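(* Let $1<p<\infty$, $\alpha\in(1/p,1]$ and $s\in\mathbb{N}$, $s\ge2$. Then $$\mathcal{H}_{\alpha,s-1,p}\otimes_{\delta_p}\mathcal{H}_{\alpha,p}=\mathcal{H}_{\alpha,s,p}$$ in the sense of equivalent norms; i.e., the functions $h(\mathbf{x},y)=\sum_{i=1}^nf_i(\mathbf{x})g_i(y)$ with $f_i\in\mathcal{H}_{\alpha,s-1,p}$, $g_i\in\mathcal{H}_{\alpha,p}$ form a dense subspace of $\mathcal{H}_{\alpha,s,p}$ on which $\delta_p(h,\mathcal{H}_{\alpha,s-1,p},\mathcal{H}_{\alpha,p})$ is equivalent to the norm of $\mathcal{H}_{\alpha,s,p}$, and the completion is identified with $\mathcal{H}_{\alpha,s,p}$.
   Context: For $d\in\mathbb{N}$ let $D=\{1,\dots,d\}$; $(x-t)_+^{\alpha-1}$ equals $(x-t)^{\alpha-1}$ if $x>t$ and $0$ otherwise; conventions $L_p([0,1]^\emptyset)=\mathbb{R}$ and $\int_{[0,1]^\emptyset}\tilde f_\emptyset=\tilde f_\emptyset$. The space of fractional smoothness $\mathcal{H}_{\alpha,d,p}$ is the set of $f:[0,1]^d\to\mathbb{R}$ of the form $f(\mathbf{x})=\sum_{u\subseteq D}\Gamma(\alpha)^{-|u|}\int_{[0,1]^u}\tilde f_u(\mathbf{t}_u)\prod_{j\in u}(x_j-t_j)_+^{\alpha-1}d\mathbf{t}_u$ with $\tilde f_u\in L_p([0,1]^u)$; the $\tilde f_u$ are uniquely determined by $f$, and the space carries any of the (mutually equivalent) norms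 $\|f\|_{\alpha,d,p,q}=(\sum_{u\subseteq D}\Gamma(\alpha)^{-q|u|}\|\tilde f_u\|^q_{L_p})^{1/q}$, $q\in[1,\infty]$. $\mathcal{H}_{\alpha,p}:=\mathcal{H}_{\alpha,1,p}$. The $p$-nuclear tensor norm of $h=\sum_{i=1}^nf_i\otimes g_i\in X\otimes Y$ (Banach spaces $X,Y$, $1<p<\infty$, $1/p+1/p'=1$) is $\delta_p(h,X,Y)=\inf\big\{(\sum_i\|f_i\|_X^p)^{1/p}\sup\{(\sum_i|\psi(g_i)|^{p'})^{1/p'}:\psi\in Y',\|\psi\|_{Y'}\le1\}\big\}$, the infimum over all representations of $h$; $X\otimes_{\delta_p}Y$ is the completion. *)

(* Defs.v *)
From HB Require Import structures.
From mathcomp Require Import all_boot all_order all_algebra.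
From mathcomp Require Import all_classical all_reals all_analysis.
Set Implicit Arguments. Unset Strict Implicit. Unset Printing Implicit Defensive.
Import Order.TTheory GRing.Theory Num.Theory.
Import numFieldNormedType.Exports.
Local Open Scope classical_set_scope.
Local Open Scope ring_scope.

Section FracSmooth.
Variable R : realType.

Definition Gamma (a : R) : R :=
  fine (\int[@lebesgue_measure R]_(t in `]0%R, +oo[%classic)
          ((t `^ (a - 1)) * expR (- t))%:E)%E.

Definition in_cube (d : nat) (x : 'I_d -> R) : Prop :=
  forall i, 0 <= x i <= 1.

(* sigma-algebra on R^d generated by the coordinates in u (product Borel
   sigma-algebra of R^u, pulled back to R^d). *)
Definition usigma (d : nat) (u : {set 'I_d}) : set (set ('I_d -> R)) :=
  <<s \bigcup_(i in [set i | i \in u])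
        preimage_set_system setT (fun x : 'I_d -> R => x i) measurable >>.

(* F is a Borel function of the coordinates t_u only *)
Definition umeasurable (d : nat) (u : {set 'I_d}) (F : ('I_d -> R) -> R) :=
  forall B : set R, measurable B -> usigma u (F @^-1` B).

Fixpoint iint (d : nat) (l : seq 'I_d) (F : ('I_d -> R) -> \bar R)
    (t : 'I_d -> R) : \bar R :=
  match l with
  | [::] => F t
  | j :: l' => (\int[@lebesgue_measure R]_(y in `[0%R, 1%R]%classic)
                 iint l' F (fun i => if i == j then y else t i))%E
  end.

(* integral over [0,1]^u of a function of t_u (coordinates outside u are
   set to 0; for u = set0 this is evaluation, i.e. int_{[0,1]^0} c = c) *)
Definition cube_int (d : nat) (u : {set 'I_d}) (F : ('I_d -> R) -> \bar R) :=
  iint (enum u) F (fun _ => 0).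

Definition Lpnorm_u (d : nat) (u : {set 'I_d}) (p : R) (F : ('I_d -> R) -> R)
  : \bar R := ((cube_int u (fun t => (`|F t| `^ p)%:E)) `^ p^-1)%E.

Definition inLp_u (d : nat) (u : {set 'I_d}) (p : R) (F : ('I_d -> R) -> R) :=
  umeasurable u F /\ (cube_int u (fun t => (`|F t| `^ p)%:E) < +oo)%E.

Definition kern (alpha x t : R) : R := if t < x then (x - t) `^ (alpha - 1) else 0.

Definition Hfun (d : nat) (alpha : R) (ft : {set 'I_d} -> ('I_d -> R) -> R)
    (x : 'I_d -> R) : R :=
  \sum_(u : {set 'I_d}) (Gamma alpha ^- #|u|) *
     fine (cube_int u (fun t => (ft u t * \prod_(j in u) kern alpha (x j) (t j))%:E)).

Definition Hrep (d : nat) (alpha p : R) (f : ('I_d -> R) -> R)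
    (ft : {set 'I_d} -> ('I_d -> R) -> R) : Prop :=
  (forall u, inLp_u u p (ft u)) /\
  (forall x, in_cube x -> f x = Hfun alpha ft x).

Definition inH (d : nat) (alpha p : R) (f : ('I_d -> R) -> R) : Prop :=
  exists ft, Hrep alpha p f ft.

Definition qsum (d : nat) (q : \bar R) (a : {set 'I_d} -> \bar R) : \bar R :=
  match q with
  | +oo%E => (\big[maxe/0%E]_(u : {set 'I_d}) a u)%E
  | r%:E => ((\sum_(u : {set 'I_d}) (a u `^ r)) `^ r^-1)%E
  | -oo%E => 0%E
  end.

(* the norm ||f||_{alpha,d,p,q}; the representation is unique, so the
   infimum over representations is the value at the unique one *)
Definition Hnorm (d : nat) (alpha p : R) (q : \bar R) (f : ('I_d -> R) -> R)
  : \bar R :=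
  ereal_inf [set qsum q (fun u => ((Gamma alpha ^- #|u|)%:E * Lpnorm_u u p (ft u))%E)
            | ft in Hrep alpha p f].

Definition dual_ball (d : nat) (alpha p : R) (q : \bar R)
    (psi : (('I_d -> R) -> R) -> R) : Prop :=
  (forall (a b : R) g1 g2, inH alpha p g1 -> inH alpha p g2 ->
      psi (fun x => a * g1 x + b * g2 x) = a * psi g1 + b * psi g2) /\
  (forall g, inH alpha p g -> (`|psi g|%:E <= Hnorm alpha p q g)%E).

Definition init_coords (s : nat) (x : 'I_s -> R) : 'I_(s - 1) -> R :=
  fun j => x (widen_ord (leq_subr 1 s) j).

Definition last_coord (s : nat) : ('I_s -> R) -> R :=
  match s return ('I_s -> R) -> R with
  | 0 => fun _ => 0
  | n.+1 => fun x => x ord_max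
  end.

Definition tens (s n : nat) (f : 'I_n -> ('I_(s - 1) -> R) -> R)
    (g : 'I_n -> ('I_1 -> R) -> R) (x : 'I_s -> R) : R :=
  \sum_(i < n) f i (init_coords x) * g i (fun _ => last_coord x).

Definition tens_rep (s : nat) (alpha p : R) (h : ('I_s -> R) -> R) (n : nat)
    (f : 'I_n -> ('I_(s - 1) -> R) -> R) (g : 'I_n -> ('I_1 -> R) -> R) :=
  (forall i, inH alpha p (f i)) /\ (forall i, inH alpha p (g i)) /\
  (forall x, in_cube x -> h x = tens f g x).

Definition in_alg_tensor (s : nat) (alpha p : R) (h : ('I_s -> R) -> R) :=
  exists n f g, @tens_rep s alpha p h n f g.

Definition delta_val (s : nat) (alpha p : R) (q : \bar R) (n : nat)
    (f : 'I_n -> ('I_(s - 1) -> R) -> R) (g : 'I_n -> ('I_1 -> R) -> R)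
  : \bar R :=
  let p' := p / (p - 1) in
  ((\sum_(i < n) Hnorm alpha p q (f i) `^ p) `^ p^-1 *
   ereal_sup [set ((\sum_(i < n) (`|psi (g i)| `^ p')%:E) `^ p'^-1)%E
             | psi in @dual_ball 1 alpha p q])%E.

Definition delta_p (s : nat) (alpha p : R) (q : \bar R) (h : ('I_s -> R) -> R)
  : \bar R :=
  ereal_inf [set delta_val alpha p q (projT2 x).1 (projT2 x).2
            | x in [set x : {n : nat & (('I_n -> ('I_(s - 1) -> R) -> R) *
                                      ('I_n -> ('I_1 -> R) -> R))%type}
                   | tens_rep alpha p h (projT2 x).1 (projT2 x).2]].
End FracSmooth.

(* Main.v *)
Require Import Defs.
From HB Require Import structures.
From mathcomp Require Import all_boot all_order all_algebra.
From mathcomp Require Import all_classical all_reals all_analysis.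
From mathcomp Require Import finmap measurable_realfun.
From mathcomp Require Import ring lra.
Import Order.TTheory GRing.Theory Num.Theory.
Import numFieldNormedType.Exports.
Set Implicit Arguments. Unset Strict Implicit. Unset Printing Implicit Defensive.
Local Open Scope classical_set_scope.
Local Open Scope ring_scope.

(* Put on [0,1] together with the extra point 2 the sum of Lebesgue measure and
   of a unit atom at 2. Its d-th power is the disjoint union of the cubes
   [0,1]^u, u a set of coordinates, so a family (f_u) of densities is a single
   function F in L_p of this product space, and f is the pairing of F with a
   product kernel. This kernel is total (by the uniqueness for Abel's integral
   equation in dimension 1, then by Fubini), hence F is unique and f |-> F is an
   isomorphism onto L_p that turns tensor products of functions into tensor
   products of densities. What remains is that delta_p is equivalent to the norm
   of L_p(m x nu) on L_p(m) (x) L_p(nu). Hoelder's inequality, applied for each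
   point of the first space, gives one half. For the other, approximate the
   second factors by step functions over one partition; normalized indicators
   of its cells have weak p'-norm at most 1, and the norm of a combination of
   them is the l_p-sum of the norms of the coefficients. *)

(** * Lebesgue spaces *)

(** The hypothesis $\alpha>1/p$ says that $(\alpha-1)p'>-1$, i.e. that the kernel lies in $L_{p'}$,
    so that the integrals defining a function of the space are pairings controlled by Hoelder's
    inequality; $\alpha\le1$ lets Abel's equation be inverted by the kernel of exponent $1-\alpha$.
    [Hnorm] is an infimum over representations, so bounding it from below rests on uniqueness of the
    density; this is why totality of the kernel has to come before any comparison of norms. The
    infimum in [delta_p] runs over exact representations of [h], so approximating the second factors
    is not enough: the errors are kept as further summands, rescaled so that they spoil neither
    factor of [delta_val]. The constants come from comparing the $q$-sum over the $2^d$ subsets with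
    the $L_p$ norm of the assembled density, once for each of the three spaces, and from a factor 4
    lost in the decomposition. *)

HB.lock Definition pint d (T : measurableType d) (R : realType)
    (m : {measure set T -> \bar R}) (p : R) (f : T -> R) : \bar R :=
  (\int[m]_x (`|f x| `^ p)%:E)%E.
Canonical pint_unlockable := Unlockable pint.unlock.

Definition inLp d (T : measurableType d) (R : realType)
    (m : {measure set T -> \bar R}) (p : R) (f : T -> R) :=
  measurable_fun [set: T] f /\ (pint m p f < +oo)%E.

(** Real-valued through [fine], which sends an infinite integral to 0; the value is the $L_p$ norm
    only under [inLp]. *)
HB.lock Definition pnorm d (T : measurableType d) (R : realType)
    (m : {measure set T -> \bar R}) (p : R) (f : T -> R) : R :=
  fine (pint m p f) `^ p^-1.
Canonical pnorm_unlockable := Unlockable pnorm.unlock.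

HB.lock Definition pairing d (T : measurableType d) (R : realType)
    (m : {measure set T -> \bar R}) (f g : T -> R) : R :=
  (\int[m]_x (f x * g x))%R.
Canonical pairing_unlockable := Unlockable pairing.unlock.

Section Lp.
Context d (T : measurableType d) (R : realType) (m : {measure set T -> \bar R}).
Implicit Types (p q : R) (f g h : T -> R).

Local Notation pint := (pint m).
Local Notation inLp := (inLp m).
Local Notation pnorm := (pnorm m).
Local Notation pairing := (pairing m).

Lemma pintE p f : pint p f = (\int[m]_x (`|f x| `^ p)%:E)%E.
Proof. by rewrite unlock. Qed.

Lemma pnorm_def p f : pnorm p f = fine (pint p f) `^ p^-1.
Proof. by rewrite unlock. Qed.

Lemma pairingE f g : pairing f g = (\int[m]_x (f x * g x))%R.
Proof. by rewrite unlock. Qed.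

Lemma pint_ge0 p f : (0 <= pint p f)%E.
Proof. by rewrite pintE; apply: integral_ge0 => x _; rewrite lee_fin powR_ge0. Qed.

Lemma pnorm_ge0 p f : 0 <= pnorm p f.
Proof. by rewrite unlock powR_ge0. Qed.

Lemma pint_fin_num p f : inLp p f -> pint p f \is a fin_num.
Proof. by move=> [_ fp]; rewrite ge0_fin_numE ?pint_ge0. Qed.

Lemma measurable_normX p f : measurable_fun [set: T] f ->
  measurable_fun [set: T] (fun x => `|f x| `^ p).
Proof.
move=> mf; apply: (measurableT_comp (measurable_powR p)).
exact: measurableT_comp.
Qed.

Lemma measurable_EnormX p f : measurable_fun [set: T] f ->
  measurable_fun [set: T] (fun x => (`|f x| `^ p)%:E).
Proof. by move=> mf; apply/measurable_EFinP/measurable_normX. Qed.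

Lemma pnorm_powR p f : 0 < p -> inLp p f -> ((pnorm p f) `^ p)%:E = pint p f.
Proof.
move=> p0 fp; rewrite pnorm_def -powRrM mulVf ?gt_eqF// powRr1 ?fine_ge0 ?pint_ge0//.
by rewrite fineK ?pint_fin_num.
Qed.

(** Bridge to the extended-real norm for which the inequalities of Hoelder and Minkowski are
    available. *)
Lemma pnormE p f : inLp p f -> (pnorm p f)%:E = 'N[m]_p%:E[EFin \o f]%E.
Proof.
move=> fp; rewrite pnorm_def Lnorm.unlock.
under eq_integral do rewrite poweR_EFin.
by rewrite -pintE -[in RHS](fineK (pint_fin_num fp)) poweR_EFin.
Qed.

Lemma inLpP p f : 0 < p -> inLp p f <->
  measurable_fun [set: T] f /\ ('N[m]_p%:E[EFin \o f] < +oo)%E.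
Proof.
move=> p0; split=> [fp|[mf fp]]; split; [exact: fp.1|by rewrite -pnormE// ltry|by []|].
have := @poweR_lty _ _ p fp.
rewrite poweR_Lnorm ?gt_eqF//.
rewrite pintE; apply; exact: fp.
Qed.

Lemma le_pint p f g : 0 <= p -> measurable_fun [set: T] f ->
  measurable_fun [set: T] g ->
  (forall x, `|f x| <= `|g x|) -> (pint p f <= pint p g)%E.
Proof.
move=> p0 mf mg fg; rewrite !pintE; apply: ge0_le_integral => //.
- exact: measurable_EnormX.
- exact: measurable_EnormX.
- by move=> x _; rewrite lee_fin ge0_ler_powR// nnegrE.
Qed.

Lemma le_inLp p f g : 0 <= p -> measurable_fun [set: T] f -> inLp p g ->
  (forall x, `|f x| <= `|g x|) -> inLp p f.
Proof.
move=> p0 mf [mg gp] fg; split=> //; apply: le_lt_trans gp.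
exact: le_pint.
Qed.

Lemma le_pnorm p f g : 0 <= p -> inLp p f -> inLp p g ->
  (pint p f <= pint p g)%E -> pnorm p f <= pnorm p g.
Proof.
move=> p0 fp gp fg; rewrite unlock ge0_ler_powR ?invr_ge0// ?nnegrE ?fine_ge0 ?pint_ge0//.
by rewrite fine_le ?pint_fin_num.
Qed.

Lemma inLp0 p : 0 < p -> inLp p (fun=> 0).
Proof.
move=> p0; split; first exact: measurable_cst.
by rewrite pintE; under eq_integral do rewrite normr0 powR0 ?gt_eqF//;
  rewrite integral0 ltry.
Qed.

Lemma inLpZ p a f : inLp p f -> inLp p (fun x => a * f x).
Proof.
move=> [mf fp]; split; first exact: measurable_funM.
rewrite pintE; under eq_integral do rewrite normrM powRM ?normr_ge0// EFinM.
rewrite ge0_integralZl_EFin ?powR_ge0//; last exact: measurable_EnormX.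
by rewrite -pintE -(fineK (pint_fin_num (conj mf fp))) -EFinM ltry.
Qed.

Lemma pintZ p a f : inLp p f -> pint p (fun x => a * f x) = ((`|a| `^ p)%:E * pint p f)%E.
Proof.
move=> [mf fp]; rewrite pintE; under eq_integral do rewrite normrM powRM ?normr_ge0// EFinM.
rewrite ge0_integralZl_EFin ?powR_ge0// ?pintE//.
exact: measurable_EnormX.
Qed.

Lemma pnormZ p a f : 0 < p -> inLp p f -> pnorm p (fun x => a * f x) = `|a| * pnorm p f.
Proof.
move=> p0 fp; rewrite unlock pintZ// -(fineK (pint_fin_num fp)) -EFinM /=.
rewrite powRM ?powR_ge0 ?fine_ge0 ?pint_ge0// -powRrM mulfV ?gt_eqF//.
by rewrite powRr1.
Qed.

Lemma inLpN p f : inLp p f -> inLp p (fun x => - f x).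
Proof.
move=> fp; have := inLpZ (-1) fp; congr (inLp _ _).
by apply/funext => x; rewrite mulN1r.
Qed.

Lemma pnormN p f : pnorm p (fun x => - f x) = pnorm p f.
Proof.
rewrite !pnorm_def (_ : pint p (fun x => - f x) = pint p f)// !pintE.
by apply: eq_integral => x _; rewrite normrN.
Qed.

Lemma inLpD p f g : 1 <= p -> inLp p f -> inLp p g -> inLp p (fun x => f x + g x).
Proof.
move=> p1 fp gp; have p0 : 0 < p by exact: lt_le_trans p1.
apply/inLpP => //; split; first exact: measurable_funD fp.1 gp.1.
apply: le_lt_trans (minkowski_EFin m fp.1 gp.1 p1) _.
by rewrite -!pnormE// -EFinD ltry.
Qed.

Lemma pnormD p f g : 1 <= p -> inLp p f -> inLp p g ->
  pnorm p (fun x => f x + g x) <= pnorm p f + pnorm p g.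
Proof.
move=> p1 fp gp; rewrite -lee_fin EFinD !pnormE//; last exact: inLpD.
exact: (minkowski_EFin m fp.1 gp.1 p1).
Qed.

Lemma inLpB p f g : 1 <= p -> inLp p f -> inLp p g -> inLp p (fun x => f x - g x).
Proof. by move=> p1 fp gp; apply: inLpD => //; exact: inLpN. Qed.

Lemma pnormB p f g : 1 <= p -> inLp p f -> inLp p g ->
  pnorm p (fun x => f x - g x) <= pnorm p f + pnorm p g.
Proof.
move=> p1 fp gp; rewrite -[X in _ <= _ + X]pnormN; apply: pnormD => //.
exact: inLpN.
Qed.

Lemma inLp_sum p I (s : seq I) (P : pred I) (F : I -> T -> R) : 1 <= p ->
  (forall i, P i -> inLp p (F i)) -> inLp p (fun x => \sum_(i <- s | P i) F i x).
Proof.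
move=> p1 FP; have p0 : 0 < p by exact: lt_le_trans p1.
elim: s => [|i s ih].
  by have := inLp0 p0; congr (inLp _ _); apply/funext => x; rewrite big_nil.
have [Pi|Pi] := boolP (P i); last first.
  by move: ih; congr (inLp _ _); apply/funext => x; rewrite big_cons (negbTE Pi).
have := inLpD p1 (FP _ Pi) ih.
by congr (inLp _ _); apply/funext => x; rewrite big_cons Pi.
Qed.

Lemma pnorm0 p : 0 < p -> pnorm p (fun=> 0) = 0.
Proof.
move=> p0; rewrite unlock pintE.
under eq_integral do rewrite normr0 powR0 ?gt_eqF//.
by rewrite integral0 powR0// gt_eqF ?invr_gt0.
Qed.

Lemma pnorm_sum p I (s : seq I) (P : pred I) (F : I -> T -> R) : 1 <= p ->
  (forall i, P i -> inLp p (F i)) ->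
  pnorm p (fun x => \sum_(i <- s | P i) F i x) <= \sum_(i <- s | P i) pnorm p (F i).
Proof.
move=> p1 FP; have p0 : 0 < p by exact: lt_le_trans p1.
elim: s => [|i s ih].
  rewrite big_nil (_ : (fun=> _) = fun=> 0); last by apply/funext => x; rewrite big_nil.
  by rewrite pnorm0.
rewrite big_cons.
have -> : (fun x => \sum_(j <- i :: s | P j) F j x) =
    fun x => (if P i then F i x else 0) + \sum_(j <- s | P j) F j x.
  by apply/funext => x; rewrite big_cons; case: ifP => //; rewrite add0r.
case: ifPn => [Pi|Pi].
  apply: le_trans (pnormD p1 (FP _ Pi) (inLp_sum s p1 FP)) _.
  by rewrite lerD2l.
rewrite (_ : (fun x => 0 + _) = fun x => \sum_(j <- s | P j) F j x)//.
by apply/funext => x; rewrite add0r.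
Qed.

Lemma ae_eq_pnorm p f g : measurable_fun setT f -> measurable_fun setT g ->
  ae_eq m setT f g -> pnorm p f = pnorm p g.
Proof.
move=> mf mg fg; rewrite !pnorm_def (_ : pint p f = pint p g)// !pintE.
apply: ge0_ae_eq_integral => //.
- exact: measurable_EnormX.
- exact: measurable_EnormX.
- by apply: filterS fg => x /= h _; rewrite (h I).
Qed.

Lemma inLp_mul p q f g : 0 < p -> 0 < q -> p^-1 + q^-1 = 1 ->
  inLp p f -> inLp q g -> m.-integrable setT (EFin \o (fun x => f x * g x)).
Proof.
move=> p0 q0 pq fp gq; apply/integrableP; split.
  by apply/measurable_EFinP; exact: measurable_funM fp.1 gq.1.
have := hoelder m fp.1 gq.1 p0 q0 pq.
rewrite -(pnormE fp) -(pnormE gq) Lnorm1 => /le_lt_trans; apply.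
by rewrite -EFinM ltry.
Qed.

Lemma pairing_hoelder p q f g : 0 < p -> 0 < q -> p^-1 + q^-1 = 1 ->
  inLp p f -> inLp q g -> `|pairing f g| <= pnorm p f * pnorm q g.
Proof.
move=> p0 q0 pq fp gq; rewrite -lee_fin EFinM (pnormE fp) (pnormE gq).
rewrite pairingE EFin_normr_Rintegral//; last exact: (inLp_mul p0 q0 pq).
apply: le_trans (hoelder m fp.1 gq.1 p0 q0 pq).
rewrite Lnorm1; apply: le_abse_integral => //.
by apply/measurable_EFinP; exact: measurable_funM fp.1 gq.1.
Qed.

End Lp.

Section Lp2.
Context d (T : measurableType d) (R : realType) (m : {measure set T -> \bar R}).
Implicit Types (p q : R) (f g h : T -> R).

Lemma pnorm_lep p f e : 0 < p -> inLp m p f -> 0 <= e ->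
  pnorm m p f <= e <-> (pint m p f <= (e `^ p)%:E)%E.
Proof.
move=> p0 fp e0; rewrite -pnorm_powR// lee_fin; split => [fe|fe].
  by rewrite ge0_ler_powR ?nnegrE ?pnorm_ge0// ltW.
rewrite -[pnorm _ _ _](@powRr1 _ _) ?pnorm_ge0// -[e]powRr1// -(mulfV (lt0r_neq0 p0)).
by rewrite !powRrM ge0_ler_powR ?nnegrE ?powR_ge0// invr_ge0 ltW.
Qed.

Lemma pnorm_ltp p f e : 0 < p -> inLp m p f -> 0 <= e ->
  pnorm m p f < e <-> (pint m p f < (e `^ p)%:E)%E.
Proof.
move=> p0 fp e0; rewrite -pnorm_powR// lte_fin; split => [fe|fe].
  by rewrite gt0_ltr_powR ?nnegrE ?pnorm_ge0.
rewrite ltNge; apply/negP => ef; move: fe; apply/negP; rewrite -leNgt.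
by rewrite ge0_ler_powR ?nnegrE ?pnorm_ge0// ltW.
Qed.

(** At a nonzero limit the power is differentiable, hence continuous. At 0 this argument fails, and
    an error below $e^{1/p}$ is seen directly to give a power below $e$. *)
Lemma cvg_normX p (u : nat -> R) (l : R) : 0 < p -> u @ \oo --> l ->
  (fun n => `|u n| `^ p) @ \oo --> `|l| `^ p.
Proof.
move=> p0 ul; have [l0|l0] := eqVneq l 0.
  rewrite l0 normr0 powR0 ?gt_eqF//; apply/cvgrPdist_lt => e e0.
  move: ul; rewrite l0 => /cvgrPdist_lt/(_ (e `^ p^-1)); rewrite powR_gt0// => /(_ isT).
  apply: filterS => n; rewrite !sub0r !normrN => h.
  rewrite ger0_norm ?powR_ge0// -[e]powRr1 ?ltW// -(mulVf (lt0r_neq0 p0)) powRrM.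
  by rewrite gt0_ltr_powR ?nnegrE// powR_ge0.
have l1 : 0 < `|l| by rewrite normr_gt0.
have h : {for `|l|, continuous (fun y : R => y `^ p)}.
  apply/differentiable_continuous/derivable1_diffP; apply: derivable_powR.
  by rewrite in_itv/= andbT.
exact: (cvg_comp _ _ (cvg_norm ul) h).
Qed.

(** Dominated convergence for $|f-f_n|^p$ with majorant $|g|^p$; a single good index is extracted,
    in the form used by density arguments. *)
Lemma dominated_inLp p f (fn : nat -> T -> R) g : 0 < p ->
  measurable_fun setT f -> (forall n, measurable_fun setT (fn n)) ->
  (forall x, fn ^~ x @ \oo --> f x) ->
  inLp m p g -> (forall n x, `|f x - fn n x| <= `|g x|) ->
  forall e, 0 < e -> exists n, inLp m p (fun x => f x - fn n x) /\
   pnorm m p (fun x => f x - fn n x) < e.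
Proof.
move=> p0 mf mfn fnf gp fng e e0.
have mB n : measurable_fun setT (fun x => f x - fn n x) by exact: measurable_funB.
have Bp n : inLp m p (fun x => f x - fn n x).
  by apply: (le_inLp _ (mB n) gp) => //; exact: ltW.
suff : (fun n => pint m p (fun x => f x - fn n x)) @ \oo --> 0%E.
  move=> /fine_cvgP[_ /cvgrPdist_lt/(_ (e `^ p))]; rewrite powR_gt0// => /(_ isT).
  move=> [n _ /(_ n)]/= /(_ (leqnn n)); rewrite sub0r normrN.
  rewrite ger0_norm ?fine_ge0 ?pint_ge0// => fe.
  exists n; split => //; apply/pnorm_ltp => //; first exact: ltW.
  by rewrite -(fineK (pint_fin_num (Bp n))) lte_fin.
have := @dominated_convergence _ T R m setT measurableT
  (fun n x => (`|f x - fn n x| `^ p)%:E) (fun=> 0%E) (fun x => (`|g x| `^ p)%:E).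
case.
- by move=> n; exact: measurable_EnormX.
- exact: measurable_cst.
- apply/aeW => x _; apply: cvg_EFin; first by apply/nearW.
  rewrite [X in X @ _ --> _](_ : _ = fun n => `|f x - fn n x| `^ p)//.
  have -> : 0 = `|f x - f x| `^ p :> R by rewrite subrr normr0 powR0 ?gt_eqF.
  by apply: cvg_normX => //; apply: cvgB => //; exact: cvg_cst.
- apply/integrableP; split; first exact: measurable_EnormX gp.1.
  have := gp.2; rewrite pintE; under [in X in _ -> X]eq_integral do
    rewrite gee0_abs ?lee_fin ?powR_ge0//.
  by [].
- apply/aeW => x n _; rewrite gee0_abs ?lee_fin ?powR_ge0//.
  by rewrite ge0_ler_powR ?nnegrE// ltW.
move=> _ _; rewrite integral0; apply: cvg_trans.
by under eq_fun do rewrite pintE.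
Qed.

End Lp2.

(** * Finite measures: density of step functions and completeness *)

Section finite.
Context d (T : measurableType d) (R : realType) (m : {measure set T -> \bar R}).
Hypothesis mfin : (m [set: T] < +oo)%E.
Import HBNNSimple.
Implicit Types (p q : R) (f g h : T -> R).

Lemma inLp_cst p c : inLp m p (fun=> c).
Proof.
split; first exact: measurable_cst.
rewrite pintE integral_cst//=; have mT : m [set: T] \is a fin_num by rewrite ge0_fin_numE.
rewrite -(fineK mT).
by rewrite -EFinM ltry.
Qed.

Lemma inLp_bounded p f (M : R) : 0 <= p -> measurable_fun setT f ->
  (forall x, `|f x| <= M) -> inLp m p f.
Proof.
move=> p0 mf fM; apply: (le_inLp p0 mf (inLp_cst p M)) => x.
by rewrite (le_trans (fM x))// ler_norm.
Qed.

(** The increasing approximation by simple functions satisfies $0\le f-f_n\le f$, so [f] itself is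
    the dominating function. *)
Lemma nnsfun_dense p f e : 0 < p -> inLp m p f -> (forall x, 0 <= f x) -> 0 < e ->
  exists g : {nnsfun T >-> R}, pnorm m p (fun x => f x - g x) < e.
Proof.
move=> p0 fp f0 e0.
have mf : measurable_fun setT (EFin \o f) by apply/measurable_EFinP; exact: fp.1.
pose fn := nnsfun_approx measurableT mf.
have f0' x : setT x -> (0 <= (EFin \o f) x)%E by rewrite lee_fin.
have cf x : (fun n => fn n x) @ \oo --> f x.
  have /(_ _ x I) := cvg_nnsfun_approx measurableT mf _; move=> /(_ f0') h.
  exact: (fine_cvg h).
have lef n x : fn n x <= f x.
  have nd : nondecreasing_seq (fun n => fn n x).
    by move=> i j ij; have /lefP := nd_nnsfun_approx measurableT mf ij; apply.
  by rewrite -(cvg_lim _ (cf x))//; apply: nondecreasing_cvgn_le => //; apply/cvg_ex; exists (f x).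
have [|||n [_ h]] := @dominated_inLp _ _ _ m p f (fun n => fn n) f p0 fp.1 _ _ fp _ e e0.
- by move=> n; exact: measurable_funP.
- exact: cf.
- move=> n x; rewrite ger0_norm ?subr_ge0// ger0_norm// lerBlDr lerDl.
  exact: (fun_ge0 (s := fn n)).
by exists (fn n).
Qed.

(** Recasts a simple function as [v] after a labelling [c] by a finite type, the label being the
    position in the list of values. With partitions encoded as labellings, a common refinement is
    the pair of two labellings. *)
Lemma nnsfun_step (g : {nnsfun T >-> R}) :
  exists (I : finType) (c : T -> I) (v : I -> R),
    (forall i, measurable (c @^-1` [set i])) /\ (forall x, g x = v (c x)).
Proof.
pose s : seq R := enum_fset (fset_set (range g)).
have gs x : g x \in s.
  have : g x \in fset_set (range g).
    rewrite in_fset_set; last exact: fimfunP.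
    by apply/mem_set; exists x.
  by [].
have cP x : (index (g x) s < size s)%N by rewrite index_mem.
exists 'I_(size s), (fun x => Ordinal (cP x)), (fun i : 'I_(size s) => nth 0 s i); split; last first.
  by move=> x; rewrite /= nth_index.
move=> i; rewrite (_ : _ @^-1` _ = g @^-1` [set nth 0 s i]).
  exact: measurable_sfunP.
apply/seteqP; split=> x /=.
  by move=> <-; rewrite /= nth_index.
move=> gi; apply/val_inj => /=; rewrite gi index_uniq ?ltn_ord//.
exact: fset_uniq.
Qed.

Lemma step_dense p f e : 1 <= p -> inLp m p f -> 0 < e ->
  exists (I : finType) (c : T -> I) (v : I -> R),
    (forall i, measurable (c @^-1` [set i])) /\
    pnorm m p (fun x => f x - v (c x)) < e.
Proof.
move=> p1 fp e0; have p0 : 0 < p by exact: lt_le_trans p1.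
have mp : inLp m p (fun x => Num.max (f x) 0).
  apply: (le_inLp (ltW p0) _ fp); first by apply: measurable_maxr => //; exact: fp.1.
  by move=> x; rewrite /Num.max; case: ifPn => // _; rewrite normr0.
have mn : inLp m p (fun x => Num.max (- f x) 0).
  apply: (le_inLp (ltW p0) _ fp).
    by apply: measurable_maxr => //; exact: measurableT_comp fp.1.
  by move=> x; rewrite /Num.max; case: ifPn; rewrite ?normr0// normrN.
have e2 : 0 < e / 2 by rewrite divr_gt0.
have [|g1 h1] := nnsfun_dense p0 mp _ e2; first by move=> x; rewrite le_max lexx orbT.
have [|g2 h2] := nnsfun_dense p0 mn _ e2; first by move=> x; rewrite le_max lexx orbT.
have [I [c [v [mc gv]]]] := nnsfun_step g1.
have [J [b [w [mb gw]]]] := nnsfun_step g2.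
exists (I * J)%type, (fun x => (c x, b x)), (fun ij => v ij.1 - w ij.2); split.
  move=> [i j]; rewrite (_ : _ @^-1` _ = c @^-1` [set i] `&` b @^-1` [set j]).
    exact: measurableI.
  by apply/seteqP; split => x /=; [case=> -> ->|case=> -> ->].
have sp (g : {nnsfun T >-> R}) : inLp m p g.
  have [M [_ hM]] := simple_bounded g.
  apply: (@inLp_bounded p g (M + 1)); [exact: ltW|exact: measurable_funP|].
  by move=> x; apply: hM => //; rewrite ltrDl.
have -> : (fun x => f x - (v (c x) - w (b x))) =
    fun x => (Num.max (f x) 0 - g1 x) - (Num.max (- f x) 0 - g2 x).
  apply/funext => x; rewrite -gv -gw.
  set a := Num.max _ _; set b' := Num.max _ _.
  have -> : f x = a - b'; last by ring.
  rewrite /a /b'.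
  by rewrite /Num.max oppr_lt0; case: ltgtP => // [||->]; rewrite ?subr0 ?sub0r ?opprK.
apply: le_lt_trans (pnormB p1 _ _) _; [exact: inLpB|exact: inLpB|].
by rewrite [e]splitr ltrD.
Qed.

Lemma inLp_integrable p q f : 0 < p -> 0 < q -> p^-1 + q^-1 = 1 ->
  inLp m p f -> m.-integrable setT (EFin \o f).
Proof.
move=> p0 q0 pq fp; have := inLp_mul p0 q0 pq fp (inLp_cst q 1).
by congr (integrable _ _ _); apply/funext => x /=; rewrite mulr1.
Qed.

(** Hoelder's inequality against the constant 1, which puts $L_p$ into $L_1$ on a finite measure
    space. *)
Lemma integral_norm_le p q f : 0 < p -> 0 < q -> p^-1 + q^-1 = 1 ->
  inLp m p f ->
  (\int[m]_x (`|f x|%:E) <= (pnorm m p f * pnorm m q (fun=> 1))%:E)%E.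
Proof.
move=> p0 q0 pq fp.
have := hoelder m fp.1 (inLp_cst q 1).1 p0 q0 pq.
rewrite -(pnormE fp) -(pnormE (inLp_cst q 1)) Lnorm1 -EFinM; apply: le_trans.
by rewrite le_eqVlt; apply/orP; left; apply/eqP; apply: eq_integral => x _ /=; rewrite mulr1.
Qed.

Lemma cauchy_subseq p (F : nat -> T -> R) :
  (forall e : R, 0 < e -> exists N, forall i k, (N <= i)%N -> (N <= k)%N ->
    pnorm m p (fun x => F i x - F k x) < e) ->
  exists n_ : nat -> nat, (forall k, (k <= n_ k)%N) /\
   forall k i, (k <= i)%N -> pnorm m p (fun x => F (n_ i) x - F (n_ k) x) < 2^-1 ^+ k.
Proof.
move=> FC; have /choice[N hN] : forall k, exists N, forall i j, (N <= i)%N -> (N <= j)%N ->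
    pnorm m p (fun x => F i x - F j x) < 2^-1 ^+ k.
  by move=> k; apply: FC; rewrite exprn_gt0.
(* A running maximum, so that every later [n_ i] also lies beyond the threshold [N k]. *)
pose n_ k := (\max_(i < k.+1) maxn i (N i))%N.
have le_n k i : (i <= k)%N -> (maxn i (N i) <= n_ k)%N.
  by move=> ik; exact: (@leq_bigmax _ (fun j : 'I_k.+1 => maxn j (N j)) (Ordinal (ik : i < k.+1)%N)).
exists n_; split => [k|k i ki].
  by apply: leq_trans (le_n k k _) => //; exact: leq_maxl.
by apply: hN; (apply: leq_trans (le_n _ k _) => //; exact: leq_maxr).
Qed.

(** By [integral_norm_le] the increments have $L_1$ norms at most $C2^{-k}$. The sum of their
    absolute values is thus integrable, hence finite almost everywhere, and there the telescoping
    series converges absolutely. *)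
Lemma cvg_series_ae p q (G : nat -> T -> R) : 1 <= p -> 0 < q -> p^-1 + q^-1 = 1 ->
  (forall k, inLp m p (G k)) ->
  (forall k, pnorm m p (fun x => G k.+1 x - G k x) < 2^-1 ^+ k) ->
  {ae m, forall x, cvgn (fun k => G k x)}.
Proof.
move=> p1 q0 pq Gp Gk; have p0 : 0 < p by exact: lt_le_trans p1.
pose D (k : nat) (x : T) : \bar R := `|G k.+1 x - G k x|%:E.
have mD k : measurable_fun setT (D k).
  apply/measurable_EFinP; apply: measurableT_comp => //.
  by apply: measurable_funB; [exact: (Gp _).1|exact: (Gp _).1].
have D0 k x : setT x -> (0 <= D k x)%E by rewrite lee_fin.
have mS : measurable_fun setT (fun x => \sum_(k <oo) D k x)%E.
  by apply: (@ge0_emeasurable_sum _ _ _ setT D xpredT) => // k x Dx _; exact: D0.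
pose C := pnorm m q (fun=> 1).
have C0 : 0 <= C by exact: pnorm_ge0.
have Soo : (\int[m]_x (\sum_(k <oo) D k x) < +oo)%E.
  rewrite integral_nneseries//.
  (* $C2^{-k}$ is written as $2C/2^{k+1}$ to match the geometric series of [epsilon_trick0]. *)
  apply: (@le_lt_trans _ _ (\sum_(k <oo) ((2 * C) / (2 ^ k.+1)%:R)%:E)%E); last first.
    by apply: le_lt_trans (@epsilon_trick0 _ (2 * C) xpredT _) _; rewrite ?mulr_ge0// ltry.
  apply: lee_nneseries => [i _ _|k _]; first by apply: integral_ge0 => x; exact: D0.
  have := integral_norm_le p0 q0 pq (inLpB p1 (Gp k.+1) (Gp k)).
  move=> /le_trans; apply; rewrite lee_fin -/C natrX exprS invfM mulrACA mulfV// mul1r mulrC.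
  by rewrite ler_wpM2l// -exprVn ltW.
have := integrable_ae (mu := m) measurableT (f := fun x => (\sum_(k <oo) D k x)%E).
case.
  apply/integrableP; split=> //; apply: le_lt_trans Soo.
  rewrite le_eqVlt; apply/orP; left; apply/eqP; apply: eq_integral => x _.
  by rewrite gee0_abs// nneseries_ge0// => k _ _; exact: D0.
move=> N [mN N0 hN]; exists N; split=> //; apply: subset_trans hN => x /= ncv h; apply: ncv.
have fin := h I.
have -> : (fun k => G k x) = (fun k => G 0%N x + series (telescope (G ^~ x)) k).
  by apply/funext => k; rewrite telescopeK/= addrC subrK.
apply: is_cvgD; first exact: is_cvg_cst.
apply: normed_cvg; apply: nondecreasing_is_cvgn.
  by apply: nondecreasing_series => n _ _; exact: normr_ge0.
exists (fine (\sum_(k <oo) D k x)%E) => _ [n _ <-].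
rewrite -lee_fin fineK//.
apply: (le_trans _ (@nneseries_lim_ge R (D ^~ x) xpredT 0 n _)); last by move=> k _ _; exact: D0.
by rewrite /series/= -sumEFin; apply: lee_sum => k _.
Qed.

Lemma Lp_complete p q (F : nat -> T -> R) : 1 <= p -> 0 < q -> p^-1 + q^-1 = 1 ->
  (forall k, inLp m p (F k)) ->
  (forall e : R, 0 < e -> exists N, forall i k, (N <= i)%N -> (N <= k)%N ->
    pnorm m p (fun x => F i x - F k x) < e) ->
  exists G, inLp m p G /\ forall e : R, 0 < e -> exists N, forall k, (N <= k)%N ->
    pnorm m p (fun x => F k x - G x) < e.
Proof.
move=> p1 q0 pq Fp FC; have p0 : 0 < p by exact: lt_le_trans p1.
have [n_ [le_n n_C]] := cauchy_subseq FC.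
pose H k := F (n_ k).
have Hcv : {ae m, forall x, cvgn (fun k => H k x)}.
  by apply: (cvg_series_ae p1 q0 pq) => k; [exact: Fp|exact: n_C].
(* The upper limit defines [G] everywhere and measurably, also on the null set where the subsequence
   diverges. *)
pose G x := fine (limn_esup (fun k => (H k x)%:E)).
have mG : measurable_fun setT G.
  apply: measurableT_comp => //; apply: measurable_fun_limn_esup => n.
  by apply/measurable_EFinP; exact: (Fp _).1.
have HG : {ae m, forall x, (fun k => H k x) @ \oo --> G x}.
  apply: filterS Hcv => x /cvg_ex[l Hl].
  have /cvg_limn_einf_sup[_] : (EFin \o (fun k => H k x)) @ \oo --> l%:E.
    by apply: cvg_EFin => //; apply/nearW.
  by move=> h; rewrite /G (_ : limn_esup _ = l%:E).
(* Fatou's lemma: a bound on $\|F_k-F_i\|_p$ for all $i\ge k$ passes to $\|F_k-G\|_p$. It yields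
   both membership of [G] in $L_p$ and convergence of the whole sequence. *)
have key e k : 0 < e -> (forall i, (k <= i)%N -> pnorm m p (fun x => F k x - F i x) < e) ->
    (pint m p (fun x => F k x - G x)%R <= (e `^ p)%:E)%E.
  move=> e0 hk.
  rewrite pintE.
  have : (\int[m]_x (`|F k x - G x| `^ p)%:E <=
    \int[m]_x (limn_einf (fun i => (`|F k x - H i x| `^ p)%:E)))%E.
    apply: ae_ge0_le_integral => //.
    - by apply: measurable_EnormX; apply: measurable_funB => //; exact: (Fp _).1.
    - move=> x _; rewrite limn_einf_lim; apply: lime_ge; first exact: is_cvg_einfs.
      apply: nearW => n; apply: le_ereal_inf_tmp => _ [j /= _ <-].
      by rewrite lee_fin powR_ge0.
    - rewrite (_ : (fun _ => _) =
          (fun x => - limn_esup (fun i => - (`|F k x - H i x| `^ p)%:E))%E); last first.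
        apply/funext => x; rewrite -limn_einfN; congr (limn_einf _).
        by apply/funext => i; rewrite /comp oppeK.
      apply: measurableT_comp => //; apply: measurable_fun_limn_esup => n.
      apply: measurableT_comp => //; apply: measurable_EnormX.
      by apply: measurable_funB; [exact: (Fp _).1|exact: (Fp _).1].
    - apply: filterS HG => x HGx _.
      have /cvg_limn_einf_sup[-> _//] : (fun i => (`|F k x - H i x| `^ p)%:E) @ \oo -->
        (`|F k x - G x| `^ p)%:E.
      apply: cvg_EFin; first by apply/nearW.
      by apply: cvg_normX => //; apply: cvgB => //; exact: cvg_cst.
  move=> /le_trans; apply.
  apply: le_trans (fatou _ _ _ _) _ => //.
    by move=> n; apply: measurable_EnormX; apply: measurable_funB; [exact: (Fp _).1|exact: (Fp _).1].
  rewrite limn_einf_lim; apply: lime_le; first exact: is_cvg_einfs.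
  apply: nearW => n.
  apply: (@le_trans _ _ (pint m p (fun x => F k x - H (maxn n k) x))).
    by apply: ereal_inf_lbound; exists (maxn n k) => /=; [exact: leq_maxl|rewrite pintE].
  apply/(pnorm_lep p0 (inLpB p1 (Fp _) (Fp _)) (ltW e0)).
  by apply/ltW/hk; rewrite (leq_trans _ (le_n _))// leq_maxr.
have Gp : inLp m p G.
  have [N hN] := FC 1 ltr01.
  have h : inLp m p (fun x => F N x - G x).
    split; first by apply: measurable_funB => //; exact: (Fp _).1.
    by apply: le_lt_trans (key 1 N ltr01 _) _; [move=> i Ni; exact: hN|exact: ltry].
  have := inLpB p1 (Fp N) h; congr (inLp _ _ _).
  by apply/funext => x; rewrite subKr.
exists G; split => // e e0.
have e2 : 0 < e / 2 by rewrite divr_gt0.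
have [N hN] := FC _ e2; exists N => k Nk.
apply: (@le_lt_trans _ _ (e / 2)); last by rewrite ltr_pdivrMr// ltr_pMr// ltr1n.
apply/(pnorm_lep p0 (inLpB p1 (Fp _) Gp) (ltW e2)).
by apply: key => // i ki; apply: hN => //; exact: leq_trans ki.
Qed.

End finite.

(** * Duality and products *)

(** The sets over which [f] integrates to 0 form a Dynkin system; complements are covered because
    the total integral vanishes. *)
Lemma pi_system_ae0 d (T : measurableType d) (R : realType)
    (m : {measure set T -> \bar R}) (G : set_system T) (f : T -> \bar R) :
  @measurable _ T = <<s G >> -> setI_closed G -> m.-integrable setT f ->
  (\int[m]_x f x = 0)%E -> (forall A, G A -> \int[m]_(x in A) f x = 0)%E ->
  ae_eq m setT f (fun=> 0%E).
Proof.
move=> GE GI fi f0 fG.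
have iS A : measurable A -> m.-integrable A f.
  by move=> mA; apply: integrableS fi.
suff h A : measurable A -> (\int[m]_(x in A) f x = 0)%E.
  apply: integral_ae_eq => // A _ mA.
  by rewrite h// integral0.
move=> mA; have : <<s G >> A by rewrite -GE.
apply: (dynkin_induction (P := fun A => \int[m]_(x in A) f x = 0)%E GE GI) => //.
- move=> B mB B0; have mCB := measurableC mB.
  have := @integral_setU _ _ _ m B (~` B) f mB mCB.
  rewrite setUv f0 B0 add0e => <- //; first exact: measurable_int fi.
  by apply/disj_setPS => x [].
- move=> F mF tF F0; rewrite integral_bigcup//.
    by rewrite eseries0.
  by apply: iS; exact: bigcup_measurable.
Qed.

(** Induction from the inequality for two terms: the tail of each sum is regarded as a power of its
    own norm. *)
Lemma sum_hoelder (R : realType) I (s : seq I) (a b : I -> R) (p q : R) :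
  0 < p -> 0 < q -> p^-1 + q^-1 = 1 ->
  \sum_(i <- s) `|a i| * `|b i| <=
  (\sum_(i <- s) `|a i| `^ p) `^ p^-1 * (\sum_(i <- s) `|b i| `^ q) `^ q^-1.
Proof.
move=> p0 q0 pq; elim: s => [|i s ih].
  by rewrite !big_nil mulr_ge0 ?powR_ge0.
have S0 (c : I -> R) r : 0 <= \sum_(j <- s) `|c j| `^ r.
  by apply: sumr_ge0 => j _; exact: powR_ge0.
rewrite !big_cons.
have K (c : I -> R) r : 0 < r ->
    \sum_(j <- s) `|c j| `^ r = ((\sum_(j <- s) `|c j| `^ r) `^ r^-1) `^ r.
  by move=> r0; rewrite -powRrM mulVf ?gt_eqF// powRr1.
rewrite [in leRHS](K a p)// [in leRHS](K b q)//.
apply: le_trans (hoelder2 _ _ _ _ p0 q0 pq); rewrite ?powR_ge0//.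
by rewrite lerD2l.
Qed.

Section duality.
Context d (T : measurableType d) (R : realType) (m : {measure set T -> \bar R}).
Variables (p q : R).
Hypotheses (p1 : 1 < p) (q0 : 0 < q) (pq : p^-1 + q^-1 = 1).
Let p0 : 0 < p. Proof. exact: lt_trans p1. Qed.

Lemma conj_mul : (p - 1) * q = p.
Proof.
have : (p^-1 + q^-1) * (p * q) = p * q by rewrite pq mul1r.
rewrite mulrDl mulrA mulVf ?gt_eqF// mul1r mulrCA mulVf ?gt_eqF// mulr1 => h.
by rewrite mulrBl mul1r -h addrC addKr.
Qed.

Lemma pairingDl f g h : inLp m p f -> inLp m p g -> inLp m q h ->
  pairing m (fun x => f x + g x) h = pairing m f h + pairing m g h.
Proof.
move=> fp gp hq; rewrite !pairingE -RintegralD//;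
  [|exact: (inLp_mul p0 q0 pq)|exact: (inLp_mul p0 q0 pq)].
by apply: eq_Rintegral => x _; rewrite mulrDl.
Qed.

Lemma pairingZl a f h : inLp m p f -> inLp m q h ->
  pairing m (fun x => a * f x) h = a * pairing m f h.
Proof.
move=> fp hq; rewrite !pairingE -RintegralZl//; last exact: (inLp_mul p0 q0 pq).
by apply: eq_Rintegral => x _; rewrite mulrA.
Qed.

Lemma pairing_suml I (s : seq I) (F : I -> T -> R) h :
  (forall i, inLp m p (F i)) -> inLp m q h ->
  pairing m (fun x => \sum_(i <- s) F i x) h = \sum_(i <- s) pairing m (F i) h.
Proof.
move=> Fp hq; elim: s => [|i s ih].
  rewrite big_nil pairingE; under eq_Rintegral do rewrite big_nil mul0r.
  by rewrite Rintegral_cst// mul0r.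
rewrite big_cons -ih -pairingDl//; last exact: (inLp_sum s (ltW p1)).
by congr pairing; apply/funext => x; rewrite big_cons.
Qed.

Lemma ae_eq_pairing f g h : inLp m p f -> inLp m p g -> inLp m q h ->
  ae_eq m setT f g -> pairing m f h = pairing m g h.
Proof.
move=> fp gp hq fg; rewrite !pairingE /Rintegral; congr fine.
apply: ae_eq_integral => //.
- by apply: measurable_int (inLp_mul p0 q0 pq fp hq).
- by apply: measurable_int (inLp_mul p0 q0 pq gp hq).
- by apply: filterS fg => x /= hx _; rewrite hx.
Qed.

(** Equality in Hoelder's inequality is attained at a multiple of $\mathrm{sgn}(f)|f|^{p-1}$,
    written below as $f|f|^{p-2}$; both expressions vanish where [f] does. *)
Lemma pnorm_dual f : inLp m p f -> exists g, inLp m q g /\ pnorm m q g <= 1 /\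
  pairing m f g = pnorm m p f.
Proof.
move=> fp; have [N0|N0] := eqVneq (pnorm m p f) 0.
  exists (fun=> 0); rewrite N0; split; first exact: inLp0.
  split; first by rewrite pnorm0.
  rewrite pairingE; under eq_Rintegral do rewrite mulr0.
  by rewrite Rintegral_cst// mul0r.
set N := pnorm m p f in N0 *.
have Np : 0 < N by rewrite lt0r N0 pnorm_ge0.
pose g x := f x * `|f x| `^ (p - 1 - 1) / N `^ (p - 1).
have p10 : 0 < p - 1 by rewrite subr_gt0.
have mg : measurable_fun setT g.
  apply: measurable_funM => //; apply: measurable_funM; first exact: fp.1.
  by apply: measurable_normX; exact: fp.1.
have gE x : `|g x| `^ q = (N `^ p)^-1 * `|f x| `^ p.
  rewrite /g normrM normrM (ger0_norm (powR_ge0 _ _)) mulr_powRB1//.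
  rewrite normfV (ger0_norm (powR_ge0 _ _)) powRM ?invr_ge0 ?powR_ge0//.
  by rewrite -[(N `^ (p - 1))^-1]powRN -!powRrM mulNr conj_mul powRN mulrC.
have pg : pint m q g = 1%E.
  rewrite pintE; under eq_integral do rewrite gE EFinM.
  rewrite ge0_integralZl_EFin ?invr_ge0 ?powR_ge0//; last exact: measurable_EnormX fp.1.
  by rewrite -pintE -pnorm_powR// -EFinM mulVf// gt_eqF// powR_gt0.
have gq : inLp m q g by split => //; rewrite pg ltry.
exists g; split => //; split; first by rewrite pnorm_def pg powR1.
rewrite pairingE /Rintegral.
rewrite (_ : (\int[m]_x _)%E = ((N `^ (p - 1))^-1)%:E * pint m p f)%E.
  rewrite -pnorm_powR// -EFinM /= -/N -powRN -powRD ?N0 ?implybT//.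
  by rewrite opprB subrK powRr1// ltW.
rewrite pintE -ge0_integralZl_EFin ?invr_ge0 ?powR_ge0//; last exact: measurable_EnormX fp.1.
apply: eq_integral => x _; rewrite -EFinM; congr EFin.
rewrite /g mulrA mulrC; congr (_ * _).
by rewrite mulrA -expr2 -real_normK ?num_real// expr2 -mulrA mulr_powRB1// mulr_powRB1.
Qed.

End duality.

Lemma finite_measure_lty d (T : measurableType d) (R : realType)
  (m : {finite_measure set T -> \bar R}) : (m setT < +oo)%E.
Proof. by rewrite -ge0_fin_numE// fin_num_measure. Qed.

Lemma product_measure_lty d1 d2 (S : measurableType d1) (T : measurableType d2)
  (R : realType) (m1 : {finite_measure set S -> \bar R}) (m2 : {finite_measure set T -> \bar R}) :
  ((m1 \x m2) setT < +oo)%E.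
Proof.
by rewrite -setXTT product_measure1E// -ge0_fin_numE ?mule_ge0// fin_numM// fin_num_measure.
Qed.

(** * Products of two measure spaces and partial pairings *)

Section tensor.
Context d1 d2 (S : measurableType d1) (T : measurableType d2) (R : realType).
Variables (m1 : {finite_measure set S -> \bar R}) (m2 : {finite_measure set T -> \bar R}).
Variables (p q : R).
Hypotheses (p1 : 1 < p) (q1 : 1 < q) (pq : p^-1 + q^-1 = 1).
Let p0 : 0 < p. Proof. exact: lt_trans p1. Qed.
Let q0 : 0 < q. Proof. exact: lt_trans q1. Qed.

Definition tensor (f : S -> R) (g : T -> R) (z : S * T) : R := f z.1 * g z.2.

Lemma measurable_tensor f g : measurable_fun setT f -> measurable_fun setT g ->
  measurable_fun setT (tensor f g).
Proof.
move=> mf mg; apply: measurable_funM.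
  by apply: (measurableT_comp mf); exact: measurable_fst.
by apply: (measurableT_comp mg); exact: measurable_snd.
Qed.

Lemma pint_prod r h : measurable_fun setT h ->
  pint (m1 \x m2)%E r h = (\int[m1]_x pint m2 r (fun y => h (x, y)))%E.
Proof.
move=> mh; rewrite pintE fubini_tonelli1//.
- by apply: eq_integral => x _; rewrite pintE.
- exact: measurable_EnormX.
Qed.

Lemma pint_tensor r f g : 0 < r -> inLp m1 r f -> inLp m2 r g ->
  pint (m1 \x m2)%E r (tensor f g) = (pint m1 r f * pint m2 r g)%E.
Proof.
move=> r0 fr gr; rewrite pint_prod; last exact: measurable_tensor fr.1 gr.1.
transitivity (\int[m1]_x ((`|f x| `^ r)%:E * pint m2 r g))%E.
  by apply: eq_integral => x _; rewrite -pintZ.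
rewrite ge0_integralZr ?pintE//.
- exact: measurable_EnormX fr.1.
- by rewrite -pintE pint_ge0.
Qed.

Lemma inLp_tensor r f g : 0 < r -> inLp m1 r f -> inLp m2 r g ->
  inLp (m1 \x m2)%E r (tensor f g).
Proof.
move=> r0 fr gr; split; first exact: measurable_tensor fr.1 gr.1.
rewrite pint_tensor// -(fineK (pint_fin_num fr)) -(fineK (pint_fin_num gr)).
by rewrite -EFinM ltry.
Qed.

Lemma pnorm_tensor r f g : 0 < r -> inLp m1 r f -> inLp m2 r g ->
  pnorm (m1 \x m2)%E r (tensor f g) = pnorm m1 r f * pnorm m2 r g.
Proof.
move=> r0 fr gr; rewrite !pnorm_def pint_tensor// fineM ?pint_fin_num//.
by rewrite powRM ?fine_ge0 ?pint_ge0.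
Qed.

Lemma pairing_tensor f g k l : inLp m1 p f -> inLp m2 p g -> inLp m1 q k ->
  inLp m2 q l ->
  pairing (m1 \x m2)%E (tensor f g) (tensor k l) = pairing m1 f k * pairing m2 g l.
Proof.
move=> fp gp kq lq; rewrite !pairingE /Rintegral.
have ifk := inLp_mul p0 q0 pq fp kq.
have igl := inLp_mul p0 q0 pq gp lq.
have it := inLp_mul p0 q0 pq (inLp_tensor p0 fp gp) (inLp_tensor q0 kq lq).
rewrite -(integral12_prod_meas1 it)/=.
transitivity (fine (\int[m1]_x ((f x * k x)%:E * \int[m2]_y (g y * l y)%:E)))%E.
  congr fine; apply: eq_integral => x _; rewrite /fubini_F -integralZl//.
  by apply: eq_integral => y _; rewrite /= /tensor/= -EFinM mulrACA.
rewrite -{1}(fineK (integrable_fin_num measurableT igl)) integralZr//.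
by rewrite fineM// integrable_fin_num.
Qed.

(* [h] in L_p(S x T) is integrated against [k] in L_q(T) for almost all [x];
   elsewhere [pairing] returns a junk value. *)
Lemma partial_pairing2 h k : inLp (m1 \x m2)%E p h -> inLp m2 q k ->
  inLp m1 p (fun x => pairing m2 (fun y => h (x, y)) k) /\
  (forall l, inLp m1 q l ->
   pairing m1 (fun x => pairing m2 (fun y => h (x, y)) k) l =
   pairing (m1 \x m2)%E h (tensor l k)).
Proof.
move=> hp kq.
have one : inLp m1 q (fun=> 1) by exact: inLp_cst (finite_measure_lty m1) _ _.
(* The partial pairing is a Fubini section of [h] times $1\otimes k$. Finiteness of [m1] makes this
   product integrable, and measurability in [x] follows. *)
have ih := inLp_mul p0 q0 pq hp (inLp_tensor q0 one kq).
have mP : measurable_fun setT (fun x => pairing m2 (fun y => h (x, y)) k).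
  have -> : (fun x => pairing m2 (fun y => h (x, y)) k) =
      fine \o fubini_F m2 (EFin \o (fun z => h z * tensor (fun=> 1) k z)).
    apply/funext => x; rewrite pairingE /Rintegral /fubini_F /=; congr fine.
    by apply: eq_integral => y _; rewrite /tensor /= mul1r.
  by apply: measurableT_comp => //; exact: (measurable_fubini_F ih).
have mh x : measurable_fun setT (fun y => h (x, y)).
  exact: measurable_fun_pair2 hp.1.
have mpint : measurable_fun setT (fun x => pint m2 p (fun y => h (x, y))).
  rewrite (_ : (fun _ => _) = fubini_F m2 (fun z => (`|h z| `^ p)%:E)).
    apply: measurable_fun_fubini_tonelli_F.
      by apply: measurable_EnormX; exact: hp.1.
    by move=> z; rewrite lee_fin powR_ge0.
  by apply/funext => x; rewrite pintE.
have aeh : {ae m1, forall x, inLp m2 p (fun y => h (x, y))}.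
  have := @integrable_ae _ _ _ m1 setT measurableT (fun x => pint m2 p (fun y => h (x, y))).
  case.
    apply/integrableP; split => //.
    under eq_integral do rewrite gee0_abs ?pint_ge0//.
    by rewrite -pint_prod; [exact: hp.2|exact: hp.1].
  move=> N [mN N0 hN]; exists N; split => //; apply: subset_trans hN => x /= nh h'.
  by apply: nh; split => //; have := h' I; rewrite ge0_fin_numE ?pint_ge0.
split.
  split=> //; rewrite pintE.
  apply: (@le_lt_trans _ _ (\int[m1]_x (pint m2 p (fun y => h (x, y)) * (pnorm m2 q k `^ p)%:E))%E).
    apply: ae_ge0_le_integral => //.
    - exact: measurable_EnormX.
    - by move=> x _; rewrite mule_ge0 ?pint_ge0 ?lee_fin ?powR_ge0.
    - by apply: emeasurable_funM => //; exact: measurable_cst.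
    - apply: filterS aeh => x hx _.
      rewrite -pnorm_powR// -EFinM lee_fin -powRM ?pnorm_ge0//.
      apply: ge0_ler_powR; rewrite ?nnegrE ?mulr_ge0 ?pnorm_ge0 ?normr_ge0//.
        exact: ltW.
      exact: pairing_hoelder.
  rewrite ge0_integralZr ?lee_fin ?powR_ge0//; last by move=> x _; rewrite pint_ge0.
  by rewrite -(pint_prod p hp.1) -(fineK (pint_fin_num hp)) -EFinM ltry.
move=> l lq; rewrite [in LHS]pairingE [in RHS]pairingE /Rintegral; congr fine.
have it := inLp_mul p0 q0 pq hp (inLp_tensor q0 lq kq).
rewrite -(integral12_prod_meas1 it)/=; apply: ae_eq_integral => //.
- by apply/measurable_EFinP; apply: measurable_funM => //; exact: lq.1.
- exact: (measurable_fubini_F it).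
- apply: filterS aeh => x hx _.
  have ihk := inLp_mul p0 q0 pq hx kq.
  rewrite /fubini_F pairingE /Rintegral EFinM fineK ?integrable_fin_num//.
  rewrite -integralZr//; apply: eq_integral => y _.
  by rewrite /tensor /= -EFinM; congr EFin; ring.
Qed.

(** The mirror image of [partial_pairing2]; [total_prod] integrates out the two variables in both
    orders. *)
Lemma partial_pairing1 h k : inLp (m1 \x m2)%E p h -> inLp m1 q k ->
  inLp m2 p (fun y => pairing m1 (fun x => h (x, y)) k) /\
  (forall l, inLp m2 q l ->
   pairing m2 (fun y => pairing m1 (fun x => h (x, y)) k) l =
   pairing (m1 \x m2)%E h (tensor k l)).
Proof.
move=> hp kq.
have one : inLp m2 q (fun=> 1) by exact: inLp_cst (finite_measure_lty m2) _ _.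
have ih := inLp_mul p0 q0 pq hp (inLp_tensor q0 kq one).
have mP : measurable_fun setT (fun y => pairing m1 (fun x => h (x, y)) k).
  have -> : (fun y => pairing m1 (fun x => h (x, y)) k) =
      fine \o fubini_G m1 (EFin \o (fun z => h z * tensor k (fun=> 1) z)).
    apply/funext => y; rewrite pairingE /Rintegral /fubini_G /=; congr fine.
    by apply: eq_integral => x _; rewrite /tensor /= mulr1.
  by apply: measurableT_comp => //; exact: (measurable_fubini_G ih).
have mh y : measurable_fun setT (fun x => h (x, y)).
  exact: measurable_fun_pair1 hp.1.
have mhE : measurable_fun setT (fun z => (`|h z| `^ p)%:E).
  by apply: measurable_EnormX; exact: hp.1.
have mpint : measurable_fun setT (fun y => pint m1 p (fun x => h (x, y))).
  rewrite (_ : (fun _ => _) = fubini_G m1 (fun z => (`|h z| `^ p)%:E)).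
    by apply: measurable_fun_fubini_tonelli_G => // z; rewrite lee_fin powR_ge0.
  by apply/funext => x; rewrite pintE.
have pE : pint (m1 \x m2)%E p h = (\int[m2]_y pint m1 p (fun x => h (x, y)))%E.
  rewrite pintE fubini_tonelli2//.
  by apply: eq_integral => x _; rewrite pintE.
have aeh : {ae m2, forall y, inLp m1 p (fun x => h (x, y))}.
  have := @integrable_ae _ _ _ m2 setT measurableT (fun y => pint m1 p (fun x => h (x, y))).
  case.
    apply/integrableP; split => //.
    under eq_integral do rewrite gee0_abs ?pint_ge0//.
    by rewrite -pE; exact: hp.2.
  move=> N [mN N0 hN]; exists N; split => //; apply: subset_trans hN => x /= nh h'.
  by apply: nh; split => //; have := h' I; rewrite ge0_fin_numE ?pint_ge0.
split.
  split=> //; rewrite pintE.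
  apply: (@le_lt_trans _ _ (\int[m2]_y (pint m1 p (fun x => h (x, y)) * (pnorm m1 q k `^ p)%:E))%E).
    apply: ae_ge0_le_integral => //.
    - exact: measurable_EnormX.
    - by move=> x _; rewrite mule_ge0 ?pint_ge0 ?lee_fin ?powR_ge0.
    - by apply: emeasurable_funM => //; exact: measurable_cst.
    - apply: filterS aeh => x hx _.
      rewrite -pnorm_powR// -EFinM lee_fin -powRM ?pnorm_ge0//.
      apply: ge0_ler_powR; rewrite ?nnegrE ?mulr_ge0 ?pnorm_ge0 ?normr_ge0//.
        exact: ltW.
      exact: pairing_hoelder.
  rewrite ge0_integralZr ?lee_fin ?powR_ge0//; last by move=> x _; rewrite pint_ge0.
  by rewrite -pE -(fineK (pint_fin_num hp)) -EFinM ltry.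
move=> l lq; rewrite [in LHS]pairingE [in RHS]pairingE /Rintegral; congr fine.
have it := inLp_mul p0 q0 pq hp (inLp_tensor q0 kq lq).
rewrite -(integral21_prod_meas1 it)/=; apply: ae_eq_integral => //.
- by apply/measurable_EFinP; apply: measurable_funM => //; exact: lq.1.
- exact: (measurable_fubini_G it).
- apply: filterS aeh => x hx _.
  have ihk := inLp_mul p0 q0 pq hx kq.
  rewrite /fubini_G pairingE /Rintegral EFinM fineK ?integrable_fin_num//.
  rewrite -integralZr//; apply: eq_integral => y _.
  by rewrite /tensor /= -EFinM; congr EFin; ring.
Qed.

End tensor.

(** * Total kernels and tensor products of Lebesgue spaces *)

Section total.
Context d (T : measurableType d) (R : realType) (m : {measure set T -> \bar R}).

(** Totality in dual form: only the zero element of $L_p$ annihilates all the [K x]. This is the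
    form that makes the density of a function unique. *)
Definition total_kernel (p q : R) (X : Type) (dom : X -> Prop) (K : X -> T -> R) :=
  (forall x, dom x -> inLp m q (K x)) /\
  (forall F, inLp m p F -> (forall x, dom x -> pairing m F (K x) = 0) ->
    ae_eq m setT F (fun=> 0)).

End total.

Lemma inLp_indic d (U : measurableType d) (R : realType)
    (m : {measure set U -> \bar R}) r (A : set U) : (m setT < +oo)%E ->
  0 < r -> measurable A -> inLp m r (\1_A : U -> R).
Proof.
move=> mfin r0 mA; apply: (inLp_bounded mfin (M := 1) (ltW r0)) => //.
by move=> x; rewrite indicE; case: (_ \in _) => /=; rewrite ?normr1 ?normr0.
Qed.

Section tensor_norm.
Context d1 d2 (S : measurableType d1) (T : measurableType d2) (R : realType).
Variables (m1 : {finite_measure set S -> \bar R}) (m2 : {finite_measure set T -> \bar R}).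
Variables (p q : R).
Hypotheses (p1 : 1 < p) (q1 : 1 < q) (pq : p^-1 + q^-1 = 1).
Let p0 : 0 < p. Proof. exact: lt_trans p1. Qed.
Let q0 : 0 < q. Proof. exact: lt_trans q1. Qed.
Let p1' : 1 <= p. Proof. exact: ltW. Qed.
Let fin1 := finite_measure_lty m1.
Let fin2 := finite_measure_lty m2.
Let finp := product_measure_lty m1 m2.

Let rects : set_system (S * T) :=
  [set A `*` B | A in @measurable _ S & B in @measurable _ T].

Let rectsE : @measurable _ (S * T)%type = <<s rects >>.
Proof. exact: measurable_prod_measurableType. Qed.

Let rectsI : setI_closed rects.
Proof.
move=> _ _ [A mA [B mB <-]] [A' mA' [B' mB' <-]].
by rewrite -setXI; exists (A `&` A'); [exact: measurableI|exists (B `&` B') => //; exact: measurableI].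
Qed.

(** Pairing [F] with [K x] in the first variable leaves a function of [t] annihilated by all [L y],
    so it vanishes off a null set that depends on [x]. To avoid uniting these null sets, it is
    integrated over a measurable [B]: the function of [s] obtained by integrating [F] over [B] is
    then annihilated by every [K x]. So [F] integrates to 0 over rectangles, which form a generating
    pi-system. *)
Lemma total_prod X Y (dX : X -> Prop) (dY : Y -> Prop) K L :
  total_kernel m1 p q dX K -> total_kernel m2 p q dY L ->
  total_kernel (m1 \x m2)%E p q (fun xy : X * Y => dX xy.1 /\ dY xy.2)
    (fun xy => tensor (K xy.1) (L xy.2)).
Proof.
move=> [Kq tK] [Lq tL]; split.
  by move=> [x y] /= [dx dy]; apply: inLp_tensor => //; [exact: Kq|exact: Lq].
move=> F Fp FKL.
have Gx0 x : dX x -> ae_eq m2 setT (fun t => pairing m1 (fun s => F (s, t)) (K x)) (fun=> 0).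
  move=> dx; have [Gp Gl] := partial_pairing1 p1 q1 pq Fp (Kq _ dx).
  apply: tL => // y dy; rewrite Gl; last exact: Lq.
  exact: (FKL (x, y)).
have FB0 B : measurable B ->
    ae_eq m1 setT (fun s => pairing m2 (fun t => F (s, t)) \1_B) (fun=> 0).
  move=> mB; have Bq := inLp_indic fin2 q0 mB.
  have [Pp Pl] := partial_pairing2 p1 q1 pq Fp Bq.
  apply: tK => // x dx; rewrite Pl; last exact: Kq.
  have [Gp <-] := partial_pairing1 p1 q1 pq Fp (Kq _ dx) => //.
  rewrite (ae_eq_pairing p1 q0 pq Gp (inLp0 _ p0) Bq (Gx0 _ dx)).
  by rewrite pairingE; under eq_Rintegral do rewrite mul0r; rewrite Rintegral_cst// mul0r.
have rect0 A B : measurable A -> measurable B ->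
    pairing (m1 \x m2)%E F (tensor \1_A \1_B) = 0.
  move=> mA mB; have Aq := inLp_indic fin1 q0 mA.
  have [Pp <-] := partial_pairing2 p1 q1 pq Fp (inLp_indic fin2 q0 mB) => //.
  rewrite (ae_eq_pairing p1 q0 pq Pp (inLp0 _ p0) Aq (FB0 _ mB)).
  by rewrite pairingE; under eq_Rintegral do rewrite mul0r; rewrite Rintegral_cst// mul0r.
have iF : (m1 \x m2)%E.-integrable setT (EFin \o F) by exact: (inLp_integrable finp p0 q0 pq Fp).
have rect0' A B : measurable A -> measurable B -> (\int[m1 \x m2]_(z in A `*` B) (F z)%:E = 0)%E.
  move=> mA mB; have mAB : measurable (A `*` B) by exact: measurableX.
  have iAB : (m1 \x m2)%E.-integrable (A `*` B) (EFin \o F) by exact: integrableS iF.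
  apply/eqP; rewrite -fine_eq0 ?integrable_fin_num//; apply/eqP.
  have := rect0 A B mA mB; rewrite pairingE /Rintegral => <-; congr fine.
  rewrite [LHS]integral_mkcond; apply: eq_integral => z _.
  have -> : F z * tensor \1_A \1_B z = if z \in A `*` B then F z else 0.
    rewrite in_setX /tensor !indicE; do 2 case: (_ \in _) => /=;
    by rewrite ?(mulr0, mul0r, mulr1).
  by rewrite patchE; case: ifP.
have F0 : ae_eq (m1 \x m2)%E setT (EFin \o F) (fun=> 0%E).
  apply: (@pi_system_ae0 _ _ _ _ rects) => //.
    by rewrite -setXTT; exact: rect0'.
  by move=> _ [A mA [B mB <-]]; exact: rect0'.
by apply: filterS F0 => z /= h _; have [] := h I.
Qed.

(** [W] bounds the weak $\ell_q$ norm of the [g i], tested on the unit ball of $L_q$. The norming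
    function [k] depends on the point [s], but only the bound that it yields is integrated, so no
    measurable choice is involved. *)
Lemma pnorm_tensor_sum (I : finType) (f : I -> S -> R) (g : I -> T -> R) (W : R) :
  (forall i, inLp m1 p (f i)) -> (forall i, inLp m2 p (g i)) -> 0 <= W ->
  (forall k, inLp m2 q k -> pnorm m2 q k <= 1 ->
    (\sum_i `|pairing m2 (g i) k| `^ q) `^ q^-1 <= W) ->
  pnorm (m1 \x m2)%E p (fun z => \sum_i tensor (f i) (g i) z) <=
  (\sum_i pnorm m1 p (f i) `^ p) `^ p^-1 * W.
Proof.
move=> fp gp W0 hW; have tp i : inLp (m1 \x m2)%E p (tensor (f i) (g i)) by exact: inLp_tensor.
have sp := inLp_sum (index_enum I) (P := xpredT) p1' (fun i _ => tp i).
have Sf0 s : 0 <= \sum_i `|f i s| `^ p by apply: sumr_ge0 => i _; exact: powR_ge0.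
have Sn0 : 0 <= \sum_i pnorm m1 p (f i) `^ p by apply: sumr_ge0 => i _; exact: powR_ge0.
have sec s : inLp m2 p (fun t => \sum_i f i s * g i t).
  by apply: inLp_sum => // i _; exact: inLpZ.
have key s : pnorm m2 p (fun t => \sum_i f i s * g i t) <= (\sum_i `|f i s| `^ p) `^ p^-1 * W.
  have [k [kq [k1 <-]]] := pnorm_dual p1 q0 pq (sec s).
  rewrite (pairing_suml p1 q0 pq)//; last by move=> i; exact: inLpZ.
  under eq_bigr do rewrite (pairingZl p1 q0 pq)//.
  apply: (@le_trans _ _ (\sum_i `|f i s| * `|pairing m2 (g i) k|)).
    by apply: ler_sum => i _; rewrite -normrM ler_norm.
  apply: (le_trans (sum_hoelder _ _ _ p0 q0 pq)).
  by rewrite ler_wpM2l ?powR_ge0// hW.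
apply/pnorm_lep => //; first by rewrite mulr_ge0// powR_ge0.
rewrite pint_prod; last exact: sp.1.
rewrite powRM ?powR_ge0// -powRrM mulVf ?gt_eqF// powRr1//.
apply: (@le_trans _ _ (\int[m1]_s ((\sum_i `|f i s| `^ p) * W `^ p)%:E)%E).
  apply: ge0_le_integral => //.
  - by move=> s _; exact: pint_ge0.
  - rewrite (_ : (fun _ => _) = fubini_F m2 (fun z => (`|\sum_i tensor (f i) (g i) z| `^ p)%:E)).
      apply: measurable_fun_fubini_tonelli_F.
        by apply: measurable_EnormX; exact: sp.1.
      by move=> z; rewrite lee_fin powR_ge0.
    by apply/funext => x; rewrite pintE.
  - apply/measurable_EFinP; apply: measurable_funM => //; apply: measurable_sum => i.
    by apply: measurable_normX; exact: (fp i).1.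
  - move=> s _; rewrite -[pint _ _ _](pnorm_powR p0 (sec s)) lee_fin.
    rewrite -[\sum_i _ `^ _]powRr1// -(mulVf (lt0r_neq0 p0)) powRrM -powRM ?powR_ge0//.
    by rewrite ge0_ler_powR ?nnegrE ?mulr_ge0 ?powR_ge0 ?pnorm_ge0// ltW.
under eq_integral do rewrite EFinM.
rewrite ge0_integralZr//; last 3 first.
- apply/measurable_EFinP; apply: measurable_sum => i.
  by apply: measurable_normX; exact: (fp i).1.
- by move=> x _; rewrite lee_fin.
- by rewrite lee_fin powR_ge0.
rewrite EFinM lee_wpmul2r ?lee_fin ?powR_ge0//.
under eq_integral do rewrite -sumEFin.
rewrite ge0_integral_sum//; last by move=> i; apply: measurable_EnormX; exact: (fp i).1.
rewrite -sumEFin; apply: lee_sum => i _.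
by rewrite pnorm_powR// pintE.
Qed.

(** Membership in the closure of the algebraic tensor product. Indexing by arbitrary finite types
    lets two sums be joined over [I + J]. *)
Definition tapprox (h : S * T -> R) := forall e : R, 0 < e ->
  exists (I : finType) (f : I -> S -> R) (g : I -> T -> R),
    (forall i, inLp m1 p (f i)) /\ (forall i, inLp m2 p (g i)) /\
    pnorm (m1 \x m2)%E p (fun z => h z - \sum_i tensor (f i) (g i) z) < e.

Let tapprox_sum (I : finType) f g : (forall i : I, inLp m1 p (f i)) ->
  (forall i, inLp m2 p (g i)) -> inLp (m1 \x m2)%E p (fun z => \sum_i tensor (f i) (g i) z).
Proof. by move=> fp gp; apply: inLp_sum => // i _; exact: inLp_tensor. Qed.

Let tapprox_tensor f g : inLp m1 p f -> inLp m2 p g -> tapprox (tensor f g).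
Proof.
move=> fp gp e e0; exists unit, (fun=> f), (fun=> g); split=> //; split => //.
rewrite (_ : (fun _ => _) = fun=> 0) ?pnorm0//.
by apply/funext => z; rewrite big_const card_unit/= addr0 subrr.
Qed.

Let tapproxD h k : inLp (m1 \x m2)%E p h -> inLp (m1 \x m2)%E p k ->
  tapprox h -> tapprox k -> tapprox (fun z => h z + k z).
Proof.
move=> hp kp ah ak e e0; have e2 : 0 < e / 2 by rewrite divr_gt0.
have [I [f [g [fp [gp lt1]]]]] := ah _ e2.
have [J [f' [g' [fp' [gp' lt2]]]]] := ak _ e2.
exists (I + J)%type, (fun x => match x with inl i => f i | inr j => f' j end),
  (fun x => match x with inl i => g i | inr j => g' j end).
split; first by case.
split; first by case.
rewrite (_ : (fun _ => _) = fun z => (h z - \sum_i tensor (f i) (g i) z) +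
   (k z - \sum_i tensor (f' i) (g' i) z)); last first.
  by apply/funext => z; rewrite big_sumType/= opprD addrACA.
apply: (le_lt_trans (pnormD p1' _ _)).
- by apply: inLpB => //; exact: tapprox_sum.
- by apply: inLpB => //; exact: tapprox_sum.
- by rewrite [e]splitr ltrD.
Qed.

Let tapproxZ a h : inLp (m1 \x m2)%E p h -> tapprox h -> tapprox (fun z => a * h z).
Proof.
move=> hp ah e e0; have a0 : 0 < `|a| + 1 by rewrite ltr_wpDl.
have [I [f [g [fp [gp lt1]]]]] := ah (e / (`|a| + 1)) (divr_gt0 e0 a0).
exists I, (fun i s => a * f i s), g; split; first by move=> i; exact: inLpZ.
split => //.
rewrite (_ : (fun _ => _) = fun z => a * (h z - \sum_i tensor (f i) (g i) z)).
  rewrite pnormZ//; last by apply: inLpB => //; exact: tapprox_sum.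
  move: lt1; rewrite ltr_pdivlMr//; apply: le_lt_trans.
  by rewrite mulrC ler_wpM2l ?pnorm_ge0// lerDl.
apply/funext => z; rewrite mulrBr mulr_sumr; congr (_ - _).
by apply: eq_bigr => i _; rewrite /tensor mulrA.
Qed.

Let tapprox_lim h : inLp (m1 \x m2)%E p h ->
  (forall e : R, 0 < e -> exists k, [/\ inLp (m1 \x m2)%E p k, tapprox k &
     pnorm (m1 \x m2)%E p (fun z => h z - k z) < e]) -> tapprox h.
Proof.
move=> hp hk e e0; have e2 : 0 < e / 2 by rewrite divr_gt0.
have [k [kp ak lt1]] := hk _ e2.
have [I [f [g [fp [gp lt2]]]]] := ak _ e2.
exists I, f, g; split => //; split => //.
rewrite (_ : (fun _ => _) = fun z => (h z - k z) +
   (k z - \sum_i tensor (f i) (g i) z)); last first.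
  by apply/funext => z; rewrite addrA subrK.
apply: (le_lt_trans (pnormD p1' _ _)).
- exact: inLpB.
- by apply: inLpB => //; exact: tapprox_sum.
- by rewrite [e]splitr ltrD.
Qed.

(** Dynkin induction: the indicator of a rectangle is an elementary tensor, that of a complement is
    1 minus an indicator, and a disjoint union is the $L_p$ limit of its finite partial unions, with
    errors dominated by the constant 1. *)
Let tapprox_indic (C : set (S * T)) : measurable C -> tapprox (\1_C : S * T -> R).
Proof.
rewrite rectsE => sC.
have mi (A : set (S * T)) : measurable A -> inLp (m1 \x m2)%E p (\1_A : S * T -> R).
  exact: (inLp_indic finp p0).
have ap0 : tapprox (\1_set0 : S * T -> R).
  have := tapprox_tensor (inLp0 m1 p0) (inLp0 m2 p0); congr tapprox.
  by apply/funext => z; rewrite /tensor indic0 mul0r.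
apply: (dynkin_induction (P := fun C => tapprox (\1_C : S * T -> R)) rectsE rectsI) => //.
- have := tapprox_tensor (inLp_cst fin1 p 1) (inLp_cst fin2 p 1); congr tapprox.
  by apply/funext => z; rewrite /tensor indicE in_setT mulr1.
- move=> _ [A mA [B mB <-]].
  have := tapprox_tensor (inLp_indic fin1 p0 mA) (inLp_indic fin2 p0 mB); congr tapprox.
  by apply/funext => z; rewrite /tensor !indicE in_setX; do 2 case: (_ \in _);
    rewrite /= ?mulr0 ?mul0r ?mulr1.
- move=> A mA aA.
  have aT : tapprox (fun=> 1).
    have := tapprox_tensor (inLp_cst fin1 p 1) (inLp_cst fin2 p 1); congr tapprox.
    by apply/funext => z; rewrite /tensor mulr1.
  have := tapproxD (inLp_cst finp p 1) (inLpZ (-1) (mi _ mA)) aT (tapproxZ (-1) (mi _ mA) aA).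
  congr tapprox; apply/funext => z; rewrite !indicE in_setC mulN1r.
  by case: (_ \in _) => /=; rewrite ?subrr ?subr0.
- move=> F mF tF aF.
  pose A n := \big[setU/set0]_(k < n) F k.
  have mA n : measurable (A n) by exact: bigsetU_measurable.
  have aA n : tapprox (\1_(A n) : S * T -> R).
    elim: n => [|n ih]; first by rewrite /A big_ord0.
    have := tapproxD (mi _ (mA n)) (mi _ (mF n)) ih (aF n); congr tapprox.
    apply/funext => z; rewrite /A big_ord_recr/= !indicE in_setU.
    have [zA|_] := boolP (z \in _); last by rewrite add0r.
    have [zF|_] := boolP (z \in _); last by rewrite addr0.
    exfalso; move: zA zF => /set_mem + /set_mem Fn; rewrite -bigcup_mkord => -[k /= kn Fk].
    have := (trivIsetP.1 tF) k n I I; rewrite ltn_eqF// => /(_ isT) /seteqP[h _].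
    exact: (h z).
  have mU : measurable (\bigcup_k F k) by exact: bigcup_measurable.
  apply: tapprox_lim => [|e e0]; first exact: mi.
  have [||| n [_ hn]] := @dominated_inLp _ _ _ (m1 \x m2)%E p (\1_(\bigcup_k F k))
    (fun n => \1_(A n)) (fun=> 1) p0 (mi _ mU).1 _ _ (inLp_cst finp p 1) _ e e0.
  + by move=> n; exact: (mi _ (mA n)).1.
  + move=> z; have [zU|zU] := pselect ((\bigcup_k F k) z).
      apply: cvg_near_cst; case: zU => k _ Fk; exists k.+1 => // n /= kn.
      rewrite !indicE !mem_set//; first by exists k.
      by rewrite /A -bigcup_mkord; exists k.
    apply: cvg_near_cst; apply: nearW => n; rewrite !indicE !memNset//.
    by rewrite /A -bigcup_mkord => -[k /= kn Fk]; apply: zU; exists k.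
  + move=> n z; rewrite normr1 !indicE; do 2 case: (_ \in _);
      by rewrite /= ?subrr ?subr0 ?sub0r ?normrN ?normr1 ?normr0.
  by exists (\1_(A n)); split => //; exact: mi.
Qed.

Lemma tensor_dense h : inLp (m1 \x m2)%E p h -> tapprox h.
Proof.
move=> hp; apply: tapprox_lim => // e e0.
have [I [c [v [mc lte]]]] := step_dense finp p1' hp e0.
have vE : v \o c = fun z => \sum_i v i * \1_(c @^-1` [set i]) z.
  apply/funext => z; rewrite (bigD1 (c z))//= indicE mem_set// mulr1 big1 ?addr0// => i ic.
  by rewrite indicE memNset ?mulr0// => /esym/eqP; apply/negP.
have mi i : inLp (m1 \x m2)%E p (\1_(c @^-1` [set i]) : S * T -> R) by exact: (inLp_indic finp p0).
exists (v \o c); split => //.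
  by rewrite vE; apply: inLp_sum => // i _; exact: inLpZ.
rewrite vE; elim: (index_enum I) => [|i s ih].
  have := tapprox_tensor (inLp0 m1 p0) (inLp0 m2 p0); congr tapprox.
  by apply/funext => z; rewrite /tensor big_nil mul0r.
have := tapproxD _ _ (tapproxZ (v i) (mi i) (tapprox_indic (mc i))) ih.
under [in X in _ -> X]eq_fun do rewrite big_cons.
by apply; [exact: inLpZ|apply: inLp_sum => // j _; exact: inLpZ].
Qed.

End tensor_norm.

(** * Abel's integral equation *)

Section lebesgue_affine.
Context (R : realType).
Local Notation lam := (@lebesgue_measure R).
Implicit Types a c : R.

Lemma measurable_affine a c : measurable_fun [set: R] (fun s : R => a * s + c).
Proof. by apply: measurable_funD => //; exact: measurable_funM. Qed.

(** By uniqueness of Lebesgue measure it suffices to compare on intervals []x, y]]. For negative [a]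
    the preimage is half-open on the other side. *)
Lemma lebesgue_measure_affine a c A : a != 0 -> measurable A ->
  lam A = (`|a|%:E * lam ((fun s : R => (a * s + c)%R) @^-1` A))%E.
Proof.
move=> a0 mA.
pose phi : measurableTypeR R -> measurableTypeR R := (fun s : R => a * s + c).
have mphi : @measurable_fun _ _ (measurableTypeR R) (measurableTypeR R) setT phi.
  exact: measurable_affine.
pose nu : {measure set (measurableTypeR R) -> \bar R} :=
  mscale (NngNum (normr_ge0 a)) (pushforward lam phi).
apply: (@lebesgue_measure_unique R (nu mphi)) => // _ [[x y]] _ <-.
rewrite /nu /= /mscale /= /pushforward.
have ai : 0 < `|a| by rewrite normr_gt0.
have [a1|a1] := ltP 0 a.
  rewrite (_ : _ @^-1` _ = `](x - c) / a, (y - c) / a]%classic); last first.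
    apply/seteqP; split => s /=; rewrite !in_itv/= ltr_pdivrMr// ler_pdivlMr// /phi;
      rewrite ltrBlDr lerBrDr mulrC //.
  rewrite !lebesgue_measure_itv /= !lte_fin ltr_pM2r ?invr_gt0// ltrD2r.
  case: ifPn => _; last by rewrite mule0.
  rewrite -!EFinD -EFinM; congr EFin; rewrite gtr0_norm//.
  by field.
have {}a1 : a < 0 by rewrite lt_neqAle a0.
rewrite (_ : _ @^-1` _ = `[(y - c) / a, (x - c) / a[%classic); last first.
  apply/seteqP; split => s /=; rewrite !in_itv/= ltr_ndivlMr// ler_ndivrMr// /phi;
    rewrite ltrBlDr lerBrDr mulrC andbC //.
rewrite !lebesgue_measure_itv /= !lte_fin ltr_nM2r ?invr_lt0// ltrD2r.
case: ifPn => _; last by rewrite mule0.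
rewrite -!EFinD -EFinM; congr EFin; rewrite ltr0_norm//.
by field.
Qed.

Lemma integral_affine a c (f : R -> \bar R) : a != 0 -> measurable_fun setT f ->
  (forall x, 0 <= f x)%E ->
  (\int[lam]_x f x = `|a|%:E * \int[lam]_s f (a * s + c)%R)%E.
Proof.
move=> a0 mf f0.
pose phi : measurableTypeR R -> measurableTypeR R := (fun s : R => a * s + c).
have mphi : @measurable_fun _ _ (measurableTypeR R) (measurableTypeR R) setT phi.
  exact: measurable_affine.
pose nu : {measure set (measurableTypeR R) -> \bar R} :=
  mscale (NngNum (normr_ge0 a)) (pushforward lam phi).
transitivity (\int[nu mphi]_x f x)%E.
  by apply: eq_measure_integral => A mA _; exact: lebesgue_measure_affine.
rewrite ge0_integral_mscale//; congr (_ * _)%E.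
by rewrite ge0_integral_pushforward.
Qed.

End lebesgue_affine.

(** * The Abel kernel and its inversion *)

Section powers.
Context (R : realType).
Local Notation lam := (@lebesgue_measure R).

(** The fundamental theorem of calculus on $[1/(n+2),1]$ bounds the integrals by $1/(b+1)$, and
    these intervals exhaust $]0,1]$. Starting from [n.+2] keeps the left end strictly below 1 for
    every [n]. *)
Lemma integral_powR_lty (b : R) : -1 < b ->
  (\int[lam]_(t in `]0%R, 1%R]%classic) (t `^ b)%:E < +oo)%E.
Proof.
move=> b1; have b0 : 0 < b + 1 by rewrite -ltrBlDr sub0r.
pose I n : set R := `[n.+2%:R^-1, 1]%classic.
have UI : \bigcup_n I n = `]0, 1]%classic.
  apply/seteqP; split => t /=; last first.
    rewrite in_itv/= => /andP[t0 t1]; exists (Num.truncn t^-1) => //=.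
    rewrite /I /= in_itv /= t1 andbT invf_ple ?posrE//.
    by rewrite ltW// (lt_le_trans (truncnS_gt _))// ler_nat.
  by move=> [n _]; rewrite /I /= !in_itv/= => /andP[nt ->]; rewrite andbT (lt_le_trans _ nt)// invr_gt0.
have mP (A : set R) : measurable_fun A (fun t : R => (t `^ b)%:E).
  by apply: measurable_funTS; apply/measurable_EFinP; exact: measurable_powR.
have ndI : nondecreasing_seq I.
  move=> m n mn; apply/subsetPset => t; rewrite /I /= !in_itv/= => /andP[h ->].
  by rewrite andbT (le_trans _ h)// lef_pV2 ?posrE// ler_nat !ltnS.
have := ge0_nondecreasing_set_cvg_integral (mu := lam) ndI
  (fun i => measurable_itv _) (fun i => mP (I i)) (fun i x _ => powR_ge0 x b).
rewrite UI => h.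
apply: (@le_lt_trans _ _ ((b + 1)^-1)%:E); last exact: ltry.
rewrite -(cvg_lim _ h)//; apply: lime_le; first by apply/cvg_ex; eexists; exact: h.
apply: nearW => n.
have n1 : n.+2%:R^-1 < 1 :> R by rewrite invf_lt1// ltr1n.
have n0 : 0 < n.+2%:R^-1 :> R by rewrite invr_gt0.
rewrite (@continuous_FTC2 _ _ (fun t => (b + 1)^-1 * t `^ (b + 1)))//.
- rewrite -EFinB lee_fin powR1 mulr1 lerBlDr lerDl mulr_ge0 ?powR_ge0// invr_ge0 ltW//.
- apply: continuous_in_subspaceT => t /set_mem; rewrite /= in_itv/= => /andP[nt _].
  apply/differentiable_continuous/derivable1_diffP; apply: derivable_powR.
  by rewrite in_itv/= andbT (lt_le_trans n0).
- have dF (t : R) : 0 < t -> derivable (fun t => (b + 1)^-1 * t `^ (b + 1)) t 1.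
    by move=> t0; apply: derivableM => //; apply: derivable_powR; rewrite in_itv/= andbT.
  have cF (t : R) : 0 < t -> {for t, continuous (fun t => (b + 1)^-1 * t `^ (b + 1))}.
    by move=> t0; apply/differentiable_continuous/derivable1_diffP; exact: dF.
  split => [t| |].
  + by rewrite in_itv/= => /andP[nt _]; apply: dF; exact: lt_trans nt.
  + by apply/cvg_at_right_filter; exact: cF.
  + by apply/cvg_at_left_filter; exact: cF.
- move=> t; rewrite in_itv/= => /andP[nt _].
  have t0 := lt_trans n0 nt.
  rewrite derive1Ml; last by apply: derivable_powR; rewrite in_itv/= andbT.
  by rewrite powR_derive1 ?in_itv/= ?andbT// mulrA mulVf ?gt_eqF// mul1r addrK.
Qed.

Lemma measurable_kern2 (a : R) : measurable_fun setT (fun z : R * R => kern a z.1 z.2).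
Proof.
apply: measurable_fun_ifT => //.
  by apply: measurable_fun_ltr; [exact: measurable_snd|exact: measurable_fst].
apply: (measurableT_comp (measurable_powR (a - 1))).
by apply: measurable_funB; [exact: measurable_fst|exact: measurable_snd].
Qed.

Lemma measurable_kern_r (a x : R) : measurable_fun setT (kern a x).
Proof. exact: measurable_fun_pair2 (measurable_kern2 a). Qed.

Lemma measurable_kern_l (a t : R) : measurable_fun setT (fun x => kern a x t).
Proof. exact: measurable_fun_pair1 (measurable_kern2 a). Qed.

Lemma kern_ge0 (a x t : R) : 0 <= kern a x t.
Proof. by rewrite /kern; case: ifP => // _; exact: powR_ge0. Qed.

(** The substitution $t\mapsto x-t$ compares with $\int_0^1 s^{(a-1)r}ds$; here $x-t\le1$ since
    $x\le1$ and $t\ge0$. For $r=p'$ the condition on the exponent is $a>1/p$. *)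
Lemma integral_kern_powR_lty (a x r : R) : 0 < r -> -1 < (a - 1) * r -> x <= 1 ->
  (\int[lam]_(t in `[0%R, 1%R]%classic) ((kern a x t) `^ r)%:E < +oo)%E.
Proof.
move=> r0 ar x1.
have mk : measurable_fun setT (fun t => ((kern a x t) `^ r)%:E).
  apply/measurable_EFinP; apply: (measurableT_comp (measurable_powR r)).
  exact: measurable_kern_r.
have mf : measurable_fun setT (((fun s : R => (s `^ ((a - 1) * r))%:E) \_ `]0, 1]) : R -> \bar R).
  apply/(measurable_restrictT _ _).1 => //; apply: measurable_funTS.
  by apply/measurable_EFinP; exact: measurable_powR.
have f0 s : (0 <= ((fun s : R => (s `^ ((a - 1) * r))%:E) \_ `]0%R, 1%R]) s)%E.
  by apply: erestrict_ge0 => y _; rewrite lee_fin powR_ge0.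
apply: le_lt_trans (integral_powR_lty ar).
rewrite [leRHS]integral_mkcond (@integral_affine _ (-1) x)// ?oppr_eq0// normrN1 mul1e.
rewrite integral_mkcond; apply: ge0_le_integral => //.
- by move=> t _; apply: erestrict_ge0 => y _; rewrite lee_fin powR_ge0.
- by apply/(measurable_restrictT _ _).1 => //; exact: measurable_funTS.
- by apply: (measurableT_comp mf); exact: measurable_affine.
- move=> t _; rewrite [leLHS]patchE; case: ifPn => [/set_mem|_]; last exact: f0.
  rewrite /= in_itv/= => /andP[t0 t1].
  rewrite /kern; case: ifPn => tx; last by rewrite powR0 ?gt_eqF//; exact: f0.
  rewrite patchE mem_set; last first.
    rewrite /= in_itv/= mulN1r addrC subr_gt0 tx/= lerBlDr (le_trans x1)// lerDl//.
  by rewrite powRrM mulN1r addrC.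
Qed.

(** The Beta integral $B(a,1-a)=\int_0^1(1-x)^{-a}x^{a-1}dx$; the two kernels confine the integral
    over the line to $]0,1[$. *)
Definition beta_kern (a : R) : \bar R :=
  (\int[lam]_x (kern (1 - a) 1 x * kern a x 0)%:E)%E.

Lemma powR_neg_ge1 (y b : R) : 0 < y <= 1 -> 0 <= b -> 1 <= y `^ (- b).
Proof.
move=> y01 b0; rewrite -(powRr0 y); apply: ger_powR => //.
by rewrite oppr_le0.
Qed.

Lemma powR_neg_le2 (y b : R) : 2^-1 <= y -> y <= 1 -> b <= 1 -> y `^ (- b) <= 2.
Proof.
move=> y2 y1 b1; have y0 : 0 < y by apply: lt_le_trans y2; rewrite invr_gt0.
apply: (@le_trans _ _ (y `^ (-1))).
  by apply: ger_powR; rewrite ?y0 ?y1// lerN2.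
by rewrite (powR_inv1 (ltW y0)) invf_ple ?posrE.
Qed.

(** Cut at $1/2$: on each side the nonsingular factor is at most 2 by [powR_neg_le2], and the other
    one is an integrable power. *)
Lemma beta_kern_lty (a : R) : 0 < a -> a < 1 -> (beta_kern a < +oo)%E.
Proof.
move=> a0 a1.
pose g (b : R) : R -> \bar R := (fun s : R => (s `^ b)%:E) \_ `]0, 1].
have mg b : measurable_fun setT (g b).
  apply/(measurable_restrictT _ _).1 => //; apply: measurable_funTS.
  by apply/measurable_EFinP; exact: measurable_powR.
have g0 b s : (0 <= g b s)%E.
  by apply: erestrict_ge0 => y _; rewrite lee_fin powR_ge0.
have gE b s : 0 < s -> s <= 1 -> g b s = (s `^ b)%:E.
  by move=> s0 s1; rewrite /g patchE mem_set//= in_itv/= s0.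
have ig b : -1 < b -> (\int[lam]_s g b s < +oo)%E.
  by move=> /integral_powR_lty; rewrite integral_mkcond.
have mgN : measurable_fun setT (fun x : R => g (- a) (-1 * x + 1)).
  by apply: (measurableT_comp (mg _)); exact: measurable_affine.
apply: (@le_lt_trans _ _ (\int[lam]_x (2%:E * g (a - 1)%R x + 2%:E * g (- a)%R (-1 * x + 1)%R))%E).
  apply: ge0_le_integral => //.
  - by move=> x _; rewrite lee_fin mulr_ge0// kern_ge0.
  - apply/measurable_EFinP; apply: measurable_funM.
      exact: measurable_kern_r.
    exact: measurable_kern_l.
  - by apply: emeasurable_funD; apply: measurable_funeM; [exact: mg|exact: mgN].
  - move=> x _; rewrite /kern subr0.
    have R0 : (0 <= 2%:E * g (a - 1)%R x + 2%:E * g (- a)%R (-1 * x + 1)%R)%E.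
      by rewrite adde_ge0// mule_ge0.
    case: ifPn => x1; last by rewrite mul0r.
    case: ifPn => x0; last by rewrite mulr0.
    have y0 : 0 < -1 * x + 1 by rewrite mulN1r addrC subr_gt0.
    have y1 : -1 * x + 1 <= 1 by rewrite mulN1r gerDr oppr_le0 ltW.
    rewrite !gE// ?(ltW x1)//.
    have -> : 1 - a - 1 = - a by ring.
    have -> : -1 * x + 1 = 1 - x by ring.
    rewrite -!EFinM -EFinD lee_fin.
    have [x2|x2] := leP x 2^-1.
      apply: (@le_trans _ _ (2 * x `^ (a - 1))).
        rewrite ler_wpM2r ?powR_ge0//; apply: powR_neg_le2; [|lra|exact: ltW].
        by move: x2; lra.
      by rewrite lerDl mulr_ge0// powR_ge0.
    apply: (@le_trans _ _ (2 * (1 - x) `^ (- a))).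
      rewrite mulrC ler_wpM2r ?powR_ge0// -[a - 1]opprB.
      by apply: powR_neg_le2; [exact: ltW|exact: ltW|rewrite gerBl ltW].
    by rewrite lerDr mulr_ge0// powR_ge0.
rewrite ge0_integralD//; last 4 first.
- by move=> x _; rewrite mule_ge0.
- by apply: measurable_funeM; exact: mg.
- by move=> x _; rewrite mule_ge0.
- by apply: measurable_funeM; exact: mgN.
rewrite !ge0_integralZl_EFin//; try solve [exact: mgN|exact: mg].
have n1 : -1 != 0 :> R by rewrite oppr_eq0 oner_eq0.
have := integral_affine 1 n1 (mg (- a)) (g0 _); rewrite normrN1 mul1e => <-.
have i1 : -1 < a - 1 by lra.
have i2 : -1 < - a by lra.
by apply: lte_add_pinfty; apply: lte_mul_pinfty => //; exact: ig.
Qed.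

(** Both factors are at least 1 on $]0,1[$, so the integral is at least 1. *)
Lemma beta_kern_gt0 (a : R) : 0 < a -> a < 1 -> (0 < beta_kern a)%E.
Proof.
move=> a0 a1.
have : (\int[lam]_(x in `]0%R, 1%R[%classic) (cst 1%E x) <= beta_kern a)%E.
  rewrite integral_mkcond; apply: ge0_le_integral => //.
  - by move=> x _; apply: erestrict_ge0.
  - by apply/(measurable_restrictT _ _).1.
  - apply/measurable_EFinP; apply: measurable_funM.
      exact: measurable_kern_r.
    exact: measurable_kern_l.
  - move=> x _; rewrite patchE; case: ifPn => [/set_mem|_]; last first.
      by rewrite lee_fin mulr_ge0// kern_ge0.
    rewrite /= in_itv/= => /andP[x0 x1]; rewrite /kern x1 x0 subr0 lee_fin.
    have -> : 1 - a - 1 = - a by ring.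
    rewrite -[a - 1]opprB -[leLHS]mulr1 ler_pM// powR_neg_ge1//.
    + by rewrite subr_gt0 x1 gerBl ltW.
    + exact: ltW.
    + by rewrite x0 ltW.
    + by rewrite subr_ge0 ltW.
apply: lt_le_trans; rewrite integral_cst//= lebesgue_measure_itv/= lte_fin ltr01 -EFinB subr0 mul1e//.
Qed.

(** Substitute $x=t+(z-t)s$: the powers of $z-t$ add up to exponent $-a+(a-1)=-1$ and cancel the
    Jacobian. The composition of the two kernels is thus a constant multiple of the indicator of
    $t<z$, which is what inverts Abel's equation. *)
Lemma integral_kern_kern (a t z : R) :
  (\int[lam]_x (kern (1 - a) z x * kern a x t)%:E = if (t < z)%R then beta_kern a else 0)%E.
Proof.
have mkk u v : measurable_fun setT (fun x : R => (kern (1 - a) u x * kern a x v)%:E).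
  apply/measurable_EFinP; apply: measurable_funM.
    exact: measurable_kern_r.
  exact: measurable_kern_l.
have kk0 u v x : (0 <= (kern (1 - a) u x * kern a x v)%:E)%E.
  by rewrite lee_fin mulr_ge0// kern_ge0.
case: ifPn => tz; last first.
  apply: integral0_eq => x _; rewrite /kern.
  case: ifPn => xz; last by rewrite mul0r.
  case: ifPn => tx; last by rewrite mulr0.
  by case/negP: tz; exact: lt_trans xz.
have d0 : 0 < z - t by rewrite subr_gt0.
rewrite (@integral_affine _ (z - t) t)//; last by rewrite gt_eqF.
rewrite gtr0_norm// /beta_kern -ge0_integralZl_EFin//; last first.
- exact: ltW.
- by apply: (measurableT_comp (mkk _ _)); exact: measurable_affine.
apply: eq_integral => s _; rewrite -EFinM; congr EFin.
rewrite /kern.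
rewrite -[(z - t) * s + t < z]ltrBrDr gtr_pMr// -[t < _ + t]ltrBlDr subrr pmulr_rgt0//.
case: ifPn => s1; last by rewrite !mul0r mulr0.
case: ifPn => s0; last by rewrite !mulr0.
have -> : z - ((z - t) * s + t) = (z - t) * (1 - s) by ring.
rewrite addrK subr0 !powRM// ?ltW ?subr_gt0//.
rewrite mulrACA -powRD; last by rewrite (gt_eqF d0) implybT.
have -> : 1 - a - 1 + (a - 1) = -1 by ring.
rewrite !mulrA (powR_inv1 (ltW d0)).
have d1 : z - t != 0 by rewrite gt_eqF.
by rewrite (mulfV d1) mul1r.
Qed.

(** Integrate the equation against [kern (1 - a) z x] in [x] and exchange the integrals; by
    [integral_kern_kern] this leaves [beta_kern a] times the integral of [G] up to [z]. *)
Lemma abel_uniqueness (a : R) (G : R -> R) : 0 < a <= 1 ->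
  lam.-integrable setT (EFin \o G) ->
  (forall x : R, x <= 1 -> lam.-integrable setT (fun t : R => (G t * kern a x t)%:E)) ->
  (forall x : R, x <= 1 -> (\int[lam]_t (G t * kern a x t)%:E = 0)%E) ->
  forall z : R, z <= 1 -> (\int[lam]_(t in `]-oo, z[%classic) (G t)%:E = 0)%E.
Proof.
move=> /andP[a0 a1] iG iGk Gk0 z z1.
have GzE (c : R) : (\int[lam]_t (G t * (if (t < z)%R then c else 0))%:E =
    (c%:E : \bar R) * \int[lam]_(t in `]-oo, z[%classic) (G t)%:E)%E.
  rewrite -integralZl//; last exact: integrableS iG.
  rewrite [RHS]integral_mkcond; apply: eq_integral => t _; rewrite patchE.
  have [tz|tz] := ltP t z.
    by rewrite mem_set ?in_itv/= ?tz// EFinM muleC.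
  by rewrite memNset ?in_itv/= ?mulr0//= in_itv/= ltNge tz.
(* For [a = 1] the constant $B(1,0)$ diverges, but the kernel is already the indicator of $t<x$. *)
have [a11|a11] := eqVneq a 1.
  rewrite -[LHS]mul1e -GzE -[RHS](Gk0 _ z1); apply: eq_integral => t _.
  by rewrite /kern a11 subrr; case: ifP => // _; rewrite powRr0.
have {}a1 : a < 1 by rewrite lt_neqAle a11.
have Blty := beta_kern_lty a0 a1; have Bgt0 := beta_kern_gt0 a0 a1.
have Bfin : beta_kern a \is a fin_num by rewrite ge0_fin_numE// ltW.
have mG : measurable_fun setT G by apply/measurable_EFinP; exact: measurable_int iG.
pose f (w : R * R) : R := G w.2 * (kern (1 - a) z w.1 * kern a w.1 w.2).
have mf : measurable_fun setT (EFin \o f).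
  apply/measurable_EFinP; apply: measurable_funM.
    by apply: (measurableT_comp mG); exact: measurable_snd.
  apply: measurable_funM; last exact: measurable_kern2.
  by apply: (measurableT_comp (measurable_kern_r _ _)); exact: measurable_fst.
have kk0 x t : 0 <= kern (1 - a) z x * kern a x t by rewrite mulr_ge0// kern_ge0.
have mkk t : measurable_fun setT (fun x : R => (kern (1 - a) z x * kern a x t)%:E).
  apply/measurable_EFinP; apply: measurable_funM.
    exact: measurable_kern_r.
  exact: measurable_kern_l.
have ikk t : lam.-integrable setT (fun x : R => (kern (1 - a) z x * kern a x t)%:E).
  apply/integrableP; split; first exact: mkk.
  under eq_integral do rewrite gee0_abs ?lee_fin//.
  by rewrite integral_kern_kern; case: ifP => _ //; exact: ltry.
have intf : (lam \x lam)%E.-integrable setT (EFin \o f).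
  apply/integrable21ltyP => //.
  apply: (@le_lt_trans _ _ (\int[lam]_t (`|(G t)%:E| * beta_kern a))%E); last first.
    rewrite ge0_integralZr ?ltW//; last by apply: measurableT_comp => //; apply/measurable_EFinP.
    have /integrableP[_ Glty] := iG.
    have Gfin : (\int[lam]_t `|(G t)%:E|)%E \is a fin_num.
      by rewrite ge0_fin_numE// integral_ge0.
    by rewrite -(fineK Gfin) -(fineK Bfin) -EFinM ltry.
  apply: ge0_le_integral => //.
  - by move=> t _; exact: integral_ge0.
  - have mabs : measurable_fun setT (abse \o (EFin \o f)) by exact: measurableT_comp.
    exact: (@measurable_fun_fubini_tonelli_G _ _ (measurableTypeR R) (measurableTypeR R) R
      lam (abse \o (EFin \o f)) mabs (fun _ => abse_ge0 _)).
  - by apply: emeasurable_funM => //; apply: measurableT_comp => //; apply/measurable_EFinP.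
  - move=> t _; rewrite /f /=.
    under eq_integral do rewrite normrM EFinM (ger0_norm (kk0 _ _)).
    have k0 x : setT x -> (0 <= (kern (1 - a) z x * kern a x t)%:E)%E by rewrite lee_fin.
    apply: (@le_trans _ _ (`|(G t)%:E| * \int[lam]_x (kern (1 - a) z x * kern a x t)%:E)%E).
      rewrite -(ge0_integralZl lam measurableT (mkk t) k0 (abse_ge0 _)).
      exact: lexx.
    apply: lee_wpmul2l; first exact: abse_ge0.
    by rewrite integral_kern_kern; case: ifP => // _; exact: ltW.
have := Fubini intf.
have -> : (\int[lam]_x \int[lam]_y (EFin \o f) (x, y) = 0)%E.
  apply: integral0_eq => x _; rewrite /f /=.
  have [xz|zx] := ltP x z; last first.
    by apply: integral0_eq => t _; rewrite /kern ltNge zx /= mul0r mulr0.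
  have x1 : x <= 1 by rewrite (le_trans (ltW xz)).
  under eq_integral do rewrite mulrCA EFinM.
  by rewrite integralZl// ?Gk0// ?mule0//; exact: iGk.
under [in X in _ = X -> _]eq_integral => t _.
  rewrite (_ : (\int[lam]_x _)%E = (G t * (if t < z then fine (beta_kern a) else 0))%:E); last first.
    rewrite /f /=; under eq_integral do rewrite EFinM.
    rewrite integralZl// integral_kern_kern EFinM; congr (_ * _)%E.
    by case: ifP => // _; rewrite fineK.
  over.
rewrite /= GzE fineK// => /esym/eqP; rewrite mule_eq0 gt_eqF//= => /eqP.
by [].
Qed.

End powers.

Lemma ge0_integral_mrestr d (T : measurableType d) (R : realType)
    (m : {measure set T -> \bar R}) (D : set T) (mD : measurable D) (f : T -> \bar R) :
  measurable_fun setT f -> (forall x, 0 <= f x)%E ->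
  (\int[mrestr m mD]_x f x = \int[m]_(x in D) f x)%E.
Proof.
move=> mf f0; rewrite (@ge0_negligible_integral _ _ _ _ setT (~` D))//.
- rewrite setTD setCK; apply: eq_measure_integral => A mA AD.
  by rewrite /= /mrestr setIidl.
- exact: measurableC.
- by change (m (~` D `&` D) = 0%E); rewrite setICl measure0.
Qed.

(** * The line measure and the one-dimensional kernel *)

Section line_measure.
Context (R : realType).
Local Notation lam := (@lebesgue_measure R).
Local Notation RR := (measurableTypeR R).

(* The atom at [2], a point outside of [0,1], accounts for the summand
   [u = set0] of the space for [d = 1]. *)
Lemma line_measure_exists : exists mu : {finite_measure set RR -> \bar R},
  forall f : R -> \bar R, measurable_fun setT f -> (forall x, 0 <= f x)%E ->
  (\int[mu]_x f x = f 2%R + \int[lam]_(x in `[0%R, 1%R]%classic) f x)%E.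
Proof.
have m01 : measurable (`[0, 1]%classic : set RR) by exact: measurable_itv.
pose mu : {measure set RR -> \bar R} := measure_add (\d_(2 : RR)) (mrestr lam m01).
have mufin : fin_num_fun mu.
  move=> A mA; rewrite [mu A]measure_addE fin_numD; apply/andP; split.
    exact: fin_num_measure.
  rewrite /mrestr ge0_fin_numE//.
  apply: (@le_lt_trans _ _ (lam `[0, 1]%classic)).
    by apply: (@le_measure _ RR _ lam); [apply/mem_set; exact: measurableI|exact/mem_set|exact: subIsetr].
  by rewrite lebesgue_measure_itv/= lte_fin ltr01 -EFinB ltry.
pose nu : {finite_measure set RR -> \bar R} :=
  HB.pack (Measure.sort mu) (Measure_isFinite.Build _ _ _ (Measure.sort mu) mufin).
exists nu => f mf f0.
transitivity (\int[mu]_x f x)%E => //.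
rewrite /mu ge0_integral_measure_add// integral_dirac// diracT mul1e; congr (_ + _)%E.
exact: ge0_integral_mrestr.
Qed.

Definition line_measure : {finite_measure set RR -> \bar R} :=
  projT1 (cid line_measure_exists).

Lemma ge0_integral_line (f : R -> \bar R) : measurable_fun setT f -> (forall x, 0 <= f x)%E ->
  (\int[line_measure]_x f x = f 2%R + \int[lam]_(x in `[0%R, 1%R]%classic) f x)%E.
Proof. by rewrite /line_measure; case: cid => mu /= h; exact: h. Qed.

Lemma integrable_line (f : R -> \bar R) : line_measure.-integrable setT f ->
  [/\ f 2 \is a fin_num, lam.-integrable `[0, 1]%classic f &
  (\int[line_measure]_x f x = f 2%R + \int[lam]_(x in `[0%R, 1%R]%classic) f x)%E].
Proof.
move=> fi; have mf := measurable_int _ fi; have /integrableP[_ foo] := fi.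
have ge0S (g : R -> \bar R) : (forall x, 0 <= g x)%E -> (0 <= \int[lam]_(x in `[0%R, 1%R]%classic) g x)%E.
  by move=> g0; exact: integral_ge0.
have m01 : measurable (`[0, 1]%classic : set RR) by exact: measurable_itv.
have mabs : measurable_fun setT (fun x => `|f x|%E) by exact: measurableT_comp.
have f2 : f 2 \is a fin_num.
  rewrite fin_num_abs; move: foo; rewrite ge0_integral_line//.
  by apply: le_lt_trans; rewrite leeDl// ge0S.
have fi01 : lam.-integrable `[0, 1]%classic f.
  apply/integrableP; split; first exact: measurable_funTS.
  by move: foo; rewrite ge0_integral_line//; apply: le_lt_trans; rewrite leeDr.
split=> //; rewrite integralE [in RHS]integralE.
have mfp := measurable_funepos mf; have mfn := measurable_funeneg mf.
rewrite !ge0_integral_line//.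
have fp := integrable_pos_fin_num m01 fi01.
have fn := integrable_neg_fin_num m01 fi01.
rewrite -(fineK fp) -(fineK fn).
have fE : (f 2%R = f^\+ 2%R - f^\- 2%R)%E by have /(congr1 (fun h => h 2%R)) := funeposneg f.
have pfin : f^\+%E 2 \is a fin_num by rewrite funeposE -(fineK f2) -EFin_max.
have nfin : f^\-%E 2 \is a fin_num by rewrite funenegE -(fineK f2) -EFin_max.
rewrite fE -(fineK pfin) -(fineK nfin) -?EFinD -?EFinN -?EFinD.
by congr EFin; ring.
Qed.

(** The value 1 at the atom makes [F 2] the constant term of the function represented by [F]. *)
Definition line_kern (a x t : R) : R := if t == 2 then 1 else kern a x t.

Lemma measurable_line_kern a x : measurable_fun setT (line_kern a x).
Proof.
apply: measurable_fun_ifT => //; last exact: measurable_kern_r.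
exact: measurable_fun_eqr.
Qed.

Lemma line_kern01 a x t : `[0, 1]%classic t -> line_kern a x t = kern a x t.
Proof.
rewrite /= in_itv/= /line_kern => /andP[_ t1]; case: eqP => // t2; exfalso.
by move: t1; rewrite t2; lra.
Qed.

Lemma inLp_line_kern (a x q : R) : 0 < q -> -1 < (a - 1) * q -> x <= 1 ->
  inLp line_measure q (line_kern a x).
Proof.
move=> q0 aq x1; split; first exact: measurable_line_kern.
rewrite pintE ge0_integral_line//; last exact: (measurable_EnormX q (measurable_line_kern a x)).
apply: lte_add_pinfty; first exact: ltry.
apply: le_lt_trans (integral_kern_powR_lty q0 aq x1).
rewrite le_eqVlt; apply/orP; left; apply/eqP; apply: eq_integral => t /set_mem t01.
by rewrite line_kern01// ger0_norm ?kern_ge0.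
Qed.

(** At $x=0$ the integral over $[0,1]$ vanishes, hence [F 2 = 0], and what remains is Abel's
    equation for the restriction [G] of [F] to $[0,1]$. The integrals of [G] over rays then vanish,
    and rays generate the sigma-algebra. *)
Lemma total_line (a p q : R) : 1 < p -> 0 < q -> p^-1 + q^-1 = 1 ->
  0 < a <= 1 -> -1 < (a - 1) * q ->
  total_kernel line_measure p q (fun x => 0 <= x <= 1) (line_kern a).
Proof.
move=> p1 q0 pq a01 aq; have p0 : 0 < p by exact: lt_trans p1.
have lq x : x <= 1 -> inLp line_measure q (line_kern a x) by exact: inLp_line_kern.
split=> [x /andP[_]|F Fp F0]; first exact: lq.
have iF : line_measure.-integrable setT (EFin \o F).
  by apply: (inLp_integrable _ p0 q0 pq Fp); exact: finite_measure_lty.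
have iFk x : x <= 1 -> line_measure.-integrable setT (EFin \o (fun t => F t * line_kern a x t)).
  by move=> x1; apply: (inLp_mul p0 q0 pq Fp); exact: lq.
have m01 : measurable (`[0, 1]%classic : set RR) by exact: measurable_itv.
pose G : R -> R := F \_ `[0, 1].
have GE (h : R -> R) A : measurable A ->
   (\int[lam]_(t in A) (G t * h t)%:E = \int[lam]_(t in `[0%R, 1%R]%classic) ((F t * h t)%:E * (\1_A t)%:E))%E.
  move=> mA; rewrite integral_mkcond [RHS]integral_mkcond.
  apply: eq_integral => t _; rewrite /G !patchE indicE.
  by case: ifP => _; case: ifP => _; rewrite ?mul0r ?mule1 ?mule0.
have Gk x : x <= 1 -> lam.-integrable setT (fun t : R => (G t * kern a x t)%:E).
  move=> x1; have [_ + _] := integrable_line (iFk x x1).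
  move/(integrable_mkcond _ m01); apply: eq_integrable => // t _.
  rewrite /G !patchE; case: ifPn => [/set_mem t01|_]; last by rewrite mul0r.
  by rewrite /= line_kern01.
have pE x : 0 <= x <= 1 ->
    ((F 2)%:E + \int[lam]_(t in `[0%R, 1%R]%classic) (F t * kern a x t)%:E = 0)%E.
  move=> x01; have [x0 x1] := andP x01.
  have [_ _] := integrable_line (iFk x x1); rewrite [(EFin \o _) 2]/=.
  have -> : line_kern a x 2 = 1 by rewrite /line_kern eqxx.
  rewrite mulr1.
  have := F0 x x01; rewrite pairingE /Rintegral => h.
  move=> hE; transitivity (\int[line_measure]_t (F t * line_kern a x t)%:E)%E.
    rewrite hE; congr (_ + _)%E; apply: eq_integral => t /set_mem t01.
    by rewrite /= line_kern01.
  by apply/eqP; rewrite -fine_eq0 ?h ?eqxx//; apply: integrable_fin_num => //; exact: iFk.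
have F20 : F 2 = 0.
  have := pE 0; rewrite lexx ler01 => /(_ isT).
  rewrite integral0_eq ?adde0; first by move=> [].
  by move=> t; rewrite /= in_itv/= => /andP[t0 _]; rewrite /kern ltNge t0 /= mulr0.
have Gk0 x : x <= 1 -> (\int[lam]_t (G t * kern a x t)%:E = 0)%E.
  move=> x1; rewrite GE//.
  have [x0|x0] := leP 0 x.
    have := pE x; rewrite x0 x1 F20 add0e => /(_ isT) <-.
    by apply: eq_integral => t _; rewrite indicE in_setT mule1.
  apply: integral0_eq => t; rewrite /= in_itv/= => /andP[t0 _].
  by rewrite /kern ltNge (le_trans (ltW x0)) //= mulr0 mul0e.
have iG : lam.-integrable setT (EFin \o G).
  have [_ + _] := integrable_line iF.
  move/(integrable_mkcond _ m01); apply: eq_integrable => // t _.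
  by rewrite /G /= !patchE; case: ifP.
have G0 := abel_uniqueness a01 iG Gk Gk0.
(* Covers the rays that end beyond 1 and the whole line: [G] is 0 to the right of 1 and the point 1
   is null, so the ray ending at 1 decides. *)
have G0' (A : set RR) : measurable A -> (forall t, t < 1 -> A t) ->
    (\int[lam]_(t in A) (G t)%:E = 0)%E.
  move=> mA A1; rewrite -(G0 1 (lexx _)) [LHS]integral_mkcond [RHS]integral_mkcond.
  have mG := measurable_int _ iG.
  have m1 : measurable (`]-oo, 1[%classic : set RR) by exact: measurable_itv.
  apply: ae_eq_integral => //.
  - by apply/(measurable_restrictT _ _).1 => //; exact: measurable_funTS.
  - by apply/(measurable_restrictT _ _).1 => //; exact: measurable_funTS.
  - exists [set 1]; split; [exact: measurable_set1|exact: lebesgue_measure_set1|].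
    move=> t /= h; apply: contrapT => t1; apply: h => _.
    rewrite !patchE; have [tlt|tgt|/esym//] := ltgtP t 1.
      by rewrite !mem_set//=; exact: A1.
    rewrite [in RHS]memNset//=; last by rewrite in_itv/= ltNge ltW.
    case: ifP => // _; rewrite /G patchE memNset//= in_itv/= => /andP[_].
    by rewrite leNgt tgt.
have FG (A : set RR) : measurable A -> (\int[line_measure]_(t in A) (F t)%:E =
    \int[lam]_(t in A) (G t)%:E)%E.
  move=> mA; have iFA : line_measure.-integrable setT (EFin \o (F \_ A)).
    have := (integrable_mkcond _ mA).1 (integrableS measurableT mA (@subsetT _ _) iF).
    by apply: eq_integrable => // t _; rewrite /= !patchE; case: ifP.
  have [_ _ h] := integrable_line iFA; rewrite [(EFin \o _) 2]/= in h.
  transitivity (\int[line_measure]_t ((F \_ A) t)%:E)%E.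
    by rewrite integral_mkcond; apply: eq_integral => t _; rewrite !patchE; case: ifP.
  rewrite h (_ : (F \_ A) 2 = 0) ?add0e; last by rewrite patchE F20; case: ifP.
  have := GE (fun=> 1) A mA; under eq_integral do rewrite mulr1.
  move=> ->; apply: eq_integral => t _; rewrite [LHS]/= patchE indicE mulr1.
  by case: ifP => _; rewrite ?mule1 ?mule0.
have : ae_eq line_measure setT (EFin \o F) (fun=> 0%E).
  apply: (@pi_system_ae0 _ RR _ _ (@RGenInftyO.G R)) => //.
  - exact: RGenInftyO.measurableE.
  - move=> _ _ [x ->] [y ->]; exists (Num.min x y).
    by apply/seteqP; split => t /=; rewrite !in_itv/= lt_min => /andP.
  - by rewrite FG// G0'.
  - move=> _ [x ->]; rewrite FG//; have [x1|x1] := leP x 1; first exact: G0.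
    by apply: G0' => // t t1; rewrite /= in_itv/= (lt_trans t1).
by apply: filterS => t /= h _; have [] := h I.
Qed.

(** [fine] would turn a divergent integral into 0, so positivity includes convergence. As $a\le1$,
    the integrand is at most $t^{a-1}$ on $]0,1]$ and at most $e^{-t}$ beyond; from below it is at
    least $e^{-1}$ on $]0,1]$. *)
Lemma Gamma_gt0 (a : R) : 0 < a -> a <= 1 -> 0 < Gamma a.
Proof.
move=> a0 a1.
pose g (s : R) : \bar R := ((fun s : R => (s `^ (a - 1))%:E) \_ `]0%R, 1%R]) s.
have mg : measurable_fun setT g.
  apply/(measurable_restrictT _ _).1 => //; apply: measurable_funTS.
  by apply/measurable_EFinP; exact: measurable_powR.
have g0 s : (0 <= g s)%E.
  by apply: erestrict_ge0 => y _; rewrite lee_fin powR_ge0.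
have me : measurable_fun setT (fun s : R => (exponential_pdf 1 s)%:E).
  by apply/measurable_EFinP; exact: measurable_exponential_pdf.
have e0 s : (0 <= (exponential_pdf 1 s : R)%:E)%E.
  by rewrite lee_fin exponential_pdf_ge0.
have mGa : measurable_fun setT (fun t : R => (t `^ (a - 1) * expR (- t))%:E).
  apply/measurable_EFinP; apply: measurable_funM; first exact: measurable_powR.
  by apply: measurableT_comp => //; exact: measurableT_comp.
have m0 : measurable (`]0, +oo[%classic : set RR) by exact: measurable_itv.
have G0 (t : R) : (0 <= (t `^ (a - 1) * expR (- t))%:E)%E.
  by rewrite lee_fin mulr_ge0 ?powR_ge0 ?expR_ge0.
have Gt : (\int[lam]_(t in `]0%R, +oo[%classic) (t `^ (a - 1) * expR (- t))%:E < +oo)%E.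
  apply: (@le_lt_trans _ _ (\int[lam]_t (g t + (exponential_pdf 1 t)%:E))%E).
    rewrite integral_mkcond; apply: ge0_le_integral => //.
    - by move=> x _; apply: erestrict_ge0.
    - by apply/(measurable_restrictT _ _).1 => //; exact: (measurable_funTS mGa).
    - by apply: emeasurable_funD.
    - move=> t _; rewrite patchE; case: ifPn => [/set_mem|_]; last by rewrite adde_ge0.
      rewrite /= in_itv/= andbT => t0; have [t1|t1] := leP t 1.
        apply: (@le_trans _ _ (g t)); last by rewrite leeDl.
        rewrite /g patchE mem_set; last by rewrite /= in_itv/= t0.
        rewrite lee_fin ler_piMr ?powR_ge0//.
        by rewrite expR_le1 oppr_le0 ltW.
      apply: (@le_trans _ _ (exponential_pdf 1 t)%:E); last by rewrite leeDr.
      rewrite exponential_pdfE; last exact: ltW.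
      rewrite /= mul1r mulN1r lee_fin.
      rewrite ler_piMl ?expR_ge0// -opprB powRN invf_le1 ?powR_gt0//.
      by rewrite -[leLHS](powRr0 t) ler_powR ?subr_ge0// ltW.
  rewrite ge0_integralD//.
  apply: lte_add_pinfty; last by rewrite integral_exponential_pdf// ltry.
  have : -1 < a - 1 by rewrite ltrBrDr addNr.
  move=> /integral_powR_lty; apply: le_lt_trans.
  by rewrite [leRHS]integral_mkcond.
rewrite /Gamma fine_gt0// Gt andbT.
have m1 : measurable (`]0, 1]%classic : set RR) by exact: measurable_itv.
apply: (@lt_le_trans _ _ (\int[lam]_(t in `]0%R, 1%R]%classic) (cst (expR (-1))%:E t))%E).
  by rewrite integral_cst//= lebesgue_measure_itv/= lte_fin ltr01 -EFinB subr0 mule1 lte_fin expR_gt0.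
apply: (@le_trans _ _ (\int[lam]_(t in `]0%R, 1%R]%classic) (t `^ (a - 1) * expR (- t))%:E)%E).
  apply: ge0_le_integral => //.
  - by move=> x _; rewrite lee_fin expR_ge0.
  - exact: measurable_funTS.
  - move=> t; rewrite /= in_itv/= => /andP[t0 t1]; rewrite lee_fin -[leLHS]mul1r.
    rewrite ler_pM ?expR_ge0//; last by rewrite ler_expR lerN2.
    by rewrite -[a - 1]opprB powR_neg_ge1 ?t0// subr_ge0.
apply: ge0_subset_integral => //.
- exact: measurable_funTS.
- by move=> t /=; rewrite !in_itv/= => /andP[-> _].
Qed.

End line_measure.

(** * The cubes as one measure space *)

Section coordinates.
Context (R : realType).
Local Notation lam := (@lebesgue_measure R).
Local Notation RR := (measurableTypeR R).

(** The last coordinate is the one split off, in agreement with [init_coords] and [last_coord]. *)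
Definition extend n (x : 'I_n -> R) (y : R) : 'I_n.+1 -> R :=
  fun i => if unlift ord_max i is Some j then x j else y.

Definition front n (x : 'I_n.+1 -> R) : 'I_n -> R := fun j => x (lift ord_max j).

Lemma extend_max n (x : 'I_n -> R) y : extend x y ord_max = y.
Proof. by rewrite /extend unlift_none. Qed.

Lemma extend_lift n (x : 'I_n -> R) y j : extend x y (lift ord_max j) = x j.
Proof. by rewrite /extend liftK. Qed.

Lemma front_extend n (x : 'I_n -> R) y : front (extend x y) = x.
Proof. by apply/funext => j; rewrite /front extend_lift. Qed.

Lemma extend_front n (x : 'I_n.+1 -> R) : extend (front x) (x ord_max) = x.
Proof. by apply/funext => i; rewrite /extend; case: unliftP => [j ->|->]. Qed.

Lemma usigma_preimage d (T : measurableType d) n (u : {set 'I_n}) (h : T -> 'I_n -> R) A :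
  (forall j, j \in u -> measurable_fun setT (h^~ j)) -> usigma u A -> measurable (h @^-1` A).
Proof.
move=> mh; apply: (@smallest_sub _ _ _ (fun A => measurable (h @^-1` A))).
  split => [|B mB|B mB]; first by rewrite preimage_set0.
  - by rewrite setTD preimage_setC; exact: measurableC.
  - by rewrite preimage_bigcup; exact: bigcup_measurable.
move=> B [i iu [C mC <-]]; rewrite setTI.
by have := mh i iu measurableT C mC; rewrite setTI.
Qed.

Lemma usigma_coord n (u : {set 'I_n}) j (A : set R) : j \in u -> measurable A ->
  usigma u ((fun x => x j) @^-1` A).
Proof.
by move=> ju mA; apply: sub_sigma_algebra; exists j => //; exists A => //; rewrite setTI.
Qed.

Lemma iint_cat n (l l' : seq 'I_n) (F : ('I_n -> R) -> \bar R) t :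
  iint (l ++ l') F t = iint l (iint l' F) t.
Proof. by elim: l t => //= j l IH t; apply: eq_integral => y _; exact: IH. Qed.

Lemma iint_lift n (l : seq 'I_n) (F : ('I_n.+1 -> R) -> \bar R) t :
  iint (map (lift ord_max) l) F t =
  iint l (fun x => F (extend x (t ord_max))) (front t).
Proof.
elim: l t => /= [t|j l IH t]; first by rewrite extend_front.
apply: eq_integral => y _; rewrite IH /= eq_liftF.
by congr iint; apply/funext => i; rewrite /front (inj_eq lift_inj).
Qed.

(** The integrands are compared only at points that the iterated integral reaches: coordinates in
    [l] range over $[0,1]$, the others keep their initial values. The two starting points may
    differ, which reconciles the value 2 marking an absent coordinate with the value 0 used by
    [cube_int]. *)
Lemma eq_iint n (l : seq 'I_n) (F F' : ('I_n -> R) -> \bar R) t t' :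
  (forall x x', (forall j, j \in l -> x j = x' j /\ 0 <= x j <= 1) ->
     (forall j, j \notin l -> x j = t j /\ x' j = t' j) -> F x = F' x') ->
  iint l F t = iint l F' t'.
Proof.
elim: l t t' => /= [|j l IH] t t' h; first by apply: h.
apply: eq_integral => y /set_mem; rewrite /= in_itv/= => y01; apply: IH => x x' hin hout.
apply: h => i; rewrite inE.
  case: (boolP (i \in l)) => [il _|il]; first exact: hin.
  by rewrite orbF => /eqP ij; have := hout _ il; rewrite ij eqxx => -[-> ->].
by rewrite negb_or => /andP[/negbTE ij il]; have := hout _ il; rewrite ij.
Qed.

(** No set of the sigma-algebra generated by the coordinates in [u] separates points that agree on
    [u]; this is applied to the preimage of the single value [F x']. *)
Lemma umeasurable_local n (u : {set 'I_n}) (F : ('I_n -> R) -> R) x x' :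
  umeasurable u F -> (forall j, j \in u -> x j = x' j) -> F x = F x'.
Proof.
move=> mF xx'; have /mF : measurable [set F x'] by exact: measurable_set1.
suff H A : usigma u A -> (A x <-> A x') by move=> h; exact: (proj2 (H _ h)).
apply: (@smallest_sub _ _ _ (fun A => A x <-> A x')).
  split => [//|B [h h']|B h].
  - by split=> -[_ Bx]; split => // ?; apply: Bx; [exact: h'|exact: h].
  - by split=> -[k _ Bk]; exists k => //; exact/h.
by move=> B [i iu [C mC <-]]; split => -[_ /=]; rewrite xx'.
Qed.

(** [iint] integrates in the order of its list, so the enumeration itself has to be known: the last
    coordinate comes last and is the innermost integral. *)
Lemma enum_lift_subset n (u : {set 'I_n}) (v : {set 'I_n.+1}) :
  (forall j, (lift ord_max j \in v) = (j \in u)) ->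
  enum v = map (lift ord_max) (enum u) ++ (if ord_max \in v then [:: ord_max] else [::]).
Proof.
move=> vu; rewrite /enum_mem -!enumT enum_ordSr filter_rcons.
have wl j : widen_ord (leqnSn n) j = lift ord_max j by apply: val_inj; rewrite [RHS]lift_max.
rewrite (eq_map wl) filter_map.
rewrite (@eq_filter _ _ (mem u)); last by move=> j; exact: vu.
by rewrite -[X in if X then _ else _]/(ord_max \in v); case: ifP; rewrite ?cats1 ?cats0.
Qed.

Lemma enum_subset_ordS n (v : {set 'I_n.+1}) : exists (u : {set 'I_n}) (b : bool),
  enum v = map (lift ord_max) (enum u) ++ (if b then [:: ord_max] else [::]).
Proof.
exists [set j | lift ord_max j \in v]%SET, (ord_max \in v).
by apply: enum_lift_subset => j; rewrite inE.
Qed.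

Lemma sum_subsets_ordS n (G : seq 'I_n.+1 -> \bar R) :
  (\sum_(v : {set 'I_n.+1}) G (enum v) =
   \sum_(u : {set 'I_n}) (G (map (lift ord_max) (enum u)) +
                          G (map (lift ord_max) (enum u) ++ [:: ord_max])))%E.
Proof.
pose low (v : {set 'I_n.+1}) : {set 'I_n} := [set j | lift ord_max j \in v]%SET.
pose up (b : bool) (u : {set 'I_n}) : {set 'I_n.+1} :=
  [set i | if unlift ord_max i is Some j then j \in u else b]%SET.
have lowup b u : low (up b u) = u by apply/setP => j; rewrite !inE liftK.
have uplow b (v : {set 'I_n.+1}) : (ord_max \in v) = b -> up b (low v) = v.
  move=> <-; apply/setP => i; rewrite !inE.
  by case: unliftP => [j ->|->]; rewrite ?inE.
have upmax b u : (ord_max \in up b u) = b by rewrite inE unlift_none.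
have uplift b u j : (lift ord_max j \in up b u) = (j \in u) by rewrite inE liftK.
rewrite big_split /= addeC (bigID (fun v : {set 'I_n.+1} => ord_max \in v)) /=.
congr (_ + _)%E.
- rewrite (reindex_onto (up true) low) /=; last by move=> v /uplow.
  apply: eq_big => [u|u _]; first by rewrite lowup upmax eqxx.
  by rewrite (enum_lift_subset (uplift true u)) upmax.
- rewrite (reindex_onto (up false) low) /=; last by move=> v /negbTE/uplow.
  apply: eq_big => [u|u _]; first by rewrite lowup upmax eqxx.
  by rewrite (enum_lift_subset (uplift false u)) upmax cats0.
Qed.

End coordinates.

Section presentation.
Context (R : realType).
Local Notation lam := (@lebesgue_measure R).
Local Notation RR := (measurableTypeR R).
Local Notation nu := (@line_measure R).

(* The measure space [(S, m)] realizes the disjoint union of the cubes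
   [[0,1]^u] inside [R^n]: the points of [[0,1]^u] are those whose coordinates
   outside of [u] are all equal to [2]. *)
Record presents n d (S : measurableType d) (m : {measure set S -> \bar R})
    (phi : S -> 'I_n -> R) (psi : ('I_n -> R) -> S) : Prop := Presents {
  presentsK : cancel phi psi ;
  presentsVK : cancel psi phi ;
  measurable_presents : forall j, measurable_fun setT (phi^~ j) ;
  measurable_presentsV : forall A, measurable A -> usigma [set: 'I_n]%SET (psi @^-1` A) ;
  ge0_integral_presents : forall g : S -> \bar R, measurable_fun setT g -> (forall s, 0 <= g s)%E ->
    (\int[m]_s g s = \sum_(u : {set 'I_n}) iint (enum u) (g \o psi) (fun=> 2%R))%E ;
  integral_presents : forall g : S -> \bar R, m.-integrable setT g ->
    (forall u : {set 'I_n}, iint (enum u) (g \o psi) (fun=> 2%R) \is a fin_num) /\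
    (\int[m]_s g s = \sum_(u : {set 'I_n}) iint (enum u) (g \o psi) (fun=> 2%R))%E }.

Lemma sum_subsets_ord0 (G : {set 'I_0} -> \bar R) : (\sum_u G u = G finset.set0)%E.
Proof.
rewrite (bigD1 finset.set0)//= big1 ?adde0// => u /eqP[]; by apply/setP => -[].
Qed.

Lemma presents_line : presents nu (fun y (_ : 'I_1) => y) (fun x => x ord0).
Proof.
have m01 : measurable (`[0, 1]%classic : set RR) by exact: measurable_itv.
have r2 (y : R) : (fun=> y) = extend (fun _ : 'I_0 => y) y.
  by apply/funext => i; rewrite /extend; case: unliftP.
have sumE (g : R -> \bar R) : (\sum_(u : {set 'I_1}) iint (enum u) (g \o (fun x => x ord0)) (fun=> 2%R) =
    g 2%R + \int[lam]_(x in `[0%R, 1%R]%classic) g x)%E.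
  rewrite (sum_subsets_ordS (fun l => iint l _ _)) sum_subsets_ord0 enum_set0 /=.
  by congr (_ + _)%E; apply: eq_integral.
split=> //.
- by move=> x; apply/funext => i /=; rewrite (ord1 i).
- by move=> A mA; apply: (usigma_coord (j := ord0)); rewrite ?inE.
- by move=> g mg g0; rewrite ge0_integral_line// sumE.
- move=> g ig; have [g2 ig01 ->] := integrable_line ig; split; last by rewrite sumE.
  move=> u; have := integrable_fin_num m01 ig01.
  have [v [b ->]] := enum_subset_ordS u; have -> : v = finset.set0 by apply/setP => -[].
  by rewrite enum_set0; case: b.
Qed.

(** The two parts of the line measure in the new factor match the two kinds of subsets: the atom at
    2 gives those without the last coordinate, the Lebesgue part those containing it. *)
Lemma presents_prod n d (S : measurableType d) (m : {finite_measure set S -> \bar R})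
    (phi : S -> 'I_n -> R) (psi : ('I_n -> R) -> S) : presents m phi psi ->
  presents (m \x nu)%E (fun z : S * RR => extend (phi z.1) z.2)
    (fun x => (psi (front x), x ord_max)).
Proof.
move=> P; have m01 : measurable (`[0, 1]%classic : set RR) by exact: measurable_itv.
have iintE (g : S * RR -> \bar R) (u : {set 'I_n}) :
    iint (map (lift ord_max) (enum u)) (g \o (fun x => (psi (front x), x ord_max))) (fun=> 2) =
    iint (enum u) ((fun s => g (s, 2)) \o psi) (fun=> 2).
  rewrite iint_lift; congr iint.
  by apply/funext => x /=; rewrite front_extend extend_max.
have iintE1 (g : S * RR -> \bar R) (u : {set 'I_n}) :
    iint (map (lift ord_max) (enum u) ++ [:: ord_max])
      (g \o (fun x => (psi (front x), x ord_max))) (fun=> 2) =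
    iint (enum u) ((fun s => \int[lam]_(y in `[0%R, 1%R]%classic) g (s, y))%E \o psi) (fun=> 2).
  rewrite iint_cat iint_lift; congr iint.
  apply/funext => x /=; apply: eq_integral => y _; rewrite eqxx; congr (g (psi _, _)).
  by apply/funext => j; rewrite /front eq_sym (negbTE (neq_lift _ _)) extend_lift.
have mg2 (g : S * RR -> \bar R) : measurable_fun setT g -> measurable_fun setT (fun s => g (s, 2%R)).
  by move=> mg; exact: measurableT_comp.
have mg01 (g : S * RR -> \bar R) : measurable_fun setT g -> (forall z, 0 <= g z)%E ->
    measurable_fun setT (fun s => \int[lam]_(y in `[0%R, 1%R]%classic) g (s, y))%E.
  move=> mg g0.
  pose h := g \_ (setT `*` `[0, 1]%classic).
  rewrite (_ : (fun _ => _) = fubini_F lam h).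
    apply: measurable_fun_fubini_tonelli_F.
      by apply/(measurable_restrictT _ _).1; [exact: measurableX|exact: measurable_funTS].
    by move=> z; exact: erestrict_ge0.
  apply/funext => s; rewrite /fubini_F [LHS]integral_mkcond; apply: eq_integral => y _.
  rewrite /h !patchE; congr (if _ then _ else _).
  by apply/idP/idP => /set_mem h'; apply/mem_set; [split|case: h'].

have int01 (g : S * RR -> \bar R) s : measurable_fun setT g -> (forall z, 0 <= g z)%E ->
   (\int[nu]_y g (s, y) = g (s, 2%R) + \int[lam]_(y in `[0%R, 1%R]%classic) g (s, y))%E.
  by move=> mg g0; rewrite (@ge0_integral_line _ (fun y => g (s, y)))//; exact: measurableT_comp.
have ge01 (g : S * RR -> \bar R) s : (forall z, 0 <= g z)%E ->
   (0 <= \int[lam]_(y in `[0%R, 1%R]%classic) g (s, y))%E.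
  by move=> g0; apply: integral_ge0.
split.
- by move=> [s y] /=; rewrite front_extend extend_max (presentsK P).
- by move=> x /=; rewrite (presentsVK P) extend_front.
- move=> i; have [j ->|->] := unliftP ord_max i.
    under eq_fun do rewrite extend_lift.
    have := measurable_presents P j.
    by move=> h; exact: (measurableT_comp h (@measurable_fst _ _ S RR)).
  by under eq_fun do rewrite extend_max; exact: (@measurable_snd _ _ S RR).
- move=> A mA; pose X := g_sigma_algebraType (\bigcup_(i in [set i | i \in [set: 'I_n.+1]%SET])
      preimage_set_system setT (fun x : 'I_n.+1 -> R => x i) measurable).
  pose h (x : X) : S * RR := (psi (front x), x ord_max).
  have coordX i : measurable_fun setT (fun x : X => (x i : RR)).
    by move=> _ B mB; rewrite setTI; apply: usigma_coord; rewrite ?inE.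
  have mh : measurable_fun setT h.
    apply: measurable_fun_pair; last exact: coordX.
    move=> _ B mB; rewrite setTI.
    apply: (usigma_preimage (h := fun x : X => front x)) (measurable_presentsV P mB).
    by move=> j _; exact: coordX.
  by have := mh measurableT A mA; rewrite setTI.
- move=> g mg g0; rewrite fubini_tonelli1// /fubini_F.
  under eq_integral do rewrite int01//.
  rewrite ge0_integralD//; do ?[exact: mg2|exact: mg01|by move=> s _; exact: ge01].
  rewrite (ge0_integral_presents P (mg2 _ mg))// (ge0_integral_presents P (mg01 _ mg g0)); last by move=> s; exact: ge01.
  rewrite (sum_subsets_ordS (fun l => iint l _ _)) -big_split /=.
  by apply: eq_bigr => u _; rewrite iintE iintE1.
- move=> g ig; have mg := measurable_int _ ig.
  have mabs : measurable_fun setT (fun z => `|g z|%E) by exact: measurableT_comp.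

  (* Both functions are dominated by the integral of [|g (s, y)|] in [y] over the line measure,
     which is integrable in [s]. *)
  have [i2 i01] : m.-integrable setT (fun s => g (s, 2%R)) /\
      m.-integrable setT (fun s => \int[lam]_(y in `[0%R, 1%R]%classic) g (s, y))%E.
    have /integrableP[_ goo] := ig.
    rewrite fubini_tonelli1// /fubini_F in goo.
    have mF : measurable_fun setT (fun s => \int[nu]_y `|g (s, y)|)%E.
      rewrite -[X in measurable_fun _ X]/(fubini_F nu (fun z => `|g z|%E)).
      exact: measurable_fun_fubini_tonelli_F.
    have bnd (h : S -> \bar R) : measurable_fun setT h ->
        (forall s, `|h s| <= \int[nu]_y `|g (s, y)|)%E -> m.-integrable setT h.
      move=> mh hle; apply/integrableP; split=> //; apply: le_lt_trans goo.
      by apply: ge0_le_integral => //; exact: measurableT_comp.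
    split; apply: bnd.
    + exact: mg2.
    + by move=> s; rewrite (int01 (fun z => `|g z|%E))// leeDl// (ge01 (fun z => `|g z|%E)).
    + rewrite (_ : (fun _ => _) = (fun s => \int[lam]_(y in `[0%R, 1%R]%classic) (g^\+ (s, y)) -
          \int[lam]_(y in `[0%R, 1%R]%classic) (g^\- (s, y)))%E); last first.
        apply/funext => s; rewrite integralE; congr (_ - _)%E; apply: eq_integral => y _.
          by rewrite !funeposE.
        by rewrite !funenegE.
      apply: emeasurable_funB; apply: mg01 => //.
        exact: measurable_funepos.
      exact: measurable_funeneg.
    + move=> s; rewrite (int01 (fun z => `|g z|%E))//.
      apply: (@le_trans _ _ (\int[lam]_(y in `[0%R, 1%R]%classic) `|g (s, y)|)%E).
        by apply: le_abse_integral => //; apply: measurable_funTS; exact: measurableT_comp.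
      by rewrite leeDr.
  have [f2 s2] := integral_presents P i2; have [f01 s01] := integral_presents P i01.
  split.
    move=> v; have [u [[] ->]] := enum_subset_ordS v; first by rewrite iintE1 f01.
    by rewrite cats0 iintE f2.
  rewrite -integral12_prod_meas1// /fubini_F.
  transitivity (\int[m]_s (g (s, 2%R) + \int[lam]_(y in `[0%R, 1%R]%classic) g (s, y)))%E.
    (* Almost every section of [g] is integrable, and there [integrable_line] splits the inner
       integral. *)
    apply: ae_eq_integral => //.
    - exact: (measurable_fubini_F ig).
    - by apply: emeasurable_funD; [exact: (measurable_int _ i2)|exact: (measurable_int _ i01)].
    - by move: (ae_integrable1 ig); apply: filterS => s hs _; have [] := integrable_line hs.
  rewrite integralD// s2 s01.
  rewrite (sum_subsets_ordS (fun l => iint l _ _)) -big_split /=.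
  by apply: eq_bigr => u _; rewrite iintE iintE1.
Qed.
End presentation.

(** * The product kernel *)

Section cube_kernel.
Context (R : realType).
Local Notation RR := (measurableTypeR R).
Local Notation nu := (@line_measure R).

Definition cube_kern (a : R) n (x y : 'I_n -> R) : R := \prod_j line_kern a (x j) (y j).

Lemma cube_kern1 a (x y : 'I_1 -> R) : cube_kern a x y = line_kern a (x ord0) (y ord0).
Proof. by rewrite /cube_kern big_ord1. Qed.

Lemma cube_kernS a n (x : 'I_n.+1 -> R) (y : 'I_n -> R) z :
  cube_kern a x (extend y z) = cube_kern a (front x) y * line_kern a (x ord_max) z.
Proof.
rewrite /cube_kern big_ord_recr /= extend_max; congr (_ * _); apply: eq_bigr => j _.
have -> : widen_ord (leqnSn n) j = lift ord_max j by apply: val_inj; rewrite [RHS]lift_max.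
by rewrite extend_lift.
Qed.

Context (a p q : R).
Hypotheses (p1 : 1 < p) (q0 : 0 < q) (pq : p^-1 + q^-1 = 1).
Hypotheses (a01 : 0 < a <= 1) (aq : -1 < (a - 1) * q).

Lemma total_cube_line : total_kernel nu p q (@in_cube R 1)
  (fun x y => cube_kern a x (fun=> y)).
Proof.
have [T1 T2] := total_line p1 q0 pq a01 aq; split=> [x x01|F Fp F0].
  by under eq_fun do rewrite cube_kern1; exact/T1/x01.
apply: T2 => // x x01; rewrite -(F0 (fun=> x)) //.
by congr pairing; apply/funext => y; rewrite cube_kern1.
Qed.

Lemma total_cube_prod n d (S : measurableType d) (m : {finite_measure set S -> \bar R})
    (phi : S -> 'I_n -> R) :
  total_kernel m p q (@in_cube R n) (fun x s => cube_kern a x (phi s)) ->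
  total_kernel (m \x nu)%E p q (@in_cube R n.+1)
    (fun x (z : S * RR) => cube_kern a x (extend (phi z.1) z.2)).
Proof.
move=> Tm; have Tl := total_line p1 q0 pq a01 aq.
have q1 : 1 < q.
  have p0 : 0 < p^-1 by rewrite invr_gt0 (lt_trans _ p1).
  have q1' : q^-1 < 1 by rewrite -pq ltrDr.
  by rewrite -(invrK q) invf_gt1 ?invr_gt0.
have [T1 T2] := total_prod p1 q1 pq Tm Tl.
have KE (x : 'I_n.+1 -> R) : (fun z : S * RR => cube_kern a x (extend (phi z.1) z.2)) =
    tensor (fun s => cube_kern a (front x) (phi s)) (line_kern a (x ord_max)).
  by apply/funext => z; rewrite cube_kernS.
split=> [x x01|F Fp F0].
  by rewrite KE; apply: (T1 (front x, x ord_max)); split=> [j|] /=; exact: x01.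
apply: T2 => // -[x y] /= [x01 y01].
rewrite -(F0 (extend x y)).
  by rewrite KE front_extend extend_max.
by move=> i; have [j ->|->] := unliftP ord_max i; rewrite ?extend_lift ?extend_max.
Qed.

Lemma presents_exists n : exists d (S : measurableType d)
    (m : {finite_measure set S -> \bar R}) phi psi,
  @presents R n.+1 d S m phi psi /\
  total_kernel m p q (@in_cube R n.+1) (fun x s => cube_kern a x (phi s)).
Proof.
elim: n => [|n [d [S [m [phi [psi [P T]]]]]]].
  exists _, RR, nu, (fun y _ => y), (fun x => x ord0).
  by split; [exact: presents_line|exact: total_cube_line].
have P' := presents_prod P; have T' := total_cube_prod T.
(* The product is repackaged as a finite measure, the form in which the induction hypothesis has to
   provide it. *)
pose mu : {measure set (S * RR)%type -> \bar R} := (m \x nu)%E.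
have mufin : fin_num_fun mu.
  move=> A mA; rewrite ge0_fin_numE//; apply: le_lt_trans (product_measure_lty m nu).
  by apply: le_measure; rewrite ?inE//; exact/mem_set.
pose fmu : {finite_measure set (S * RR)%type -> \bar R} :=
  HB.pack (Measure.sort mu) (Measure_isFinite.Build _ _ _ (Measure.sort mu) mufin).
exists _, (S * RR)%type, fmu, (fun z => extend (phi z.1) z.2), (fun x => (psi (front x), x ord_max)).
by split; [exact: P'|exact: T'].
Qed.

End cube_kernel.

(** * Comparison of the $q$-sums with the maximum *)

Section qsum.
Context (R : realType) (n : nat) (r : \bar R) (b : {set 'I_n} -> R).
Hypotheses (r1 : (1 <= r)%E) (b0 : forall u, 0 <= b u).
Let N : R := #|{set 'I_n}|%:R.

Lemma le_qsum u : ((b u)%:E <= qsum r (fun u => (b u)%:E))%E.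
Proof.
case: r r1 => [k|_|//]; last exact: (le_bigmax _ (fun u => (b u)%:E)).
rewrite lee_fin => k1; have k0 : 0 < k by exact: lt_le_trans k1.
rewrite /qsum; under eq_bigr do rewrite poweR_EFin.
rewrite sumEFin poweR_EFin lee_fin -[leLHS]powRr1// -(mulfV (lt0r_neq0 k0)) powRrM.
apply: ge0_ler_powR; rewrite ?invr_ge0 ?nnegrE ?powR_ge0 ?(ltW k0)//.
  by apply: sumr_ge0 => v _; exact: powR_ge0.
rewrite (bigD1 u)//= lerDl; apply: sumr_ge0 => v _; exact: powR_ge0.
Qed.

(** For a finite exponent $k$ the factor is $N^{1/k}\le N$, so one constant serves all exponents. *)
Lemma qsum_le M : 0 <= M -> (forall u, b u <= M) -> (qsum r (fun u => (b u)%:E) <= (N * M)%:E)%E.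
Proof.
move=> M0 bM; have N1 : 1 <= N by rewrite ler1n; apply/card_gt0P; exists finset.set0.
have MN : M <= N * M by rewrite ler_peMl.
case: r r1 => [k|_|//]; last first.
  apply: bigmax_le => [|u _]; first by rewrite lee_fin mulr_ge0// (le_trans _ N1).
  by rewrite lee_fin (le_trans (bM u)).
rewrite lee_fin => k1; have k0 : 0 < k by exact: lt_le_trans k1.
rewrite /qsum; under eq_bigr do rewrite poweR_EFin.
rewrite sumEFin poweR_EFin lee_fin.
apply: (@le_trans _ _ ((N * M `^ k) `^ k^-1)).
  apply: ge0_ler_powR; rewrite ?invr_ge0 ?nnegrE ?(ltW k0)//.
  - by apply: sumr_ge0 => v _; exact: powR_ge0.
  - by rewrite mulr_ge0 ?powR_ge0// (le_trans _ N1).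
  - rewrite /N mulr_natl -sumr_const; apply: ler_sum => u _.
    by apply: ge0_ler_powR; rewrite ?nnegrE ?(ltW k0).
have N0 : 0 <= N by exact: le_trans N1.
rewrite powRM ?powR_ge0// -powRrM mulfV ?gt_eqF// powRr1// ler_wpM2r//.
by rewrite -[leRHS]powRr1// ler_powR// invf_le1.
Qed.
End qsum.

(** * Densities and the equivalence of norms *)

Section model.
Context (R : realType) (n : nat) d (S : measurableType d) (m : {measure set S -> \bar R}).
Context (phi : S -> 'I_n -> R) (psi : ('I_n -> R) -> S).
Hypothesis P : presents m phi psi.
Local Notation RR := (measurableTypeR R).

(** Reads off from a point the set [u] of the cube that it stands for, 2 being the mark of an absent
    coordinate. *)
Definition off2 (x : 'I_n -> R) : {set 'I_n} := [set j | x j != 2]%SET.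

(** The slices partition all of [S], so a function on [S] is the sum of its restrictions to them;
    inside a slice only the points of the cube carry mass. *)
Definition slice (u : {set 'I_n}) : set S := [set s | off2 (phi s) = u].

Lemma measurable_slice u : measurable (slice u).
Proof.
rewrite (_ : slice u = \bigcap_(j in setT) ((phi^~ j) @^-1` (if j \in u then ~` [set 2] else [set 2]))).
  apply: fin_bigcap_measurable => [|j _]; first exact: finite_finset.
  rewrite -[X in measurable X]setTI; apply: (measurable_presents P) => //.
  by case: ifP => _; [apply: measurableC|]; exact: measurable_set1.
apply/seteqP; split=> s /=.
  move=> su j _ /=; rewrite -su inE; case: ifPn => [/eqP//|].
  by rewrite negbK => /eqP.
move=> H; apply/setP => j; rewrite inE; have := H j I; rewrite /preimage/=.
by case: ifP => _ /= ?; [exact/eqP|apply/negbTE; rewrite negbK; exact/eqP].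
Qed.

Lemma off2_slice (u : {set 'I_n}) (x : 'I_n -> R) :
  (forall j, j \in enum u -> 0 <= x j <= 1) -> (forall j, j \notin enum u -> x j = 2) ->
  off2 x = u.
Proof.
move=> xin xout; apply/setP => j; rewrite inE.
case: (boolP (j \in u)) => ju; last by rewrite xout ?eqxx// mem_enum.
apply/eqP => x2; have := xin j; rewrite mem_enum ju x2 => /(_ isT).
by move=> /andP[_]; lra.
Qed.

Lemma iint0 (l : seq 'I_n) t : iint l (fun=> 0%E : \bar R) t = 0%E.
Proof.
elim: l t => //= j l IH t; under eq_integral do rewrite IH.
by rewrite integral0.
Qed.

Let slice_term (u v : {set 'I_n}) (G : S -> \bar R) :
  iint (enum v) ((G \_ (slice u)) \o psi) (fun=> 2) =
  if v == u then iint (enum u) (G \o psi) (fun=> 2) else 0%E.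
Proof.
have off x : (forall j, j \in enum v -> x j = x j /\ 0 <= x j <= 1) ->
     (forall j, j \notin enum v -> x j = 2) -> off2 x = v.
  by move=> h1 h2; apply: off2_slice => // j /h1[].
case: eqP => [->|vu]; last rewrite -(iint0 (enum v) (fun=> 2)).
  apply: eq_iint => x x' hin hout; have -> : x' = x.
    apply/funext => j; case: (boolP (j \in enum u)) => ju; first by have [] := hin _ ju.
    by have [-> ->] := hout _ ju.
  rewrite /= patchE mem_set// /slice /= (presentsVK P).
  by apply: off2_slice => j ju; [have [] := hin _ ju|have [] := hout _ ju].
apply: eq_iint => x x' hin hout.
rewrite /= patchE memNset// /slice /= (presentsVK P) => xu; apply: vu; rewrite -xu.
by apply/esym; apply: off2_slice => j ju; [have [] := hin _ ju|have [] := hout _ ju].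
Qed.

Lemma ge0_integral_slice u (G : S -> \bar R) : measurable_fun setT G -> (forall s, 0 <= G s)%E ->
  (\int[m]_(s in slice u) G s = iint (enum u) (G \o psi) (fun=> 2%R))%E.
Proof.
move=> mG G0; rewrite integral_mkcond (ge0_integral_presents P).
- under eq_bigr do rewrite slice_term.
  by rewrite -big_mkcond big_pred1_eq.
- by apply/(measurable_restrictT _ _).1; [exact: measurable_slice|exact: measurable_funTS].
- by move=> s; apply: erestrict_ge0 => ? _.
Qed.

Lemma integral_slice u (G : S -> \bar R) : m.-integrable setT G ->
  (\int[m]_(s in slice u) G s = iint (enum u) (G \o psi) (fun=> 2%R))%E.
Proof.
move=> iG; rewrite integral_mkcond (integral_presents P _).2.
  under eq_bigr do rewrite slice_term.
  by rewrite -big_mkcond big_pred1_eq.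
apply/(integrable_mkcond _ (measurable_slice u)).1.
by apply: integrableS iG => //; exact: measurable_slice.
Qed.

Definition piece u (f : ('I_n -> R) -> R) (s : S) : R := \1_(slice u) s * f (phi s).

Lemma piece_in u f s : off2 (phi s) = u -> piece u f s = f (phi s).
Proof. by move=> su; rewrite /piece indicE mem_set// mul1r. Qed.

Lemma piece_out u f s : off2 (phi s) <> u -> piece u f s = 0.
Proof. by move=> su; rewrite /piece indicE memNset// mul0r. Qed.

Lemma measurable_piece u f : umeasurable u f -> measurable_fun setT (piece u f).
Proof.
move=> mf; apply: measurable_funM.
  by apply: measurable_indic; exact: measurable_slice.
move=> _ C mC; rewrite setTI.
apply: (usigma_preimage (h := phi)) (mf _ mC) => j _; exact: measurable_presents P j.
Qed.

Let piece_iint u f (H : ('I_n -> R) -> \bar R) (G : S -> \bar R) : umeasurable u f ->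
  (forall x x', off2 x = u -> (forall j, j \in u -> x j = x' j /\ 0 <= x j <= 1) -> f x = f x' ->
     G (psi x) = H x') ->
  iint (enum u) (G \o psi) (fun=> 2) = cube_int u H.
Proof.
move=> mf GH; apply: eq_iint => x x' hin hout; apply: GH.
- by apply: off2_slice => j ju; [have [] := hin _ ju|have [] := hout _ ju].
- by move=> j ju; apply: hin; rewrite mem_enum.
- by apply: (umeasurable_local mf) => j ju; have [] := hin j; rewrite ?mem_enum.
Qed.

Lemma pint_piece u f r : 0 < r -> umeasurable u f ->
  pint m r (piece u f) = cube_int u (fun t => (`|f t| `^ r)%:E).
Proof.
move=> r0 mf; rewrite pintE.
transitivity (\int[m]_(s in slice u) (`|piece u f s| `^ r)%:E)%E.
  rewrite [RHS]integral_mkcond; apply: eq_integral => s _; rewrite patchE.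
  case: ifPn => // /negP su; rewrite piece_out ?normr0 ?powR0 ?gt_eqF//.
  by move=> h; apply: su; exact/mem_set.
rewrite ge0_integral_slice//; last exact: (measurable_EnormX r (measurable_piece mf)).
apply: (piece_iint mf) => x x' xu _ fx.
by rewrite /= piece_in (presentsVK P)// fx.
Qed.

(** On the slice of [u] the factors of [cube_kern] outside [u] are taken at 2 and equal 1, which
    leaves the product over [u]. *)
Lemma pairing_piece u f a x :
  umeasurable u f ->
  m.-integrable setT (EFin \o (fun s => piece u f s * cube_kern a x (phi s))) ->
  pairing m (piece u f) (fun s => cube_kern a x (phi s)) =
  fine (cube_int u (fun t => (f t * \prod_(j in u) kern a (x j) (t j))%:E)).
Proof.
move=> mf iG; rewrite pairingE /Rintegral; congr fine.
transitivity (\int[m]_(s in slice u) (piece u f s * cube_kern a x (phi s))%:E)%E.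
  rewrite [RHS]integral_mkcond; apply: eq_integral => s _; rewrite patchE.
  case: ifPn => // /negP su; rewrite piece_out ?mul0r//.
  by move=> h; apply: su; exact/mem_set.
rewrite integral_slice//.
apply: (piece_iint mf) => t t' tu tt' ft.
rewrite /= piece_in (presentsVK P)// ft; congr (_ * _)%:E.
rewrite /cube_kern [RHS]big_mkcond; apply: eq_bigr => j _ /=.
case: ifPn => ju; first by have [<- t01] := tt' j ju; rewrite line_kern01//= in_itv.
by move: ju; rewrite -tu inE negbK /line_kern => ->.
Qed.

(** Resetting the coordinates outside [u] to 2 turns the restriction of a function to a slice into a
    function of the coordinates in [u] alone, as [umeasurable] demands. *)
Definition on_face (u : {set 'I_n}) (t : 'I_n -> R) : 'I_n -> R :=
  fun j => if j \in u then t j else 2.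

Lemma umeasurable_face u (F : S -> R) : measurable_fun setT F ->
  umeasurable u (fun t => F (psi (on_face u t))).
Proof.
move=> mF C mC; have := mF measurableT C mC; rewrite setTI => /(measurable_presentsV P) mFC.
pose X := g_sigma_algebraType (\bigcup_(i in [set i | i \in u])
  preimage_set_system setT (fun x : 'I_n -> R => x i) measurable).
apply: (@usigma_preimage _ _ X _ _ (on_face u)) mFC => j _.
rewrite /on_face; case: (boolP (j \in u)) => ju //.
by move=> _ B mB; rewrite setTI; apply: usigma_coord.
Qed.

Lemma sum_piece (f : {set 'I_n} -> ('I_n -> R) -> R) s :
  \sum_u piece u (f u) s = f (off2 (phi s)) (phi s).
Proof.
rewrite (bigD1 (off2 (phi s)))//= piece_in// big1 ?addr0// => u /eqP su.
by rewrite piece_out// => /esym.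
Qed.

Lemma on_face_off2 s : on_face (off2 (phi s)) (phi s) = phi s.
Proof. by apply/funext => j; rewrite /on_face inE; case: eqP. Qed.

Context (a p q : R).
Hypotheses (p1 : 1 < p) (q0 : 0 < q) (pq : p^-1 + q^-1 = 1) (a0 : 0 < a) (a1 : a <= 1).
Hypothesis T : total_kernel m p q (@in_cube R n) (fun x s => cube_kern a x (phi s)).

Let p0 : 0 < p. Proof. exact: lt_trans p1. Qed.
Let p1' : 1 <= p. Proof. exact: ltW. Qed.
Let Gn0 k : 0 < Gamma a ^- k. Proof. by rewrite invr_gt0 exprn_gt0// Gamma_gt0. Qed.

Definition density (f : ('I_n -> R) -> R) (F : S -> R) := inLp m p F /\
  forall x, in_cube x -> f x = pairing m F (fun s => cube_kern a x (phi s)).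

Lemma inLp_piece u f : inLp_u u p f -> inLp m p (piece u f).
Proof.
move=> [mf foo]; split; first exact: measurable_piece.
by rewrite pint_piece.
Qed.

(** The powers of [Gamma] are absorbed into the density, so that pairing with [cube_kern] reproduces
    [Hfun]. *)
Definition assemble (ft : {set 'I_n} -> ('I_n -> R) -> R) (s : S) : R :=
  \sum_(u : {set 'I_n}) Gamma a ^- #|u| * piece u (ft u) s.

Lemma density_assemble f ft : Hrep a p f ft -> density f (assemble ft).
Proof.
move=> [ftp fE]; have pp u := inLp_piece (ftp u).
have pg (u : {set 'I_n}) : inLp m p (fun s => Gamma a ^- #|u| * piece u (ft u) s) by exact: inLpZ.
split; first exact: inLp_sum.
move=> x x01; rewrite fE// /Hfun /assemble (pairing_suml p1 q0 pq)//; last by case: T => + _; exact.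
apply: eq_bigr => u _; rewrite (pairingZl p1 q0 pq)//; last by case: T => + _; exact.
rewrite pairing_piece//; first by case: (ftp u).
by apply: (inLp_mul p0 q0 pq)=> //; case: T => + _; exact.
Qed.

(** The restrictions of [F] to the slices, with the powers of [Gamma] undone, form a representation.
    The equality with [F] holds at every point, since each point lies in exactly one slice. *)
Lemma assemble_density f F : density f F -> exists2 ft, Hrep a p f ft & F = assemble ft.
Proof.
move=> [Fp fE]; pose ft (u : {set 'I_n}) t := Gamma a ^+ #|u| * F (psi (on_face u t)).
have gE : F = assemble ft.
  apply/funext => s; rewrite /assemble.
  transitivity (\sum_u piece u (fun t => F (psi (on_face u t))) s).
    by rewrite sum_piece on_face_off2 (presentsK P).
  apply: eq_bigr => u _; rewrite /piece /ft mulrCA mulKf//.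
  by rewrite gt_eqF// exprn_gt0// Gamma_gt0.
have mft u : umeasurable u (ft u).
  apply: (umeasurable_face (F := fun s => Gamma a ^+ #|u| * F s)).
  by apply: measurable_funM => //; case: Fp.
have ftp u : inLp_u u p (ft u).
  split; first exact: mft.
  rewrite -pint_piece//.
  have : inLp m p (fun s => Gamma a ^+ #|u| * F s) by exact: inLpZ.
  have mp := measurable_piece (mft u).
  move=> /(le_inLp (ltW p0) mp) []//.
  move=> s; have [su|su] := pselect (off2 (phi s) = u); last by rewrite piece_out// normr0.
  by rewrite piece_in// /ft -su on_face_off2 (presentsK P).
exists ft => //; split=> // x x01.
have [_ h] : density (Hfun a ft) (assemble ft) by apply: density_assemble.
by rewrite h// fE// -gE.
Qed.

Lemma inHP f : inH a p f <-> exists F, density f F.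
Proof.
split; first by move=> [ft /density_assemble ?]; exists (assemble ft).
by move=> [F /assemble_density[ft ? _]]; exists ft.
Qed.

Lemma density_unique f F F' : density f F -> density f F' -> ae_eq m setT F F'.
Proof.
move=> [Fp fE] [Fp' fE']; have [T1 T2] := T.
have : ae_eq m setT (fun s => F s - F' s) (fun=> 0).
  apply: T2; first exact: inLpB.
  move=> x x01; have Fn := inLpN Fp'.
  rewrite (pairingDl p1 q0 pq Fp Fn (T1 _ x01)) -(fE _ x01).
  under [X in pairing m X]eq_fun do rewrite -mulN1r.
  by rewrite (pairingZl p1 q0 pq)//; [rewrite -fE'// mulN1r subrr|exact: T1].
by apply: filterS => s h /h /subr0_eq.
Qed.

Lemma density_lin f g F G c e : density f F -> density g G ->
  density (fun x => c * f x + e * g x) (fun s => c * F s + e * G s).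
Proof.
move=> [Fp fE] [Gp gE]; have [T1 _] := T; split; first by apply: inLpD => //; exact: inLpZ.
move=> x x01; have [cF eG] := (inLpZ c Fp, inLpZ e Gp).
by rewrite (pairingDl p1 q0 pq cF eG (T1 _ x01)) !(pairingZl p1 q0 pq _ _ (T1 _ x01))// fE// gE.
Qed.

Let N : R := #|{set 'I_n}|%:R.

Lemma weighted_Lpnorm f ft (u : {set 'I_n}) : Hrep a p f ft ->
  ((Gamma a ^- #|u|)%:E * Lpnorm_u u p (ft u))%E =
  (pnorm m p (fun s => Gamma a ^- #|u| * piece u (ft u) s))%:E.
Proof.
move=> [ftp _]; have Fp := inLp_piece (ftp u); have [mf _] := ftp u.
rewrite pnormZ// ger0_norm ?(ltW (Gn0 _))// EFinM; congr (_ * _)%E.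
by rewrite /Lpnorm_u -pint_piece// -(fineK (pint_fin_num Fp)) poweR_EFin -pnorm_def.
Qed.

Context (r : \bar R) (r1 : (1 <= r)%E).

(** The infimum is bounded term by term: the density assembled from any representation equals [F]
    almost everywhere, and its norm is at most the sum of [N] pieces, each below the $q$-sum. *)
Lemma pnorm_le_Hnorm f F : density f F -> ((pnorm m p F)%:E <= N%:E * Hnorm a p r f)%E.
Proof.
move=> fF; have N0 : 0 < N by rewrite ltr0n; apply/card_gt0P; exists finset.set0.
rewrite -lee_pdivrMl//; apply: le_ereal_inf_tmp => _ [ft hft <-].
under eq_fun do rewrite (weighted_Lpnorm _ hft).
have fG := density_assemble hft.
rewrite (@ae_eq_pnorm _ _ _ _ _ _ (assemble ft)).
- pose b (u : {set 'I_n}) := pnorm m p (fun s => Gamma a ^- #|u| * piece u (ft u) s).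
  have bQ u : ((b u)%:E <= qsum r (fun u => (b u)%:E))%E.
    by apply: le_qsum => // v; exact: pnorm_ge0.
  have h (u : {set 'I_n}) := inLpZ (Gamma a ^- #|u|) (inLp_piece ((proj1 hft) u)).
  have le_sum : pnorm m p (assemble ft) <= \sum_u b u.
    exact: (pnorm_sum (P := xpredT) _ p1' (fun u _ => h u)).
  rewrite -/b; case: (qsum r _) bQ => [Q bQ|_|/(_ finset.set0)//]; last exact: leey.
  rewrite -EFinM lee_fin ler_pdivrMl// (le_trans le_sum)//.
  by rewrite /N mulr_natl -sumr_const; apply: ler_sum => u _; rewrite -lee_fin.
- by case: fF => -[].
- by case: fG => -[].
- exact: density_unique fF fG.
Qed.

(** The representation cut out of [F] has pieces that are restrictions of [F], so none of them
    exceeds the norm of [F]. *)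
Lemma Hnorm_le_pnorm f F : density f F -> (Hnorm a p r f <= (N * pnorm m p F)%:E)%E.
Proof.
move=> fF; have [ft hft FE] := assemble_density fF.
have h (u : {set 'I_n}) := inLpZ (Gamma a ^- #|u|) (inLp_piece ((proj1 hft) u)).
apply: (@le_trans _ _ (qsum r (fun u => (pnorm m p (fun s => Gamma a ^- #|u| * piece u (ft u) s))%:E))).
  apply: ereal_inf_lbound; exists ft => //.
  by congr qsum; apply/funext => u; rewrite (weighted_Lpnorm _ hft).
apply: qsum_le => // [u||u]; rewrite ?pnorm_ge0//.
apply: (le_pnorm (ltW p0) (h u)); first by case: fF.
apply: le_pint => //; [exact: ltW|by case: (h u)|by case: fF => -[]|move=> s].
rewrite FE /assemble; have [su|su] := pselect (off2 (phi s) = u); last first.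
  by rewrite piece_out// mulr0 normr0.
rewrite (bigD1 u)//= big1 ?addr0// => v /eqP vu.
by rewrite piece_out ?mulr0// su => /esym.
Qed.

Lemma Hnorm_equiv : exists2 C : R, 0 < C & forall f F, density f F -> exists h : R,
  [/\ Hnorm a p r f = h%:E, 0 <= h, pnorm m p F <= C * h & h <= C * pnorm m p F].
Proof.
have N0 : 0 < N by rewrite ltr0n; apply/card_gt0P; exists finset.set0.
exists N => // f F fF; have := pnorm_le_Hnorm fF; have := Hnorm_le_pnorm fF.
case: (Hnorm a p r f) => [h|//|]; last by rewrite gt0_muleNy.
rewrite -EFinM !lee_fin => hN Nh; exists h; split=> //.
by rewrite -(pmulr_rge0 _ N0); apply: le_trans Nh; exact: pnorm_ge0.
Qed.

End model.

(** * Step functions *)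

Section atoms.
Context (R : realType) d (T : measurableType d) (m : {finite_measure set T -> \bar R}).

Lemma ler_powR_sum (I : finType) (a : I -> R) p i : 0 < p ->
  `|a i| <= (\sum_j `|a j| `^ p) `^ p^-1.
Proof.
move=> p0; rewrite -[leLHS]powRr1// -(mulfV (lt0r_neq0 p0)) powRrM.
apply: ge0_ler_powR; rewrite ?invr_ge0 ?nnegrE ?powR_ge0 ?(ltW p0)//.
  by apply: sumr_ge0 => j _; exact: powR_ge0.
by rewrite (bigD1 i)//= lerDl; apply: sumr_ge0 => j _; exact: powR_ge0.
Qed.

(** Stated for a sequence with a bound [k] on the index, so that the induction refines the partition
    by one more function without changing the index type. *)
Lemma common_step_dense p (G : nat -> T -> R) e k : 1 <= p -> (forall i, inLp m p (G i)) -> 0 < e ->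
  exists (I : finType) (c : T -> I) (v : nat -> I -> R),
    (forall j, measurable (c @^-1` [set j])) /\
    forall i, (i < k)%N -> pnorm m p (fun x => G i x - v i (c x)) < e.
Proof.
move=> p1 Gp e0; elim: k => [|k [I [c [v [mc ce]]]]].
  exists unit, (fun=> tt), (fun _ _ => 0); split=> // -[].
  by rewrite (_ : _ @^-1` _ = setT)//; apply/seteqP; split.
have [I' [c' [v' [mc' ce']]]] := step_dense (finite_measure_lty m) p1 (Gp k) e0.
exists (I * I')%type, (fun x => (c x, c' x)), (fun i jj => if i == k then v' jj.2 else v i jj.1).
split=> [[j j']|i].
  rewrite (_ : _ @^-1` _ = c @^-1` [set j] `&` c' @^-1` [set j']); first exact: measurableI.
  by apply/seteqP; split=> x /= [-> ->].
rewrite ltnS leq_eqVlt; case: eqP => [->|_] //=; exact: ce.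
Qed.

Lemma pint_disjoint_sum (mu : {measure set T -> \bar R}) (I : finType) (h : I -> T -> R) p : 0 < p -> (forall i, measurable_fun setT (h i)) ->
  (forall x i j, i != j -> h i x = 0 \/ h j x = 0) ->
  (pint mu p (fun x => \sum_i h i x)%R = \sum_i pint mu p (h i))%E.
Proof.
move=> p0 mh hd; rewrite pintE; under [RHS]eq_bigr do rewrite pintE.
rewrite -ge0_integral_sum//; last first.
  by move=> i; exact: measurable_EnormX.
apply: eq_integral => x _; rewrite sumEFin; congr EFin.
have [i hi|h0] := pickP (fun i => h i x != 0); last first.
  rewrite !big1 ?normr0 ?powR0 ?gt_eqF// => i _; have /negbFE/eqP-> := h0 i => //.
  by rewrite normr0 powR0// gt_eqF.
have hj j : j != i -> h j x = 0 by move=> /(hd x)[//|hi0]; rewrite hi0 eqxx in hi.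
rewrite (bigD1 i)//= big1 ?addr0 => [|j /hj//].
by rewrite (bigD1 i)//= big1 ?addr0 // => j /hj ->; rewrite normr0 powR0 ?gt_eqF.
Qed.

Context (p : R) (p1 : 1 < p) (J : finType) (c : T -> J).
Hypothesis mc : forall j, measurable (c @^-1` [set j]).
Let p0 : 0 < p. Proof. exact: lt_trans p1. Qed.

Definition mass j : R := fine (m (c @^-1` [set j])).
(** The indicator of a cell, normalized in $L_p$. On a null cell [powR] returns 0 for the power of
    0, so the atom is the zero function. *)
Definition atom j (y : T) : R := mass j `^ (- p^-1) * \1_(c @^-1` [set j]) y.

Lemma mass_ge0 j : 0 <= mass j. Proof. exact: fine_ge0. Qed.

Lemma atomE j y : atom j y = if c y == j then mass j `^ (- p^-1) else 0.
Proof.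
rewrite /atom indicE; case: eqP => cy; first by rewrite mem_set ?mulr1.
by rewrite memNset ?mulr0.
Qed.

Lemma inLp_atom j : inLp m p (atom j).
Proof. by apply: inLpZ; apply: inLp_indic => //; exact: finite_measure_lty. Qed.

Lemma pint_atom j : pint m p (atom j) = (mass j != 0)%:R%:E.
Proof.
have I1 : inLp m p (\1_(c @^-1` [set j]) : T -> R).
  by apply: inLp_indic => //; exact: finite_measure_lty.
rewrite pintZ// (_ : pint m p _ = (mass j)%:E); last first.
  rewrite pintE (eq_integral (fun x => (\1_(c @^-1` [set j]) x)%:E)); last first.
    move=> x _; rewrite indicE; case: (_ \in _) => /=; first by rewrite normr1 powR1.
    by rewrite normr0 powR0// gt_eqF.
  by rewrite integral_indic// setIT fineK// fin_num_measure.
rewrite -EFinM ger0_norm ?powR_ge0// -powRrM mulNr mulVf ?(gt_eqF p0)//.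
have := mass_ge0 j; rewrite le_eqVlt => /predU1P[<-|m0]; first by rewrite mulr0 eqxx.
by rewrite powRN powRr1 ?(ltW m0)// mulVf (gt_eqF m0).
Qed.

Lemma pnorm_sum_atom (a : J -> R) :
  pnorm m p (fun y => \sum_j a j * atom j y) <= (\sum_j `|a j| `^ p) `^ p^-1.
Proof.
have ap j := inLpZ (a j) (inLp_atom j).
have sp : inLp m p (fun y => \sum_j a j * atom j y) by apply: inLp_sum => //; exact: ltW.
rewrite pnorm_lep ?powR_ge0// -powRrM mulVf ?gt_eqF// powRr1; last first.
  by apply: sumr_ge0 => j _; exact: powR_ge0.
rewrite pint_disjoint_sum//; last 2 first.
- by move=> j; case: (ap j).
- move=> x i j ij; rewrite !atomE; case: eqP => [->|]; last by left; rewrite mulr0.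
  by right; rewrite (negbTE ij) mulr0.
rewrite -sumEFin; apply: lee_sum => j _; rewrite pintZ; last exact: inLp_atom.
rewrite pint_atom -EFinM lee_fin; case: (_ != _); rewrite ?mulr1// mulr0; exact: powR_ge0.
Qed.

Lemma ae_mass_neq0 : {ae m, forall y, mass (c y) != 0}.
Proof.
have : forall j, {ae m, forall y, c y = j -> mass j != 0}.
  move=> j; have [mj|mj] := eqVneq (mass j) 0; last by apply: nearW.
  exists (c @^-1` [set j]); split=> //; first by rewrite -[LHS]fineK ?fin_num_measure// -/(mass j) mj.
  by move=> y /= h; apply: contrapT => cy; apply: h => /cy.
move=> /filter_forall; apply: filterS => y; exact.
Qed.

End atoms.

Section decomposition.
Context (R : realType) d1 d2 (S : measurableType d1) (T : measurableType d2).
Context (m1 : {finite_measure set S -> \bar R}) (m2 : {finite_measure set T -> \bar R}).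
Context (p : R) (p1 : 1 < p).
Let p0 : 0 < p. Proof. exact: lt_trans p1. Qed.
Let p1' : 1 <= p. Proof. exact: ltW. Qed.

(* The [G' i] are the normalized indicators of a partition on which all the
   [G i] are nearly constant, plus the small remainders. *)
Lemma atomic_decomposition k (F : 'I_k -> S -> R) (G : 'I_k -> T -> R) eps :
  (forall i, inLp m1 p (F i)) -> (forall i, inLp m2 p (G i)) -> 0 < eps ->
  exists (I : finType) (F' : I -> S -> R) (G' : I -> T -> R),
  [/\ forall i, inLp m1 p (F' i), forall i, inLp m2 p (G' i),
   forall z, \sum_i tensor (F i) (G i) z = \sum_i tensor (F' i) (G' i) z,
   \sum_i pnorm m1 p (F' i) `^ p <=
     2 * (pnorm (m1 \x m2)%E p (fun z => \sum_i tensor (F i) (G i) z) + eps) `^ p &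
   forall a : I -> R, pnorm m2 p (fun y => \sum_i a i * G' i y) <=
     2 * (\sum_i `|a i| `^ p) `^ p^-1].
Proof.
move=> Fp Gp eps0.
pose H z := \sum_i tensor (F i) (G i) z.
have Hp : inLp (m1 \x m2)%E p H by apply: inLp_sum => // i _; exact: inLp_tensor.
pose M := 1 + \sum_i pnorm m1 p (F i).
have FM i : pnorm m1 p (F i) <= M.
  rewrite /M (bigD1 i)//= addrCA lerDl addr_ge0// sumr_ge0// => j _; exact: pnorm_ge0.
have M1 : 1 <= M by rewrite lerDl sumr_ge0// => j _; exact: pnorm_ge0.
have M0 : 0 < M by exact: lt_le_trans M1.
(* The rescaled $\tau F_i$ have norm at most $\tau M=\epsilon/(k+1)$, and with $\eta=\tau/(k+1)$ the
   $\tau^{-1}r_i$ have norm at most $1/(k+1)$; moreover $kM\eta\le\epsilon$. The successor keeps the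
   quotients meaningful for [k = 0]. *)
pose tau := eps / (k.+1%:R * M).
have tau0 : 0 < tau by rewrite divr_gt0// mulr_gt0.
pose eta := tau / k.+1%:R.
have eta0 : 0 < eta by rewrite divr_gt0.
(* The finite family is continued by 0 to a sequence, as [common_step_dense] expects. *)
have [J [c [v [mc ce]]]] := common_step_dense k p1'
  (G := fun i => oapp G (fun=> 0) (insub i)) (e := eta)
  (fun i => match insub i as o return inLp m2 p (oapp G (fun=> 0) o) with
   | Some j => Gp j | None => inLp0 m2 p0 end) eta0.
(* Undoes the normalization: on a cell of positive mass, [w j] times the atom is the indicator. *)
pose w j : R := mass m2 c j `^ p^-1.
pose e := atom m2 p c.
have ep j : inLp m2 p (e j) by exact: inLp_atom.
pose r i y := G i y - \sum_j (v (val i) j * w j) * e j y.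
have rp i : inLp m2 p (r i).
  by apply: inLpB => //; apply: inLp_sum => // j _; exact: inLpZ.
have r_eta i : pnorm m2 p (r i) <= eta.
  have := ce i (ltn_ord i); rewrite valK/= => /ltW; apply: le_trans.
  have stepE y : v (val i) (c y) = \sum_j v (val i) j * \1_(c @^-1` [set j]) y.
    rewrite (bigD1 (c y))//= indicE mem_set// mulr1 big1 ?addr0// => j /eqP jc.
    by rewrite indicE memNset ?mulr0// => /esym.
  rewrite (@ae_eq_pnorm _ _ _ _ _ _ (fun y => G i y - v (val i) (c y)))//.
  - by case: (rp i).
  - apply: measurable_funB; first by case: (Gp i).
    under eq_fun do rewrite stepE.
    by apply: measurable_sum => j; exact: measurable_funM.
  - move: (ae_mass_neq0 m2 mc); apply: filterS => y my _; rewrite /r; congr (_ - _).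
    rewrite (bigD1 (c y))//= big1 ?addr0 => [|j /negbTE jc]; last first.
      by rewrite /e atomE// eq_sym jc mulr0.
    by rewrite /e atomE// eqxx -mulrA /w powRN mulfV ?mulr1// powR_eq0 negb_and my.
(* The coefficient of the atom [e j] after the sums over [i] and [j] are exchanged. *)
pose F1 j s := w j * \sum_i v (val i) j * F i s.
have F1p j : inLp m1 p (F1 j).
  by apply: inLpZ; apply: inLp_sum => // i _; exact: inLpZ.
have HE z : H z = \sum_j tensor (F1 j) (e j) z + \sum_i tensor (F i) (r i) z.
  rewrite /H /tensor /F1 /r; under [X in _ = X + _]eq_bigr do rewrite mulr_sumr mulr_suml.
  rewrite exchange_big/= -big_split /=; apply: eq_bigr => i _.
  rewrite mulrBr mulr_sumr -[LHS](subrK (\sum_j F i z.1 * (v (val i) j * w j * e j z.2))).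
  rewrite addrC; congr (_ + _); apply: eq_bigr => j _; ring.
pose H1 z := \sum_j tensor (F1 j) (e j) z.
have H1p : inLp (m1 \x m2)%E p H1 by apply: inLp_sum => // i _; exact: inLp_tensor.
(* An equality because the supports are disjoint and the atoms have norm 1; a null cell contributes
   0 on both sides since its [w j] is 0. *)
have F1sum : \sum_j pnorm m1 p (F1 j) `^ p = pnorm (m1 \x m2)%E p H1 `^ p.
  apply: EFin_inj; rewrite pnorm_powR// pint_disjoint_sum//; last 2 first.
  - by move=> j; apply: measurable_tensor; [case: (F1p j)|case: (ep j)].
  - move=> z i j ij; rewrite /tensor /e !atomE//; case: eqP => [->|_]; last by left; rewrite mulr0.
    by right; rewrite (negbTE ij) mulr0.
  rewrite -sumEFin; apply: eq_bigr => j _; rewrite pnorm_powR// pint_tensor// pint_atom//.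
  have [mj|mj] := eqVneq (mass m2 c j) 0; last by rewrite mule1.
  rewrite mule0 (_ : F1 j = fun=> 0); last first.
    by apply/funext => s; rewrite /F1 /w mj powR0 ?mul0r// invr_neq0// gt_eqF.
  rewrite pintE; apply: integral0_eq => s _; by rewrite normr0 powR0// gt_eqF.
have H1le : pnorm (m1 \x m2)%E p H1 <= pnorm (m1 \x m2)%E p H + eps.
  rewrite (_ : H1 = fun z => H z - \sum_i tensor (F i) (r i) z); last first.
    by apply/funext => z; rewrite HE addrK.
  have rt i : inLp (m1 \x m2)%E p (tensor (F i) (r i)) by exact: inLp_tensor.
  apply: le_trans (pnormB p1' Hp _) _; first exact: inLp_sum.
  rewrite lerD2l; apply: le_trans (pnorm_sum (P := xpredT) _ p1' (fun i _ => rt i)) _.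
  apply: (@le_trans _ _ (\sum_(i < k) M * eta)).
    by apply: ler_sum => i _; rewrite pnorm_tensor// ler_pM ?pnorm_ge0.
  rewrite sumr_const card_ord -mulr_natl /eta /tau.
  rewrite (_ : _ * _ = (k%:R / k.+1%:R / k.+1%:R) * eps); last by field; rewrite gt_eqF//= gt_eqF.
  rewrite ler_piMl ?(ltW eps0)// ler_pdivrMr// ler_pdivrMr// !mul1r.
  by rewrite -natrM ler_nat (leq_trans (leqnSn k))// leq_pmulr.
pose F' (x : J + 'I_k) := match x with inl j => F1 j | inr i => fun s => tau * F i s end.
pose G' (x : J + 'I_k) := match x with inl j => e j | inr i => fun y => tau^-1 * r i y end.
have sumJ (V : nmodType) (f : J + 'I_k -> V) : \sum_x f x = \sum_j f (inl j) + \sum_i f (inr i).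
  exact: big_sumType.
exists (J + 'I_k)%type, F', G'; split.
- by case=> [j|i] /=; [exact: F1p|exact: inLpZ].
- by case=> [j|i] /=; [exact: ep|exact: inLpZ].
- move=> z; rewrite -/(H z) HE sumJ; congr (_ + _); apply: eq_bigr => i _.
  by rewrite /tensor /= mulrACA mulfV ?mul1r// gt_eqF.
(* Atoms and remainders are each bounded by the same power, hence the factor 2. *)
- rewrite sumJ /= F1sum mulr_natl mulr2n; apply: lerD.
    by apply: ge0_ler_powR; rewrite ?nnegrE ?pnorm_ge0 ?(ltW p0)// addr_ge0 ?pnorm_ge0 ?ltW.
  apply: (@le_trans _ _ (eps `^ p)); last first.
    apply: ge0_ler_powR; rewrite ?nnegrE ?(ltW p0) ?(ltW eps0) ?addr_ge0 ?pnorm_ge0 ?(ltW eps0)//.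
    by rewrite lerDr pnorm_ge0.
  apply: (@le_trans _ _ (\sum_(i < k) (eps / k.+1%:R) `^ p)).
    apply: ler_sum => i _; apply: ge0_ler_powR; rewrite ?nnegrE ?pnorm_ge0 ?(ltW p0)//.
      by rewrite divr_ge0 ?ltW.
    rewrite pnormZ// ger0_norm ?(ltW tau0)//.
    apply: (@le_trans _ _ (tau * M)); first by rewrite ler_wpM2l// ltW.
    by rewrite le_eqVlt; apply/orP; left; apply/eqP; rewrite /tau; field; rewrite gt_eqF//= gt_eqF.
  rewrite sumr_const card_ord -[leLHS]mulr_natl powRM ?(ltW eps0) ?invr_ge0//.
  rewrite mulrCA ler_piMr ?powR_ge0//.
  apply: (@le_trans _ _ (k%:R * k.+1%:R^-1)).
    rewrite ler_wpM2l// -[leRHS]powRr1 ?invr_ge0//.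
    by apply: ger_powR => //; rewrite invr_gt0 ltr0n/= invf_le1// ler1n.
  by rewrite ler_pdivrMr// mul1r ler_nat.
- move=> a; set A := (\sum_i _) `^ _.
  have aA x : `|a x| <= A by exact: ler_powR_sum.
  have A0 : 0 <= A by exact: powR_ge0.
  rewrite (_ : (fun y => _) = fun y => \sum_j a (inl j) * e j y + \sum_i a (inr i) * (tau^-1 * r i y)); last first.
    by apply/funext => y; rewrite sumJ.
  have s1 j : inLp m2 p (fun y => a (inl j) * e j y) by exact: inLpZ.
  have s2 i : inLp m2 p (fun y => a (inr i) * (tau^-1 * r i y)) by do 2!apply: inLpZ.
  apply: le_trans (pnormD p1' _ _) _; [exact: inLp_sum|exact: inLp_sum|].
  rewrite mulr_natl mulr2n; apply: lerD.
    apply: le_trans (pnorm_sum_atom m2 p1 mc (fun j => a (inl j))) _.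
    apply: ge0_ler_powR; rewrite ?nnegrE ?invr_ge0 ?(ltW p0)//.
    + by apply: sumr_ge0 => j _; exact: powR_ge0.
    + by apply: sumr_ge0 => j _; exact: powR_ge0.
    + by rewrite sumJ lerDl; apply: sumr_ge0 => j _; exact: powR_ge0.
  apply: le_trans (pnorm_sum (P := xpredT) _ p1' (fun i _ => s2 i)) _.
  apply: (@le_trans _ _ (\sum_(i < k) A / k.+1%:R)).
    apply: ler_sum => i _; rewrite pnormZ//; last exact: inLpZ.
    rewrite pnormZ// ler_pM ?pnorm_ge0 ?mulr_ge0 ?pnorm_ge0//.
    rewrite ger0_norm ?invr_ge0 ?(ltW tau0)// mulrC ler_pdivrMr// mulrC.
    exact: r_eta.
  rewrite sumr_const card_ord -[leLHS]mulr_natr -mulrA ler_piMr//.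
  by rewrite mulrC ler_pdivrMr// mul1r ler_nat.
Qed.

End decomposition.

(** * The tensor norm *)

HB.lock Definition lsum (R : realType) (I : finType) (p : R) (x : I -> R) : R :=
  (\sum_i `|x i| `^ p) `^ p^-1.
Canonical lsum_unlockable := Unlockable lsum.unlock.

Section lsum.
Context (R : realType) (I : finType) (p : R) (p0 : 0 < p).
Implicit Types x y : I -> R.

Lemma lsumE x : lsum p x = (\sum_i `|x i| `^ p) `^ p^-1.
Proof. by rewrite unlock. Qed.

Lemma ge0_lsumE x : (forall i, 0 <= x i) -> lsum p x = (\sum_i x i `^ p) `^ p^-1.
Proof. by move=> x0; rewrite lsumE; under eq_bigr do rewrite ger0_norm//. Qed.

Lemma EFin_lsum x : ((\sum_i (`|x i| `^ p)%:E) `^ p^-1)%E = (lsum p x)%:E.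
Proof. by rewrite sumEFin poweR_EFin lsumE. Qed.

Lemma lsum_ge0 x : 0 <= lsum p x. Proof. by rewrite lsumE powR_ge0. Qed.

Lemma le_lsum x y : (forall i, `|x i| <= `|y i|) -> lsum p x <= lsum p y.
Proof.
move=> xy; rewrite !lsumE; apply: ge0_ler_powR; rewrite ?invr_ge0 ?nnegrE ?(ltW p0)//.
- by apply: sumr_ge0 => i _; exact: powR_ge0.
- by apply: sumr_ge0 => i _; exact: powR_ge0.
- by apply: ler_sum => i _; apply: ge0_ler_powR; rewrite ?nnegrE ?(ltW p0).
Qed.

Lemma lsumZ c x : 0 <= c -> lsum p (fun i => c * x i) = c * lsum p x.
Proof.
move=> c0; rewrite !lsumE; under eq_bigr do rewrite normrM powRM//.
rewrite -mulr_sumr powRM ?powR_ge0//; last by apply: sumr_ge0 => i _; exact: powR_ge0.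
by rewrite -powRrM mulfV ?gt_eqF// powRr1// ger0_norm.
Qed.

End lsum.

(** [delta_val] indexes representations by ordinals, while the decompositions come indexed by a
    finite type. *)
Lemma sum_enum_val (V : nmodType) (I : finType) (f : I -> V) :
  \sum_(i < #|I|) f (enum_val i) = \sum_i f i.
Proof.
rewrite [RHS](reindex_onto enum_val enum_rank)/=; last by move=> *; rewrite enum_rankK.
by apply: eq_big => [i|//]; rewrite enum_valK eqxx.
Qed.

(** * Transfer to the spaces of fractional smoothness *)

Section main.
Context (R : realType) (a p q : R) (r : \bar R) (n : nat).
Hypotheses (p1 : 1 < p) (q1 : 1 < q) (pq : p^-1 + q^-1 = 1).
Hypotheses (a0 : 0 < a) (a1 : a <= 1) (aq : -1 < (a - 1) * q) (r1 : (1 <= r)%E).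
Local Notation RR := (measurableTypeR R).
Local Notation nu := (@line_measure R).
Local Notation coord1 := (fun (y : RR) (_ : 'I_1) => (y : R)).
Context d (S : measurableType d) (m : {finite_measure set S -> \bar R}).
Context (phi : S -> 'I_n.+1 -> R) (psi : ('I_n.+1 -> R) -> S).
Hypothesis Pm : presents m phi psi.
Hypothesis Tm : total_kernel m p q (@in_cube R n.+1) (fun x s => cube_kern a x (phi s)).
Local Notation coordp := (fun z : S * RR => extend (phi z.1) z.2).

Let p0 : 0 < p. Proof. exact: lt_trans p1. Qed.
Let q0 : 0 < q. Proof. exact: lt_trans q1. Qed.
Let p1' : 1 <= p. Proof. exact: ltW. Qed.
Let a01 : 0 < a <= 1. Proof. exact/andP. Qed.
Let Pl := @presents_line R.
Let Tl := total_cube_line p1 q0 pq a01 aq.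
Let Pp := presents_prod Pm.
Let Tp := total_cube_prod p1 q0 pq a01 aq Tm.
Context (N1 N2 N3 : R).
Hypotheses (N1_gt0 : 0 < N1) (N2_gt0 : 0 < N2) (N3_gt0 : 0 < N3).
Hypothesis Hnorm1 : forall f F, density m phi a p f F -> exists h : R,
  [/\ Hnorm a p r f = h%:E, 0 <= h, pnorm m p F <= N1 * h & h <= N1 * pnorm m p F].
Hypothesis Hnorm2 : forall f F, density nu coord1 a p f F -> exists h : R,
  [/\ Hnorm a p r f = h%:E, 0 <= h, pnorm nu p F <= N2 * h & h <= N2 * pnorm nu p F].
Hypothesis Hnorm3 : forall f F, density (m \x nu)%E coordp a p f F -> exists h : R,
  [/\ Hnorm a p r f = h%:E, 0 <= h, pnorm (m \x nu)%E p F <= N3 * h &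
      h <= N3 * pnorm (m \x nu)%E p F].

(** The kernel in all coordinates is the product of the kernels in the first [n.+1] and in the last
    one, so tensors of densities represent tensors of functions. *)
Lemma density_tens k (f : 'I_k -> ('I_n.+1 -> R) -> R) g F G :
  (forall i, density m phi a p (f i) (F i)) ->
  (forall i, density nu coord1 a p (g i) (G i)) ->
  density (m \x nu)%E coordp a p (@tens R n.+2 k f g) (fun z => \sum_i tensor (F i) (G i) z).
Proof.
move=> fF gG; have Fp i := (fF i).1; have Gp i := (gG i).1.
have FGp i : inLp (m \x nu)%E p (tensor (F i) (G i)) by exact: inLp_tensor.
split=> [|x x01]; first exact: inLp_sum.
rewrite (pairing_suml p1 q0 pq)//; last exact: (Tp.1).
have fx01 : in_cube (front x) by move=> j; exact: x01.
have lx01 : in_cube (fun _ : 'I_1 => x ord_max) by move=> j; exact: x01.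
apply: eq_bigr => i _; rewrite /last_coord.
have -> : @init_coords R n.+2 x = front x.
  by apply/funext => j; rewrite /init_coords /front; congr x; apply: val_inj; rewrite [RHS]lift_max.
rewrite (fF i).2// (gG i).2// -(pairing_tensor p1 q1 pq)//; last 2 first.
- exact: Tm.1.
- exact: Tl.1.
by congr pairing; apply/funext => z; rewrite cube_kernS /tensor /= cube_kern1.
Qed.

(** Division by [N2] puts the pairing with [k] into the dual ball, the norm of a density being at
    most [N2] times [Hnorm]. The functional is 0 outside the space, and uniqueness of the density
    makes it independent of the chosen [G]. *)
Lemma dual_ball_pairing k : inLp nu q k -> pnorm nu q k <= 1 ->
  exists2 ps, @dual_ball R 1 a p r ps &
    forall g G, density nu coord1 a p g G -> ps g = N2^-1 * pairing nu G k.
Proof.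
move=> kq k1.
pose ps (g : ('I_1 -> R) -> R) := if pselect (exists G, density nu coord1 a p g G) is left h
  then N2^-1 * pairing nu (projT1 (cid h)) k else 0.
have psE g G : density nu coord1 a p g G -> ps g = N2^-1 * pairing nu G k.
  move=> gG; rewrite /ps; case: pselect => [h|]; last by case; exists G.
  case: cid => G' gG' /=; congr (_ * _).
  apply: (ae_eq_pairing p1 q0 pq) => //; [exact: gG'.1|exact: gG.1|].
  exact: (density_unique p1 q0 pq Tl gG' gG).
exists ps => //; split.
  move=> c e g1 g2 /(inHP Pl p1 q0 pq a0 a1 Tl)[G1 gG1] /(inHP Pl p1 q0 pq a0 a1 Tl)[G2 gG2].
  rewrite (psE _ _ (density_lin p1 q0 pq Tl c e gG1 gG2)) (psE _ _ gG1) (psE _ _ gG2).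
  have [G1p _] := gG1; have [G2p _] := gG2.
  have [cG eG] := (inLpZ c G1p, inLpZ e G2p).
  rewrite (pairingDl p1 q0 pq cG eG kq) !(pairingZl p1 q0 pq _ _ kq)//; ring.
move=> g /(inHP Pl p1 q0 pq a0 a1 Tl)[G gG]; rewrite (psE _ _ gG).
have [h [-> h0 Gh _]] := Hnorm2 gG.
rewrite lee_fin normrM ger0_norm ?invr_ge0 ?(ltW N2_gt0)// ler_pdivrMl ?N2_gt0//.
apply: le_trans Gh; apply: le_trans (pairing_hoelder p0 q0 pq gG.1 kq) _.
by rewrite ler_piMr ?pnorm_ge0.
Qed.

Lemma dual_ball_sum ps (I : finType) (c : I -> R) (g : I -> ('I_1 -> R) -> R) :
  @dual_ball R 1 a p r ps -> (forall i, inH a p (g i)) ->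
  ps (fun x => \sum_i c i * g i x) = \sum_i c i * ps (g i).
Proof.
move=> [lin _] gH.
have H0 : inH a p (fun _ : 'I_1 -> R => 0).
  apply/(inHP Pl p1 q0 pq a0 a1 Tl); exists (fun=> 0); split; first exact: inLp0.
  by move=> x _; rewrite pairingE; under eq_Rintegral do rewrite mul0r; rewrite Rintegral_cst// mul0r.
suff H (s : seq I) : inH a p (fun x => \sum_(i <- s) c i * g i x) /\
    ps (fun x => \sum_(i <- s) c i * g i x) = \sum_(i <- s) c i * ps (g i).
  by have [] := H (index_enum I).
elim: s => [|i s [sH IH]].
  rewrite big_nil; under eq_fun do rewrite big_nil; split=> //.
  have lin0 := lin 0 0 _ _ H0 H0; rewrite [X in _ = X + _]mul0r [X in _ = _ + X]mul0r addr0 in lin0.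
  by rewrite -[RHS]lin0; congr ps; apply/funext => x; rewrite mul0r addr0.
have E : (fun x => \sum_(i <- i :: s) c i * g i x) =
    (fun x => c i * g i x + 1 * \sum_(i <- s) c i * g i x).
  by apply/funext => x; rewrite big_cons mul1r.
rewrite E; split; last by rewrite lin// IH mul1r big_cons.
move: (gH i) sH => /(inHP Pl p1 q0 pq a0 a1 Tl)[G1 gG1] /(inHP Pl p1 q0 pq a0 a1 Tl)[G2 gG2].
apply/(inHP Pl p1 q0 pq a0 a1 Tl); eexists; exact: (density_lin p1 q0 pq Tl (c i) 1 gG1 gG2).
Qed.

(* Testing the functional on the combination with coefficients
   [sgn b |b|^(q-1)], which is extremal in Hoelder's inequality. *)
Lemma weak_norm_le ps (I : finType) (g : I -> ('I_1 -> R) -> R) G C :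
  @dual_ball R 1 a p r ps -> (forall i, density nu coord1 a p (g i) (G i)) -> 0 <= C ->
  (forall c : I -> R, pnorm nu p (fun y => \sum_i c i * G i y) <= C * lsum p c) ->
  lsum q (fun i => ps (g i)) <= N2 * C.
Proof.
move=> psB gG C0 GC; pose b i := ps (g i); pose X := \sum_i `|b i| `^ q.
have X0 : 0 <= X by apply: sumr_ge0 => i _; exact: powR_ge0.
pose c i := Num.sg (b i) * `|b i| `^ (q - 1).
have gH i : inH a p (g i) by apply/(inHP Pl p1 q0 pq a0 a1 Tl); exists (G i).
have cb i : c i * b i = `|b i| `^ q.
  rewrite /c mulrAC -normrEsg mulrC.
  have [->|b0] := eqVneq (b i) 0; first by rewrite normr0 mulr0 powR0// gt_eqF.
  rewrite -[X in _ * X]powRr1// -powRD ?subrK//.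
  by rewrite normr_eq0 b0 implybT.
have cp i : `|c i| `^ p = `|b i| `^ q.
  have [b0|b0] := eqVneq (b i) 0.
    by rewrite /c b0 sgr0 mul0r normr0 !powR0// gt_eqF.
  rewrite /c normrM normr_sg b0 mul1r ger0_norm ?powR_ge0// -powRrM.
  by rewrite (conj_mul q1 p0)// addrC.
have dG : density nu coord1 a p (fun x => \sum_i c i * g i x) (fun y => \sum_i c i * G i y).
  have cGp i : inLp nu p (fun y => c i * G i y) by apply: inLpZ; exact: (gG i).1.
  split=> [|x x01]; first exact: inLp_sum.
  have Kx := Tl.1 x x01.
  rewrite (pairing_suml p1 q0 pq)//; apply: eq_bigr => i _.
  by rewrite (pairingZl p1 q0 pq)//; [rewrite (gG i).2|exact: (gG i).1].
have [h [hE h0 _ hG]] := Hnorm2 dG.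
have XE : X = ps (fun x => \sum_i c i * g i x).
  by rewrite (dual_ball_sum _ psB)//; apply: eq_bigr => i _; rewrite -cb.
(* Dividing by $X^{1/p}$ leaves $X^{1/q}\le N_2C$, the claim. *)
have XC : X <= N2 * (C * X `^ p^-1).
  apply: (@le_trans _ _ h).
    rewrite XE -lee_fin -hE; apply: le_trans (psB.2 _ _); first by rewrite lee_fin ler_norm.
    by apply/(inHP Pl p1 q0 pq a0 a1 Tl); eexists; exact: dG.
  apply: (le_trans hG); apply: ler_wpM2l; first exact: ltW.
  suff <- : lsum p c = X `^ p^-1 by exact: GC.
  by rewrite lsumE; under eq_bigr do rewrite cp.
have [X00|Xn0] := eqVneq X 0.
  by rewrite lsumE -/X X00 powR0 ?invr_eq0 ?gt_eqF// mulr_ge0// ltW.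
have Xgt0 : 0 < X by rewrite lt_neqAle eq_sym Xn0.
rewrite lsumE -/X -(@ler_pM2r _ (X `^ p^-1)) ?powR_gt0// -powRD; last by rewrite Xn0 implybT.
by rewrite addrC pq powRr1// -mulrA.
Qed.

Lemma density_eq_cube (h h' : ('I_n.+2 -> R) -> R) H :
  (forall x, in_cube x -> h x = h' x) -> density (m \x nu)%E coordp a p h' H ->
  density (m \x nu)%E coordp a p h H.
Proof. by move=> hh' [Hp hE]; split=> // x x01; rewrite hh'// hE. Qed.

Hypothesis qE : p / (p - 1) = q.

(** [N1] and [N2] pay for passing from the [f i] and from the dual ball to densities, [N3] for
    returning from the density of [h] to [h]. The bound holds for each representation separately,
    hence for the infimum. *)
Lemma le_delta_val k f g (h : ('I_n.+2 -> R) -> R) : @tens_rep R n.+2 a p h k f g ->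
  (((N3 * N1 * N2)^-1)%:E * Hnorm a p r h <= @delta_val R n.+2 a p r k f g)%E.
Proof.
move=> [fH [gH hE]].
have [F fF] := boolp.choice (fun i => (inHP Pm p1 q0 pq a0 a1 Tm _).1 (fH i)).
have [G gG] := boolp.choice (fun i => (inHP Pl p1 q0 pq a0 a1 Tl _).1 (gH i)).
have hH := density_eq_cube hE (density_tens fF gG).
have [hh [-> hh0 _ hhH]] := Hnorm3 hH.
have [hf Hf] := boolp.choice (fun i => Hnorm1 (fF i)).
have [hg Hg] := boolp.choice (fun i => Hnorm2 (gG i)).
rewrite /delta_val qE; set sup := ereal_sup _.
have -> : (\sum_(i < k) Hnorm a p r (f i) `^ p)%E = (\sum_(i < k) (`|hf i| `^ p)%:E)%E.
  by apply: eq_bigr => i _; have [-> ? _ _] := Hf i; rewrite ger0_norm// poweR_EFin.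
rewrite EFin_lsum.
have sup_ge ps : @dual_ball R 1 a p r ps -> ((lsum q (fun i => ps (g i)))%:E <= sup)%E.
  by move=> psB; apply: ereal_sup_ubound; exists ps => //; rewrite EFin_lsum.
(* Makes the supremum finite, so that it can be handled as a real number [W]. *)
have sup_le : (sup <= (lsum q hg)%:E)%E.
  apply: ge_ereal_sup => _ [ps psB <-]; rewrite EFin_lsum lee_fin; apply: le_lsum => // i.
  by rewrite -lee_fin; have [hgE hg0 _ _] := Hg i; rewrite (ger0_norm hg0) -hgE; exact: psB.2.
have ball0 : @dual_ball R 1 a p r (fun=> 0).
  split=> [*|e /(inHP Pl p1 q0 pq a0 a1 Tl)[E eE]]; first by rewrite !mulr0 addr0.
  by rewrite normr0; have [he [-> ? _ _]] := Hnorm2 eE; rewrite lee_fin.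
have sup0 : (0 <= sup)%E by apply: le_trans (sup_ge _ ball0); rewrite lee_fin lsum_ge0.
case: sup sup_ge sup_le sup0 => [W sup_ge _ W0|_|_] //; rewrite -!EFinM !lee_fin in W0 *.
have F_hf : lsum p (fun i => pnorm m p (F i)) <= N1 * lsum p hf.
  rewrite -(lsumZ p0 hf (ltW N1_gt0)); apply: (le_lsum p0) => i.
  have [_ hf0 hfF _] := Hf i.
  by rewrite ger0_norm ?pnorm_ge0// ger0_norm// mulr_ge0// ltW.
have HW : pnorm (m \x nu)%E p (fun z => \sum_i tensor (F i) (G i) z) <=
    lsum p (fun i => pnorm m p (F i)) * (N2 * W).
  rewrite ge0_lsumE => [|i]; last exact: pnorm_ge0.
  apply: (pnorm_tensor_sum p1 q1 pq) => [i|i||l lq l1].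
  - exact: (fF i).1.
  - exact: (gG i).1.
  - by rewrite mulr_ge0// ltW.
  have [ps psB psE] := dual_ball_pairing lq l1.
  have := sup_ge _ psB; rewrite lee_fin => psW.
  rewrite -lsumE -(ler_pM2l (x := N2^-1)) ?invr_gt0// mulKf ?gt_eqF//.
  have N2V : 0 <= N2^-1 by rewrite invr_ge0 ltW.
  rewrite -(lsumZ q0 _ N2V).
  by under eq_fun do rewrite -(psE _ _ (gG _)).
rewrite ler_pdivrMl ?mulr_gt0//; apply: (le_trans hhH).
rewrite -!mulrA ler_wpM2l ?(ltW N3_gt0)//; apply: (le_trans HW).
rewrite [leRHS](_ : _ = (N1 * lsum p hf) * (N2 * W)); last by ring.
by apply: ler_wpM2r => //; rewrite mulr_ge0// ltW.
Qed.

(** The factors found by [atomic_decomposition] are densities of functions obtained by pairing with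
    the kernel, which gives a new representation of [h]. The 4 is a factor 2 for the first factors,
    from $2^{1/p}\le2$, times a factor 2 for the weak norm of the second ones; then [eps] tends to
    0. *)
Lemma delta_p_le (h : ('I_n.+2 -> R) -> R) : in_alg_tensor a p h ->
  (delta_p a p r h <= (4 * N1 * N2 * N3)%:E * Hnorm a p r h)%E.
Proof.
move=> [k [f [g [fH [gH hE]]]]].
have [F fF] := boolp.choice (fun i => (inHP Pm p1 q0 pq a0 a1 Tm _).1 (fH i)).
have [G gG] := boolp.choice (fun i => (inHP Pl p1 q0 pq a0 a1 Tl _).1 (gH i)).
have hH := density_eq_cube hE (density_tens fF gG).
have [hh [-> hh0 Hhh _]] := Hnorm3 hH.
set nH := pnorm _ _ _ in Hhh.
suff approx eps : 0 < eps -> (delta_p a p r h <= (4 * N1 * N2 * (nH + eps))%:E)%E.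
  have C0 : 0 < 4 * N1 * N2 by rewrite !mulr_gt0.
  rewrite -EFinM; apply/lee_addgt0Pr => e e0; apply: le_trans (approx _ (divr_gt0 e0 C0)) _.
  rewrite -EFinD lee_fin mulrDr [X in _ + X <= _]mulrC divfK ?gt_eqF// lerD2r.
  by rewrite -[leRHS]mulrA; apply: ler_wpM2l => //; exact: ltW.
move=> eps0.
have [I [F' [G' [F'p G'p HE F'le G'le]]]] :=
  atomic_decomposition p1 (fun i => (fF i).1) (fun i => (gG i).1) eps0.
pose f' (i : 'I_#|I|) := fun x : 'I_n.+1 -> R => pairing m (F' (enum_val i)) (fun s => cube_kern a x (phi s)).
pose g' (i : 'I_#|I|) := fun x : 'I_1 -> R => pairing nu (G' (enum_val i)) (fun y => cube_kern a x (fun=> y)).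
have fF' i : density m phi a p (f' i) (F' (enum_val i)) by [].
have gG' i : density nu coord1 a p (g' i) (G' (enum_val i)) by [].
have rep' : @tens_rep R n.+2 a p h _ f' g'.
  split=> [i|]; first by apply/(inHP Pm p1 q0 pq a0 a1 Tm); eexists; exact: fF'.
  split=> [i|x x01]; first by apply/(inHP Pl p1 q0 pq a0 a1 Tl); eexists; exact: gG'.
  rewrite hH.2// (density_tens fF' gG').2//; congr pairing; apply/funext => z.
  by rewrite HE -sum_enum_val.
apply: (@le_trans _ _ (@delta_val R n.+2 a p r _ f' g')).
  apply: ereal_inf_lbound.
  by exists (existT _ #|I| (f', g')).
have [hf Hf] := boolp.choice (fun i => Hnorm1 (fF' i)).
rewrite /delta_val qE.
have -> : (\sum_(i < #|I|) Hnorm a p r (f' i) `^ p)%E = (\sum_(i < #|I|) (`|hf i| `^ p)%:E)%E.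
  by apply: eq_bigr => i _; have [-> ? _ _] := Hf i; rewrite ger0_norm// poweR_EFin.
rewrite EFin_lsum (_ : 4 * N1 * N2 * (nH + eps) = (N1 * (2 * (nH + eps))) * (N2 * 2)); last by ring.
rewrite EFinM; apply: lee_pmul.
- by rewrite lee_fin lsum_ge0.
- apply: le_ereal_sup_tmp; exists 0%E => //; exists (fun=> 0).
    split=> [*|e /(inHP Pl p1 q0 pq a0 a1 Tl)[E eE]]; first by rewrite !mulr0 addr0.
    by rewrite normr0; have [he [-> ? _ _]] := Hnorm2 eE; rewrite lee_fin.
  rewrite EFin_lsum lsumE big1 ?powR0 ?invr_eq0 ?gt_eqF// => i _.
  by rewrite normr0 powR0// gt_eqF.
- rewrite lee_fin; apply: (@le_trans _ _ (N1 * lsum p (fun i => pnorm m p (F' (enum_val i))))).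
    rewrite -(lsumZ p0 _ (ltW N1_gt0)); apply: (le_lsum p0) => i.
    by have [_ hf0 _ hfF] := Hf i; rewrite ger0_norm// (le_trans hfF)// ler_norm.
  apply: ler_wpM2l; first exact: ltW.
  rewrite ge0_lsumE => [|i]; last exact: pnorm_ge0.
  rewrite (sum_enum_val (fun i => pnorm m p (F' i) `^ p)).
  have e0 : 0 <= nH + eps by rewrite addr_ge0 ?pnorm_ge0 ?ltW.
  apply: (@le_trans _ _ ((2 * (nH + eps) `^ p) `^ p^-1)).
    apply: ge0_ler_powR => //; rewrite ?invr_ge0 ?nnegrE ?(ltW p0)//.
      by apply: sumr_ge0 => i _; exact: powR_ge0.
    by rewrite mulr_ge0 ?powR_ge0.
  rewrite powRM ?powR_ge0// -powRrM mulfV ?gt_eqF// powRr1//; apply: ler_wpM2r => //.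
  rewrite -[leRHS]powRr1//; apply: ler_powR; first by rewrite ler1n.
  by rewrite invf_le1.
- apply: ge_ereal_sup => _ [ps psB <-]; rewrite EFin_lsum lee_fin.
  apply: (weak_norm_le psB gG') => // c.
  have := G'le (fun i => c (enum_rank i)).
  rewrite (_ : (fun y => _) = (fun y => \sum_i c i * G' (enum_val i) y)); last first.
    by apply/funext => y; rewrite -sum_enum_val; apply: eq_bigr => i _; rewrite enum_valK.
  suff -> : \sum_i `|c (enum_rank i)| `^ p = \sum_i `|c i| `^ p by rewrite lsumE.
  by rewrite -sum_enum_val; apply: eq_bigr => i _; rewrite enum_valK.
Qed.

Lemma density_sub (h h' : ('I_n.+2 -> R) -> R) H H' :
  density (m \x nu)%E coordp a p h H -> density (m \x nu)%E coordp a p h' H' ->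
  density (m \x nu)%E coordp a p (fun x => h x - h' x) (fun z => H z - H' z).
Proof.
move=> hH hH'; have -> : (fun x => h x - h' x) = (fun x => 1 * h x + -1 * h' x).
  by apply/funext => x; rewrite mul1r mulN1r.
have -> : (fun z => H z - H' z) = (fun z => 1 * H z + -1 * H' z).
  by apply/funext => z; rewrite mul1r mulN1r.
exact: (density_lin p1 q0 pq Tp).
Qed.

Lemma alg_tensor_dense (h : ('I_n.+2 -> R) -> R) e : inH a p h -> 0 < e ->
  exists h', in_alg_tensor a p h' /\ (Hnorm a p r (fun x => h x - h' x)%R < e%:E)%E.
Proof.
move=> /(inHP Pp p1 q0 pq a0 a1 Tp)[H hH] e0.
have [I [F [G [Fp [Gp HFG]]]]] := tensor_dense p1 hH.1 (divr_gt0 e0 N3_gt0).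
pose f (i : 'I_#|I|) := fun x : 'I_n.+1 -> R => pairing m (F (enum_val i)) (fun s => cube_kern a x (phi s)).
pose g (i : 'I_#|I|) := fun x : 'I_1 -> R => pairing nu (G (enum_val i)) (fun y => cube_kern a x (fun=> y)).
have fF i : density m phi a p (f i) (F (enum_val i)) by [].
have gG i : density nu coord1 a p (g i) (G (enum_val i)) by [].
exists (@tens R n.+2 _ f g); split.
  exists _, f, g; split=> [i|]; first by apply/(inHP Pm p1 q0 pq a0 a1 Tm); eexists; exact: fF.
  by split=> // i; apply/(inHP Pl p1 q0 pq a0 a1 Tl); eexists; exact: gG.
have [he [-> _ _ heH]] := Hnorm3 (density_sub hH (density_tens fF gG)).
rewrite lte_fin; apply: le_lt_trans heH _; rewrite mulrC -ltr_pdivlMr//.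
by apply: le_lt_trans HFG; under [X in pnorm _ _ X]eq_fun do rewrite (sum_enum_val (fun i => tensor (F i) (G i) _)).
Qed.

(** The densities form a Cauchy sequence in $L_p$; pairing their limit with the kernel defines the
    limit function. *)
Lemma H_complete (u : nat -> ('I_n.+2 -> R) -> R) : (forall k, inH a p (u k)) ->
  (forall e : R, 0 < e -> exists N, forall i k, (N <= i)%N -> (N <= k)%N ->
     (Hnorm a p r (fun x => (u i x - u k x)%R) < e%:E)%E) ->
  exists F, inH a p F /\
    (forall e : R, 0 < e -> exists N, forall k, (N <= k)%N ->
       (Hnorm a p r (fun x => (u k x - F x)%R) < e%:E)%E).
Proof.
move=> uH ucauchy.
have [U uU] := boolp.choice (fun k => (inHP Pp p1 q0 pq a0 a1 Tp _).1 (uH k)).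
have [||G [Gp UG]] := Lp_complete (product_measure_lty m nu) p1' q0 pq (F := U).
- by move=> k; exact: (uU k).1.
- move=> e e0; have [N Ne] := ucauchy _ (divr_gt0 e0 N3_gt0).
  exists N => i k Ni Nk; have [h [hE _ hU _]] := Hnorm3 (density_sub (uU i) (uU k)).
  apply: le_lt_trans hU _; rewrite mulrC -ltr_pdivlMr//.
  by rewrite -lte_fin -hE; exact: Ne.
pose F x := pairing (m \x nu)%E G (fun z => cube_kern a x (coordp z)).
have FG : density (m \x nu)%E coordp a p F G by [].
exists F; split; first by apply/(inHP Pp p1 q0 pq a0 a1 Tp); exists G.
move=> e e0; have [N Ne] := UG _ (divr_gt0 e0 N3_gt0).
exists N => k Nk; have [h [-> _ _ hU]] := Hnorm3 (density_sub (uU k) FG).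
rewrite lte_fin; apply: le_lt_trans hU _; rewrite mulrC -ltr_pdivlMr//.
exact: Ne.
Qed.

End main.

Theorem theorem4 (R : realType) (p alpha : R) (s : nat) (q : \bar R) :
  1 < p -> p^-1 < alpha <= 1 -> (2 <= s)%N -> (1 <= q)%E ->
  [/\ (* the algebraic tensor product lies in H_{alpha,s,p} *)
      (forall (n : nat) (f : 'I_n -> ('I_(s - 1) -> R) -> R)
              (g : 'I_n -> ('I_1 -> R) -> R),
         (forall i, inH alpha p (f i)) -> (forall i, inH alpha p (g i)) ->
         inH alpha p (tens f g)),
      (* delta_p is equivalent to the norm of H_{alpha,s,p} on it *)
      (exists c C : R, 0 < c /\ 0 < C /\
         forall h : ('I_s -> R) -> R, in_alg_tensor alpha p h ->
           (c%:E * Hnorm alpha p q h <= delta_p alpha p q h)%E /\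
           (delta_p alpha p q h <= C%:E * Hnorm alpha p q h)%E),
      (* it is dense in H_{alpha,s,p} *)
      (forall F : ('I_s -> R) -> R, inH alpha p F ->
         forall e : R, 0 < e -> exists h, in_alg_tensor alpha p h /\
           (Hnorm alpha p q (fun x => (F x - h x)%R) < e%:E)%E)
    & (* and H_{alpha,s,p} is complete, so it is the completion *)
      (forall u : nat -> ('I_s -> R) -> R, (forall k, inH alpha p (u k)) ->
         (forall e : R, 0 < e -> exists N, forall m k, (N <= m)%N -> (N <= k)%N ->
            (Hnorm alpha p q (fun x => (u m x - u k x)%R) < e%:E)%E) ->
         exists F, inH alpha p F /\
           (forall e : R, 0 < e -> exists N, forall k, (N <= k)%N ->
              (Hnorm alpha p q (fun x => (u k x - F x)%R) < e%:E)%E))].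
Proof.
move=> p1 /andP[pa a1] + r1; case: s => [|[|n]]// _.
have p0 : 0 < p by exact: lt_trans p1.
have a0 : 0 < alpha by apply: lt_trans pa; rewrite invr_gt0.
have a01 : 0 < alpha <= 1 by rewrite a0.
pose p' := p / (p - 1); have pm0 : 0 < p - 1 by rewrite subr_gt0.
have p'1 : 1 < p' by rewrite ltr_pdivlMr// mul1r; lra.
have p'0 : 0 < p' by exact: lt_trans p'1.
have pp' : p^-1 + p'^-1 = 1 by rewrite /p'; field; rewrite !gt_eqF.
(* From $\alpha>1/p$: $(\alpha-1)p'>(1/p-1)p'=-1$, so the kernel lies in $L_{p'}$. *)
have ap' : -1 < (alpha - 1) * p'.
  have E : (p^-1 - 1) * p' = -1 by rewrite /p'; field; rewrite !gt_eqF.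
  by rewrite -[ltLHS]E ltr_pM2r// ltrD2r.
(* Here [s] is [n.+2]. The model for [s - 1] coordinates comes from [presents_exists]; the one for
   [s] is its product with the line, which carries the tensor structure. *)
have [d [S [m [phi [psi [Pm Tm]]]]]] := presents_exists p1 p'0 pp' a01 ap' n.
have Pl := presents_line R; have Tl := total_cube_line p1 p'0 pp' a01 ap'.
have Pp := presents_prod Pm; have Tp := total_cube_prod p1 p'0 pp' a01 ap' Tm.
have [N1 N1_gt0 H1] := Hnorm_equiv Pm p1 p'0 pp' a0 a1 Tm r1.
have [N2 N2_gt0 H2] := Hnorm_equiv Pl p1 p'0 pp' a0 a1 Tl r1.
have [N3 N3_gt0 H3] := Hnorm_equiv Pp p1 p'0 pp' a0 a1 Tp r1.
split.
- move=> k f g fH gH.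
  have [F fF] := boolp.choice (fun i => (inHP Pm p1 p'0 pp' a0 a1 Tm _).1 (fH i)).
  have [G gG] := boolp.choice (fun i => (inHP Pl p1 p'0 pp' a0 a1 Tl _).1 (gH i)).
  apply/(inHP Pp p1 p'0 pp' a0 a1 Tp); eexists.
  exact: (density_tens p1 p'1 pp' a0 a1 ap' Tm fF gG).
- exists (N3 * N1 * N2)^-1, (4 * N1 * N2 * N3).
  split; first by rewrite invr_gt0 !mulr_gt0.
  split=> [|h hT]; first by rewrite !mulr_gt0.
  split.
    apply: le_ereal_inf_tmp => _ [[k [f g]] rep <-].
    exact: (le_delta_val p1 p'1 pp' a0 a1 ap' Pm Tm N1_gt0 N2_gt0 N3_gt0 H1 H2 H3).
  exact: (delta_p_le p1 p'1 pp' a0 a1 ap' Pm Tm N1_gt0 N2_gt0 H1 H2 H3).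
- by move=> F FH e e0; exact: (alg_tensor_dense p1 p'1 pp' a0 a1 ap' Pm Tm N3_gt0 H3).
- by move=> u uH uc; exact: (H_complete p1 p'1 pp' a0 a1 ap' Pm Tm N3_gt0 H3).
Qed.
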